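(* Let $K$ be a field, let $\mathcal{P}$ be a closed path polyomino having zig-zag walks, and let $Z_{\mathcal{P}}\subset S_{\mathcal{P}}$ be the ideal generated by the binomials $f_{\mathcal{W}}$ for every zig-zag walk $\mathcal{W}$ of $\mathcal{P}$. Then $I_{\mathcal{P}}+Z_{\mathcal{P}}=J_{\mathcal{P}}$, where $J_{\mathcal{P}}$ is the toric ideal defined in the context.
   Context: Intervals and cells: for $a=(i,j)\le b=(k,l)$ in $\mathbb{Z}^2$ (componentwise order), $[a,b]=\{(m,n)\in\mathbb{Z}^2: i\le m\le k,\ j\le n\le l\}$. If $i<k$ and $j<l$ it is a proper interval, with diagonal corners $a,b$ and anti-diagonal corners $(i,l),(k,j)$; its vertex set consists of these four corners, and its edges are its four sides. A cell is an interval $[a,a+(1,1)]$. A polyomino is a non-empty finite set $\mathcal{P}$ of cells such that any two of its cells are joined by a sequence of cells of $\mathcal{P}$ in which consecutive cells share an edge. $V(\mathcal{P})$ is the set of all vertices of cells of $\mathcal{P}$. An inner interval of $\mathcal{P}$ is a proper interval $I$ such that every cell contained in $I$ belongs to $\mathcal{P}$. An edge interval of $\mathcal{P}$ is a horizontal or vertical interval $[a,b]$ (with $a,b$ on a common horizontal or vertical line) all of whose unit segments are edges of cells of $\mathcal{P}$; it is maximal if it is not properly contained in another one. Ideal: $S_{\mathcal{P}}=K[x_a: a\in V(\mathcal{P})]$, and $I_{\mathcal{P}}$ is generated by the binomials $x_ax_b-x_cx_d$ for all inner intervals $[a,b]$ of $\mathcal{P}$, with $a,b$ the diagonal and $c,d$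 the anti-diagonal corners. Closed path: a polyomino $\mathcal{P}=\{A_1,\dots,A_n\}$ with $n>5$, the $A_i$ pairwise distinct, such that (indices mod $n$) $A_i\cap A_{i+1}$ is a common edge for all $i$, and $V(A_i)\cap V(A_j)=\emptyset$ whenever $j\notin\{i-2,i-1,i,i+1,i+2\}$. Zig-zag walk of $\mathcal{P}$: a sequence $\mathcal{W}:I_1,\dots,I_l$ of distinct inner intervals where each $I_i$ has diagonal corners $v_i,z_i$ and anti-diagonal corners $u_i,v_{i+1}$, or anti-diagonal corners $v_i,z_i$ and diagonal corners $u_i,v_{i+1}$, such that: (1) $I_1\cap I_l=\{v_1=v_{l+1}\}$ and $I_i\cap I_{i+1}=\{v_{i+1}\}$ for $i=1,\dots,l-1$; (2) $v_i,v_{i+1}$ lie on the same edge interval of $\mathcal{P}$ for $i=1,\dots,l$; (3) for $i\ne j$ there is no inner interval $J$ of $\mathcal{P}$ with $z_i,z_j\in J$. Put $f_{\mathcal{W}}=\prod_{i=1}^l x_{z_i}-\prod_{i=1}^l x_{u_i}$. Toric ideal $J_{\mathcal{P}}$: let $C_{p,q}$ denote the cell with lower left corner $(p,q)$. Fix an isometry $\sigma$ of $\mathbb{Z}^2$ (a composition of translations, rotations by multiples of $90^\circ$ and reflections in horizontal or vertical lines) such that the images under $\sigma$ of the five cells $C_{0,2},C_{0,1},C_{1,1},C_{1,0},C_{2,0}$ all belong to $\mathcal{P}$ (every closed path with zig-zag walks contains such a configuration), and put $a=\sigma((0,2))$, $b=\sigma((1,2))$, $c=\sigma((0,1))$, $d=\sigma((1,1))$,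 $e=\sigma((1,0))$. Let $\{V_i\}_{i\in I}$ and $\{H_j\}_{j\in J}$ be the sets of maximal vertical and maximal horizontal edge intervals of $\mathcal{P}$, and let $\{v_i\}_{i\in I}$, $\{h_j\}_{j\in J}$, $w$ be distinct variables. For $r\in V(\mathcal{P})$ with $r\in V_i\cap H_j$ put $\alpha(r)=v_ih_jw^k$, where $k=1$ if $r\in\{a,b,c,d,e\}$ and $k=0$ otherwise. Then $J_{\mathcal{P}}$ is the kernel of the $K$-algebra homomorphism $\psi:S_{\mathcal{P}}\to K[\{v_i,h_j,w\}:i\in I,j\in J]$, $\psi(x_r)=\alpha(r)$. *)

(* Defs.v *)
From HB Require Import structures.
From mathcomp Require Import all_boot all_order all_algebra.
From mathcomp Require Import finmap.
From mathcomp.multinomials Require Import mpoly.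
From mathcomp Require Import zify.

Set Implicit Arguments.
Unset Strict Implicit.
Unset Printing Implicit Defensive.

Import Order.TTheory GRing.Theory Num.Theory.

Local Open Scope fset_scope.
Local Open Scope ring_scope.

Definition point : Type := (int * int)%type.

(* The interval [a, b] is the pair (a, b). *)
Definition interval : Type := (point * point)%type.

Definition pts (I : interval) : {pred point} :=
  [pred p : point | (I.1.1 <= p.1 <= I.2.1) && (I.1.2 <= p.2 <= I.2.2)].

(* For I non-empty this is inclusion of pts I in pts J. *)
Definition subitv (I J : interval) : bool := (I.1 \in pts J) && (I.2 \in pts J).

Definition proper (I : interval) : bool := (I.1.1 < I.2.1) && (I.1.2 < I.2.2).

(* Diagonal corners of I: I.1 and I.2; anti-diagonal corners: ulc I, lrc I. *)
Definition ulc (I : interval) : point := (I.1.1, I.2.2).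
Definition lrc (I : interval) : point := (I.2.1, I.1.2).

Definition corners (I : interval) : {fset point} :=
  [fset I.1; I.2; ulc I; lrc I].

Definition sides (I : interval) : {fset interval} :=
  [fset (I.1, lrc I); (ulc I, I.2); (I.1, ulc I); (lrc I, I.2)].

(* A cell is encoded by its lower left corner. *)
Definition cell (p : point) : interval := (p, (p.1 + 1, p.2 + 1)).

(* As subsets of Z^2, a cell is its set of corners and an edge its set of
   endpoints; so this says that the intersection of the cells is an edge of both. *)
Definition common_edge (p q : point) : bool :=
  [exists e : sides (cell p), (val e \in sides (cell q)) &&
     (corners (cell p) `&` corners (cell q) == [fset (val e).1; (val e).2])].

Definition is_polyomino (P : {fset point}) : Prop :=
  P != fset0 /\
  forall p q, p \in P -> q \in P ->
    exists s : seq point,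
      [/\ all (fun c => c \in P) s, path common_edge p s & last p s = q].

Definition V (P : {fset point}) : {fset point} :=
  [fset x | c in P, x in corners (cell c)].

Definition edges (P : {fset point}) : {fset interval} :=
  [fset e | c in P, e in sides (cell c)].

Definition inner_interval (P : {fset point}) (I : interval) : Prop :=
  proper I /\ forall c, subitv (cell c) I -> c \in P.

(* Edge intervals are non-degenerate: single points are not counted. *)
Definition vertical (I : interval) : bool :=
  (I.1.1 == I.2.1) && (I.1.2 < I.2.2).
Definition horizontal (I : interval) : bool :=
  (I.1.2 == I.2.2) && (I.1.1 < I.2.1).

Definition vsegments (I : interval) : seq interval :=
  [seq ((I.1.1, I.1.2 + k%:Z), (I.1.1, I.1.2 + k.+1%:Z))
     | k <- iota 0 `|I.2.2 - I.1.2|%N].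
Definition hsegments (I : interval) : seq interval :=
  [seq ((I.1.1 + k%:Z, I.1.2), (I.1.1 + k.+1%:Z, I.1.2))
     | k <- iota 0 `|I.2.1 - I.1.1|%N].

Definition edge_interval (P : {fset point}) (I : interval) : bool :=
  (vertical I && all (fun e => e \in edges P) (vsegments I)) ||
  (horizontal I && all (fun e => e \in edges P) (hsegments I)).

Definition edge_intervals (P : {fset point}) : {fset interval} :=
  [fset I in V P `*` V P | edge_interval P I].

Definition maximal_edge_interval (P : {fset point}) (I : interval) : bool :=
  edge_interval P I &&
  [forall J : edge_intervals P, subitv I (val J) ==> (I == val J)].

Definition maxV (P : {fset point}) : {fset interval} :=
  [fset I in edge_intervals P | maximal_edge_interval P I && vertical I].
Definition maxH (P : {fset point}) : {fset interval} :=
  [fset I in edge_intervals P | maximal_edge_interval P I && horizontal I].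

Definition closed_path (P : {fset point}) : Prop :=
  is_polyomino P /\
  exists (n : nat) (A : 'I_n -> point),
    [/\ (5 < n)%N, injective A, P = [fset A i | i in 'I_n],
        forall i, common_edge (A i) (A (ordS i)) &
        forall i j,
          j \notin [:: ord_pred (ord_pred i); ord_pred i; i; ordS i;
                       ordS (ordS i)] ->
          corners (cell (A i)) `&` corners (cell (A j)) = fset0].

(* Indices are taken in 'I_zz_len with the cyclic successor ordS, so that
   v_(l+1) = v_1 and condition (1) becomes one family of equations. *)
Record zigzag_walk (P : {fset point}) := ZigzagWalk {
  zz_len : nat;
  zz_I : 'I_zz_len -> interval;
  zz_v : 'I_zz_len -> V P;
  zz_z : 'I_zz_len -> V P;
  zz_u : 'I_zz_len -> V P;
  zz_len_gt0 : (0 < zz_len)%N;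
  zz_inj : injective zz_I;
  zz_inner : forall i, inner_interval P (zz_I i);
  zz_corners : forall i,
    let diag := [fset (zz_I i).1; (zz_I i).2] in
    let anti := [fset ulc (zz_I i); lrc (zz_I i)] in
    let vz := [fset val (zz_v i); val (zz_z i)] in
    let uv := [fset val (zz_u i); val (zz_v (ordS i))] in
    (vz = diag /\ uv = anti) \/ (vz = anti /\ uv = diag);
  zz_meet : forall i p,
    (p \in pts (zz_I i)) && (p \in pts (zz_I (ordS i)))
      = (p == val (zz_v (ordS i)));
  zz_edge : forall i, exists E,
    [/\ edge_interval P E, val (zz_v i) \in pts E &
        val (zz_v (ordS i)) \in pts E];
  zz_sep : forall i j, i != j ->
    ~ exists J, [/\ inner_interval P J, val (zz_z i) \in pts J &
                    val (zz_z j) \in pts J]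
}.

Inductive isometry : (point -> point) -> Prop :=
| iso_translation (t : point) : isometry (fun p => (p.1 + t.1, p.2 + t.2))
| iso_rotation : isometry (fun p => (- p.2, p.1))
| iso_reflection_h : isometry (fun p => (p.1, - p.2))
| iso_reflection_v : isometry (fun p => (- p.1, p.2))
| iso_comp f g : isometry f -> isometry g -> isometry (f \o g).

Definition image_cell_in (P : {fset point}) (s : point -> point) (c : point) :=
  exists2 c', c' \in P & [fset s x | x in corners (cell c)] = corners (cell c').

Definition special_configuration (P : {fset point}) (s : point -> point) :=
  isometry s /\
  forall c, c \in [:: (0, 2); (0, 1); (1, 1); (1, 0); (2, 0)] ->
    image_cell_in P s c.

Definition special_points (s : point -> point) : seq point :=
  map s [:: (0, 2); (1, 2); (0, 1); (1, 1); (1, 0)].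

Section MaximalIntervals.
Variable P : {fset point}.

Lemma V_P (r : point) :
  reflect (exists2 c, c \in P & r \in corners (cell c)) (r \in V P).
Proof.
apply: (iffP idP) => [/imfset2P[c cP [x xc ->]]|[c cP rc]]; first by exists c.
by apply/imfset2P; exists c => //; exists r.
Qed.

Lemma edges_P (e : interval) :
  reflect (exists2 c, c \in P & e \in sides (cell c)) (e \in edges P).
Proof.
apply: (iffP idP) => [/imfset2P[c cP [x xc ->]]|[c cP ec]]; first by exists c.
by apply/imfset2P; exists c => //; exists e.
Qed.

Lemma subitv_pts (I J : interval) (p : point) :
  subitv I J -> p \in pts I -> p \in pts J.
Proof.
case: I J p => [[a b] [c d]] [[a' b'] [c' d']] [x y].
by rewrite /subitv !inE /=; lia.
Qed.

Lemma fset4P (T : choiceType) (a b c d x : T) :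
  reflect [\/ x = a, x = b, x = c | x = d] (x \in [fset a; b; c; d]).
Proof.
rewrite !inE -!orbA.
apply: (iffP or4P) => -[/eqP H|/eqP H|/eqP H|/eqP H].
- by constructor 1.
- by constructor 2.
- by constructor 3.
- by constructor 4.
- by constructor 1.
- by constructor 2.
- by constructor 3.
- by constructor 4.
Qed.

Lemma sides_in (I : interval) :
  [/\ (I.1, lrc I) \in sides I, (ulc I, I.2) \in sides I,
      (I.1, ulc I) \in sides I & (lrc I, I.2) \in sides I].
Proof.
by split; apply/fset4P;
  [constructor 1|constructor 2|constructor 3|constructor 4].
Qed.

Lemma sides_corners (I e : interval) :
  e \in sides I -> e.1 \in corners I /\ e.2 \in corners I.
Proof.
by case/fset4P => ->; split; apply/fset4P;
  by [constructor 1|constructor 2|constructor 3|constructor 4].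
Qed.

Lemma corners_cell (r c : point) :
  r \in corners (cell c) -> [\/ r = (c.1, c.2), r = (c.1 + 1, c.2 + 1),
                               r = (c.1, c.2 + 1) | r = (c.1 + 1, c.2)].
Proof.
case: c => p q.
by case/fset4P => ->; [constructor 1|constructor 2|constructor 3|constructor 4].
Qed.

Lemma edges_V (e : interval) : e \in edges P -> (e.1 \in V P) && (e.2 \in V P).
Proof.
case/edges_P => c cP /sides_corners[c1 c2].
by apply/andP; split; apply/V_P; exists c.
Qed.

Lemma all_vsegments (I : interval) : vertical I ->
  reflect (forall y : int, I.1.2 <= y < I.2.2 ->
             ((I.1.1, y), (I.1.1, y + 1)) \in edges P)
          (all (fun e => e \in edges P) (vsegments I)).
Proof.
case: I => [[a b] [c d]] /andP[/= /eqP _ lt]; rewrite /vsegments /=.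
apply: (iffP allP) => [H y yP|H e /mapP[k]].
- apply: H; apply/mapP; exists `|y - b|%N; first by rewrite mem_iota; lia.
  by congr ((_, _), (_, _)); lia.
- rewrite mem_iota => kP ->.
  have -> : b + k.+1%:Z = b + k%:Z + 1 by lia.
  by apply: H; lia.
Qed.

Lemma all_hsegments (I : interval) : horizontal I ->
  reflect (forall x : int, I.1.1 <= x < I.2.1 ->
             ((x, I.1.2), (x + 1, I.1.2)) \in edges P)
          (all (fun e => e \in edges P) (hsegments I)).
Proof.
case: I => [[a b] [c d]] /andP[/= /eqP _ lt]; rewrite /hsegments /=.
apply: (iffP allP) => [H y yP|H e /mapP[k]].
- apply: H; apply/mapP; exists `|y - a|%N; first by rewrite mem_iota; lia.
  by congr ((_, _), (_, _)); lia.
- rewrite mem_iota => kP ->.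
  have -> : a + k.+1%:Z = a + k%:Z + 1 by lia.
  by apply: H; lia.
Qed.

Lemma vert_edge_interval (I : interval) : vertical I ->
  edge_interval P I = all (fun e => e \in edges P) (vsegments I).
Proof.
move=> vI; rewrite /edge_interval vI /=; case: (horizontal I) / boolP => hI.
  by move: vI hI; rewrite /vertical /horizontal; lia.
by rewrite orbF.
Qed.

Lemma hor_edge_interval (I : interval) : horizontal I ->
  edge_interval P I = all (fun e => e \in edges P) (hsegments I).
Proof.
move=> hI; rewrite /edge_interval hI /=; case: (vertical I) / boolP => vI //.
by move: vI hI; rewrite /vertical /horizontal; lia.
Qed.

Lemma edge_interval_V (I : interval) : edge_interval P I ->
  (I.1 \in V P) && (I.2 \in V P).
Proof.
case/orP => /andP[oI].
- move/(all_vsegments oI) => H; move: oI H.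
  case: I => [[a b] [c d]] /andP[/= /eqP <- lt] H.
  have /H/edges_V/andP[/= -> _] : b <= b < d by lia.
  have /H/edges_V/andP[_ /=] : b <= d - 1 < d by lia.
  by rewrite subrK.
- move/(all_hsegments oI) => H; move: oI H.
  case: I => [[a b] [c d]] /andP[/= /eqP <- lt] H.
  have /H/edges_V/andP[/= -> _] : a <= a < c by lia.
  have /H/edges_V/andP[_ /=] : a <= c - 1 < c by lia.
  by rewrite subrK.
Qed.

Lemma in_edge_intervals (I : interval) :
  (I \in edge_intervals P) = edge_interval P I.
Proof.
rewrite !inE /=; case: (boolP (edge_interval P I)) => [/edge_interval_V|].
  by case/andP => -> ->.
by rewrite andbF.
Qed.

Lemma maximalP (I : interval) :
  reflect (edge_interval P I /\
           forall J, edge_interval P J -> subitv I J -> I = J)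
          (maximal_edge_interval P I).
Proof.
apply: (iffP andP) => -[eI].
- move/forallP => H; split => // J; rewrite -in_edge_intervals => JP IJ.
  by move: (H [` JP]) => /=; rewrite IJ => /eqP.
- move=> H; split=> //; apply/forallP => -[J JP] /=; apply/implyP => IJ.
  by apply/eqP/H => //; rewrite -in_edge_intervals.
Qed.

Lemma in_maxV (I : interval) :
  (I \in maxV P) = maximal_edge_interval P I && vertical I.
Proof.
rewrite !inE /=; case: (boolP (maximal_edge_interval P I)); last first.
  by rewrite /= andbF.
by case/maximalP => eI _; rewrite eI; case/andP: (edge_interval_V eI) => -> ->.
Qed.

Lemma in_maxH (I : interval) :
  (I \in maxH P) = maximal_edge_interval P I && horizontal I.
Proof.
rewrite !inE /=; case: (boolP (maximal_edge_interval P I)); last first.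
  by rewrite /= andbF.
by case/maximalP => eI _; rewrite eI; case/andP: (edge_interval_V eI) => -> ->.
Qed.

Lemma ex_maxV (r : V P) : exists I : maxV P, val r \in pts (val I).
Proof.
case: r => -[x y] /= rP.
have [I0 [eI0 vI0 rI0]] :
    exists I, [/\ edge_interval P I, vertical I & (x, y) \in pts I].
  have mk (b : int) : ((x, b), (x, b + 1)) \in edges P ->
      (b == y) || (b + 1 == y) -> exists I,
      [/\ edge_interval P I, vertical I & (x, y) \in pts I].
    move=> eP by_; have vI : vertical ((x, b), (x, b + 1)).
      by rewrite /vertical /=; lia.
    exists ((x, b), (x, b + 1)); split=> //; last by rewrite inE /=; lia.
    rewrite vert_edge_interval //; apply/(all_vsegments vI) => /= z zP.
    by have -> : z = b by lia.
  case/V_P: rP => -[p q] cP /corners_cell.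
  have [s1 s2 s3 s4] := sides_in (cell (p, q)).
  by case=> -[/= ex ey]; (apply: (mk q); last by rewrite ey eqxx ?orbT);
    apply/edges_P; exists (p, q); rewrite // ex; assumption.
have eI0' : I0 \in edge_intervals P by rewrite in_edge_intervals.
pose Q := [pred I : edge_intervals P | vertical (val I) && ((x, y) \in pts (val I))].
have Q0 : Q [` eI0'] by rewrite /= vI0 rI0.
case: (arg_maxnP (fun I : edge_intervals P => `|(val I).2.2 - (val I).1.2|%N) Q0).
move=> [I IP] /= /andP[vI rI] Imax.
have eI : edge_interval P I by rewrite -in_edge_intervals.
suff mI : I \in maxV P by exists [` mI].
rewrite in_maxV vI andbT; apply/maximalP; split=> // J eJ IJ.
have vJ : vertical J.
  case/orP: eJ => /andP[] // hJ _; exfalso.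
  move: vI IJ hJ; rewrite /vertical /horizontal /subitv !inE.
  by case: I J {IP rI Imax eI} => [[a b] [c d]] [[a' b'] [c' d']] /=; lia.
have JP : J \in edge_intervals P by rewrite in_edge_intervals.
have /(Imax [` JP]) /= : Q [` JP].
  by rewrite /= vJ (subitv_pts IJ rI).
move: vI vJ IJ; rewrite /vertical /subitv !inE.
case: I J {IP rI Imax eI eJ JP} => [[a b] [c d]] [[a' b'] [c' d']] /= *.
by congr ((_, _), (_, _)); lia.
Qed.

Lemma ex_maxH (r : V P) : exists I : maxH P, val r \in pts (val I).
Proof.
case: r => -[x y] /= rP.
have [I0 [eI0 vI0 rI0]] :
    exists I, [/\ edge_interval P I, horizontal I & (x, y) \in pts I].
  have mk (b : int) : ((b, y), (b + 1, y)) \in edges P ->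
      (b == x) || (b + 1 == x) -> exists I,
      [/\ edge_interval P I, horizontal I & (x, y) \in pts I].
    move=> eP by_; have vI : horizontal ((b, y), (b + 1, y)).
      by rewrite /horizontal /=; lia.
    exists ((b, y), (b + 1, y)); split=> //; last by rewrite inE /=; lia.
    rewrite hor_edge_interval //; apply/(all_hsegments vI) => /= z zP.
    by have -> : z = b by lia.
  case/V_P: rP => -[p q] cP /corners_cell.
  have [s1 s2 s3 s4] := sides_in (cell (p, q)).
  by case=> -[/= ex ey]; (apply: (mk p); last by rewrite ex eqxx ?orbT);
    apply/edges_P; exists (p, q); rewrite // ey; assumption.
have eI0' : I0 \in edge_intervals P by rewrite in_edge_intervals.
pose Q := [pred I : edge_intervals P | horizontal (val I) && ((x, y) \in pts (val I))].
have Q0 : Q [` eI0'] by rewrite /= vI0 rI0.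
case: (arg_maxnP (fun I : edge_intervals P => `|(val I).2.1 - (val I).1.1|%N) Q0).
move=> [I IP] /= /andP[vI rI] Imax.
have eI : edge_interval P I by rewrite -in_edge_intervals.
suff mI : I \in maxH P by exists [` mI].
rewrite in_maxH vI andbT; apply/maximalP; split=> // J eJ IJ.
have vJ : horizontal J.
  case/orP: eJ => /andP[] // hJ _; exfalso.
  move: vI IJ hJ; rewrite /vertical /horizontal /subitv !inE.
  by case: I J {IP rI Imax eI} => [[a b] [c d]] [[a' b'] [c' d']] /=; lia.
have JP : J \in edge_intervals P by rewrite in_edge_intervals.
have /(Imax [` JP]) /= : Q [` JP].
  by rewrite /= vJ (subitv_pts IJ rI).
move: vI vJ IJ; rewrite /horizontal /subitv !inE.
case: I J {IP rI Imax eI eJ JP} => [[a b] [c d]] [[a' b'] [c' d']] /= *.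
by congr ((_, _), (_, _)); lia.
Qed.

Let lower (a b : int) : exists c, [/\ c <= a, c <= b & c = a \/ c = b].
Proof. by case: (leP a b) => ?; [exists a | exists b]; split=> //; lia. Qed.

Let upper (a b : int) : exists c, [/\ a <= c, b <= c & c = a \/ c = b].
Proof. by case: (leP a b) => ?; [exists b | exists a]; split=> //; lia. Qed.

Lemma maxV_inj (I J : maxV P) (r : point) :
  r \in pts (val I) -> r \in pts (val J) -> I = J.
Proof.
case: I J r => [I mI] [J mJ] [x y] /= rI rJ; apply: val_inj => /=.
case: I J mI mJ rI rJ => [[a b] [c d]] [[a' b'] [c' d']] mI mJ.
rewrite !inE /= => rI rJ.
move: mI mJ; rewrite !in_maxV => /andP[/maximalP[eI mI] vI].
case/andP => /maximalP[eJ mJ] vJ.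
have [lo [lo1 lo2 loE]] := lower b b'.
have [hi [hi1 hi2 hiE]] := upper d d'.
pose U := ((a, lo), (a, hi)).
have vU : vertical U.
  by move: vI vJ; rewrite /vertical /=; lia.
have eU : edge_interval P U.
  move: eI eJ; rewrite !vert_edge_interval // => /(all_vsegments vI) sI.
  move/(all_vsegments vJ) => sJ; apply/(all_vsegments vU) => z /= zP.
  have eqx : a' = a.
    by move: vI vJ; rewrite /vertical /=; lia.
  have [?|?] := boolP (b <= z < d); first exact: sI.
  by rewrite -eqx; apply: sJ => /=; lia.
rewrite (mI U eU); last first.
  by move: vI; rewrite /subitv /vertical !inE /=; lia.
by rewrite (mJ U eU) //; move: vI vJ; rewrite /subitv /vertical !inE /=; lia.
Qed.

Lemma maxH_inj (I J : maxH P) (r : point) :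
  r \in pts (val I) -> r \in pts (val J) -> I = J.
Proof.
case: I J r => [I mI] [J mJ] [x y] /= rI rJ; apply: val_inj => /=.
case: I J mI mJ rI rJ => [[a b] [c d]] [[a' b'] [c' d']] mI mJ.
rewrite !inE /= => rI rJ.
move: mI mJ; rewrite !in_maxH => /andP[/maximalP[eI mI] vI].
case/andP => /maximalP[eJ mJ] vJ.
have [lo [lo1 lo2 loE]] := lower a a'.
have [hi [hi1 hi2 hiE]] := upper c c'.
pose U := ((lo, b), (hi, b)).
have vU : horizontal U.
  by move: vI vJ; rewrite /horizontal /=; lia.
have eU : edge_interval P U.
  move: eI eJ; rewrite !hor_edge_interval // => /(all_hsegments vI) sI.
  move/(all_hsegments vJ) => sJ; apply/(all_hsegments vU) => z /= zP.
  have eqx : b' = b.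
    by move: vI vJ; rewrite /horizontal /=; lia.
  have [?|?] := boolP (a <= z < c); first exact: sI.
  by rewrite -eqx; apply: sJ => /=; lia.
rewrite (mI U eU); last first.
  by move: vI; rewrite /subitv /horizontal !inE /=; lia.
by rewrite (mJ U eU) //; move: vI vJ; rewrite /subitv /horizontal !inE /=; lia.
Qed.

(* By maxV_inj and maxH_inj, these are the only maximal edge intervals
   through r. *)
Definition vmax (r : V P) : maxV P := xchoose (ex_maxV r).
Definition hmax (r : V P) : maxH P := xchoose (ex_maxH r).

End MaximalIntervals.

Definition polyring (K : fieldType) (T : finType) := {mpoly K[#|T|]}.

Definition var (K : fieldType) (T : finType) (t : T) : polyring K T :=
  'X_(enum_rank t).

Definition ideal_gen (R : comNzRingType) (G : R -> Prop) (p : R) : Prop :=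
  exists s : seq (R * R),
    (forall u, u \in s -> G u.2) /\ p = \sum_(u <- s) u.1 * u.2.

Definition ideal_add (R : comNzRingType) (I J : R -> Prop) (p : R) : Prop :=
  exists q r, [/\ I q, J r & p = q + r].

Section Ideals.
Variables (K : fieldType) (P : {fset point}).

Definition ring_S := polyring K (V P).

Definition x_ (r : V P) : ring_S := var K r.

Definition inner_binomial (f : ring_S) : Prop :=
  exists a b c d : V P,
    let I := (val a, val b) in
    [/\ inner_interval P I, val c = ulc I, val d = lrc I &
        f = x_ a * x_ b - x_ c * x_ d].

Definition ideal_I : ring_S -> Prop := ideal_gen inner_binomial.

Definition f_walk (W : zigzag_walk P) : ring_S :=
  \prod_(i < zz_len W) x_ (zz_z i) - \prod_(i < zz_len W) x_ (zz_u i).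

Definition ideal_Z : ring_S -> Prop :=
  ideal_gen (fun f => exists W : zigzag_walk P, f = f_walk W).

Definition toric_vars : finType := ((maxV P + maxH P) + unit)%type.

Definition ring_T := polyring K toric_vars.

Definition v_ (I : maxV P) : ring_T := var K (inl (inl I) : toric_vars).
Definition h_ (J : maxH P) : ring_T := var K (inl (inr J) : toric_vars).
Definition w_ : ring_T := var K (inr tt : toric_vars).

Definition alpha (s : point -> point) (r : V P) : ring_T :=
  v_ (vmax r) * h_ (hmax r) * w_ ^+ (val r \in special_points s).

Lemma alphaE (s : point -> point) (r : V P) (I : maxV P) (J : maxH P) :
  val r \in pts (val I) -> val r \in pts (val J) ->
  alpha s r = v_ I * h_ J * w_ ^+ (val r \in special_points s).
Proof.
move=> rI rJ; rewrite /alpha.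
have -> : vmax r = I by apply: maxV_inj (xchooseP (ex_maxV r)) rI.
by have -> : hmax r = J by apply: maxH_inj (xchooseP (ex_maxH r)) rJ.
Qed.

Definition psi (s : point -> point) (f : ring_S) : ring_T :=
  mmap (@mpolyC #|toric_vars| K) (fun i => alpha s (enum_val i)) f.

Definition ideal_J (s : point -> point) (f : ring_S) : Prop := psi s f = 0.

End Ideals.

Arguments ideal_I : clear implicits.
Arguments ideal_Z : clear implicits.
Arguments ideal_J : clear implicits.

(* Main.v *)
(* The kernel J is spanned by the binomials X^m - X^m' with psi(X^m) = psi(X^m').  The
   equations from the variables v_i and h_j say that m' - m is the mixed second
   difference of an integer function c on cells (its quadrant sums) which is constant
   on each of the two sides of the closed path; the equation from w makes both constants
   vanish, so that c is supported on P.  Rewriting either monomial by an inner 2-minor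
   adds 1 or -1 to c on an inner interval.  If c <> 0 and no such move on either
   monomial lowers the sum of |c|, then c has constant sign on each maximal straight
   block, the signs alternate, and the blocks form a zig-zag walk, whose binomial does
   lower that sum.

   Conversely, f_W lies in J because x_{v_1} f_W telescopes modulo the inner 2-minors.
   That the latter are balanced in w needs the cell (-1, 2) next to the configuration not
   to be in P; otherwise the path has four consecutive corner cells, then no block
   can be stuck, and 2-minor moves alone would connect the two monomials of f_W,
   although none applies to the product of the x_{z_i}. *)

Require Import Defs.
From HB Require Import structures.
From mathcomp Require Import all_boot all_order all_algebra.
From mathcomp Require Import finmap.
From mathcomp.multinomials Require Import mpoly.
From mathcomp Require Import zify ring.
From Stdlib Require Import Classical.

Set Implicit Arguments.
Unset Strict Implicit.
Unset Printing Implicit Defensive.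

Import Defs Order.TTheory GRing.Theory Num.Theory.

Local Open Scope ring_scope.

(** Of the two monomials only the difference is known, so a token can be guaranteed at a vertex only
    through the sign of [D c] there. At an endpoint of an edge between consecutive cells, [D c]
    involves at most three path cells, and at the outer corner of a turn just one; hence every
    availability argument is an inequality between heights of consecutive cells. A straight stretch
    of constant sign can be lowered by one move as soon as two opposite corners of its strip carry
    tokens of the right monomial. An end where the sign is lost on straight ground offers tokens at
    both of its corners, so one of them can be matched with the other end. Only at a corner of the
    path may an end offer a token on one side alone, the outer one, and two such ends block each
    other exactly when both turns go to the same side. These unmatched tokens are the far corners
    z_i of the zig-zag walk. They all belong to the same monomial, which is why one binomial can
    move them together. *)

Lemma ptE (p q : point) : (p == q) = (p.1 == q.1) && (p.2 == q.2).
Proof. by case: p q => [a b] [c d]; rewrite xpair_eqE. Qed.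

Lemma pt_eq (p q : point) : p.1 = q.1 -> p.2 = q.2 -> p = q.
Proof. by case: p q => [a b] [c d] /= -> ->. Qed.

(* The mixed second difference of a function on cells: the token change it
   prescribes at a lattice point. *)
Definition D (c : point -> int) (p : point) : int :=
  c (p.1, p.2) + c (p.1 - 1, p.2 - 1) - c (p.1 - 1, p.2) - c (p.1, p.2 - 1).

Definition ind (I : interval) (x : point) : int := (subitv (cell x) I)%:Z.

Lemma subitv_cell (I : interval) (x : point) :
  subitv (cell x) I = (I.1.1 <= x.1 < I.2.1) && (I.1.2 <= x.2 < I.2.2).
Proof. by case: I x => [[a b] [a' b']] [x y]; rewrite /subitv !inE /=; lia. Qed.

(** The indicator of a rectangle is a product of two one-dimensional indicators, so its mixed
    difference is a product of two jumps. *)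
Lemma D_ind (I : interval) (p : point) : proper I ->
  D (ind I) p = (p == I.1)%:Z + (p == I.2)%:Z - (p == ulc I)%:Z - (p == lrc I)%:Z.
Proof.
case: I p => [[a b] [a' b']] [x y] /andP[/= lta ltb].
rewrite /D /ind !subitv_cell /= !ptE /=.
have jump (u v w : int) : u < v ->
    (u <= w < v)%R%:Z - (u <= w - 1 < v)%R%:Z = (w == u)%:Z - (w == v)%:Z by lia.
have Hn (P Q : bool) : nat_of_bool (P && Q) = (P * Q)%N by case: P; case: Q.
rewrite ![nat_of_bool ((a <= _ < a')%R && _)]Hn ![nat_of_bool ((x == _) && _)]Hn !PoszM.
transitivity (((a <= x < a')%R%:Z - (a <= x - 1 < a')%R%:Z) *
              ((b <= y < b')%R%:Z - (b <= y - 1 < b')%R%:Z)); first by ring.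
by rewrite !jump //; ring.
Qed.

Lemma D_lin (c c' : point -> int) (k : int) p :
  D (fun x => c x + k * c' x) p = D c p + k * D c' p.
Proof. by rewrite /D !mulrDr !mulrN; lia. Qed.

(* [p] and [q] are opposite corners of [I], and so are [r] and [s]; the sign [t]
   tells whether [p], [q] is the diagonal pair. *)
Definition quad (t : bool) (I : interval) (p q r s : point) : bool :=
  let d p q := ((p == I.1) && (q == I.2)) || ((p == I.2) && (q == I.1)) in
  let a p q := ((p == ulc I) && (q == lrc I)) || ((p == lrc I) && (q == ulc I)) in
  if t then d p q && a r s else d r s && a p q.

(** Signs are booleans, so that products of signs become equality tests ([sgM]) and a sign can
    directly select one of the two token distributions. *)
Definition sg (b : bool) : int := if b then 1 else -1.

Lemma sgM a b : sg (a == b) = sg a * sg b.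
Proof. by case: a; case: b. Qed.

Lemma quadC t I p q r s : quad t I p q r s = quad (~~ t) I r s p q.
Proof. by case: t. Qed.

Lemma quadsw t I p q r s : quad t I p q r s = quad t I q p r s.
Proof.
by rewrite /quad; case: t; do ![case: (_ == _)].
Qed.

Lemma D_quad t I p q r s x : proper I -> quad t I p q r s ->
  D (ind I) x =
    sg t * ((x == p)%:Z + (x == q)%:Z - (x == r)%:Z - (x == s)%:Z).
Proof.
move=> pI; rewrite D_ind // /quad; case: t => /= /andP[];
  by case/orP => /andP[/eqP-> /eqP->]; case/orP => /andP[/eqP-> /eqP->]; lia.
Qed.

Definition rot (b : bool) (h : point) : point :=
  if b then (- h.2, h.1) else (h.2, - h.1).

Definition near (p q : point) : bool :=
  `|p.1 - q.1| + `|p.2 - q.2| == 1.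

Definition diagonal (p q : point) : bool :=
  (`|p.1 - q.1| == 1) && (`|p.2 - q.2| == 1).

(** * Geometry of closed walks of cells *)

Section Walk.
Variable A : int -> point.

(** Locked so that simplification does not replace a step by differences of cell coordinates. *)
Definition step (i : int) : point :=
  locked ((A (i + 1)).1 - (A i).1, (A (i + 1)).2 - (A i).2).
Lemma stepE (i : int) :
  step i = ((A (i + 1)).1 - (A i).1, (A (i + 1)).2 - (A i).2).
Proof. by rewrite /step -lock. Qed.
Definition turn (b : bool) (i : int) : bool := step i == rot b (step (i - 1)).
Definition straight (i : int) : bool := step i == step (i - 1).
Definition hor (i : int) : bool := (step i).2 == 0.

(* The endpoint on side [b] (true is left) of the common edge of cells i, i+1. *)
Definition sd (b : bool) (i : int) : point :=
  ((A i).1 + (if 0 < (step i).1 + (rot b (step i)).1 then 1 else 0),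
   (A i).2 + (if 0 < (step i).2 + (rot b (step i)).2 then 1 else 0)).

Definition oppc (i : int) (p : point) : point :=
  ((A i).1 * 2 + 1 - p.1, (A i).2 * 2 + 1 - p.2).

(* Corners of cell i on its rear edge for the outgoing direction, and on its
   front edge for the incoming direction. *)
Definition back (b : bool) (i : int) : point := oppc i (sd (~~ b) i).
Definition front (b : bool) (i : int) : point := oppc i (sd (~~ b) (i - 1)).

Definition beside (b : bool) (i j : int) : point :=
  ((A j).1 + (rot b (step i)).1, (A j).2 + (rot b (step i)).2).

(** Indexing by all integers avoids arithmetic modulo n. The disjointness condition of a closed path
    is split by the kind of contact: cells sharing an edge are consecutive, cells sharing only a
    corner are two positions apart. *)
Record closed_walk (n : nat) : Prop := ClosedWalk {
  cw_n : (5 < n)%N;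
  cw_per : forall i : int, A (i + n%:Z) = A i;
  cw_inj : forall i j : int, A i = A j -> (n%:Z %| i - j)%Z;
  cw_near : forall i : int, near (A i) (A (i + 1));
  cw_adj : forall i j : int, near (A i) (A j) -> A j = A (i + 1) \/ A j = A (i - 1);
  cw_diag : forall i j : int, diagonal (A i) (A j) ->
    A j = A (i + 1 + 1) \/ A j = A (i - 1 - 1) }.

Variable n : nat.
Hypothesis cw : closed_walk n.

Lemma cw_neq (i d : int) : 0 < d -> d < 6 -> A (i + d) <> A i.
Proof.
move=> d0 d6 /(cw_inj cw); have := cw_n cw.
have -> : i + d - i = d by lia.
move=> n5 /dvdzP[q dq]; have q0 : 0 < q by nia.
by nia.
Qed.

Lemma step_cases (i : int) :
  [\/ step i = (1, 0), step i = (0, 1), step i = (-1, 0) | step i = (0, -1)].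
Proof.
have := cw_near cw i; rewrite /near stepE => H.
have [E|[E|[E|E]]] : 
  ((A (i + 1)).1 - (A i).1 = 1 /\ (A (i + 1)).2 - (A i).2 = 0) \/
  ((A (i + 1)).1 - (A i).1 = 0 /\ (A (i + 1)).2 - (A i).2 = 1) \/
  ((A (i + 1)).1 - (A i).1 = -1 /\ (A (i + 1)).2 - (A i).2 = 0) \/
  ((A (i + 1)).1 - (A i).1 = 0 /\ (A (i + 1)).2 - (A i).2 = -1) by lia.
- by case: E => -> ->; constructor 1.
- by case: E => -> ->; constructor 2.
- by case: E => -> ->; constructor 3.
- by case: E => -> ->; constructor 4.
Qed.

Lemma A_step (i : int) : A (i + 1) = ((A i).1 + (step i).1, (A i).2 + (step i).2).
Proof. by apply: pt_eq => /=; rewrite stepE /=; lia. Qed.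

Lemma A_step_prev (i : int) :
  A (i - 1) = ((A i).1 - (step (i - 1)).1, (A i).2 - (step (i - 1)).2).
Proof. by have := A_step (i - 1); rewrite subrK => ->; apply: pt_eq => /=; lia. Qed.

Lemma turn_cases (i : int) : [\/ straight i, turn true i | turn false i].
Proof.
(* A reversal of direction would make cells i-1 and i+1 equal. *)
have := @cw_neq (i - 1) 2 isT isT; have -> : i - 1 + 2 = i + 1 by lia.
rewrite A_step A_step_prev /straight /turn.
case: (step_cases i) => ->; case: (step_cases (i - 1)) => -> /= H;
  do [by constructor 1 | by constructor 2 | by constructor 3 |
      by exfalso; apply: H; apply: pt_eq => /=; lia].
Qed.

Lemma turnN (b : bool) (i : int) : turn b i -> turn (~~ b) i = false.
Proof.
rewrite /turn => /eqP->.
by case: b; case: (step_cases (i - 1)) => ->.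
Qed.

Lemma turn_corner (b : bool) (i : int) : turn b i -> straight i = false.
Proof.
rewrite /straight /turn => /eqP->.
by case: b; case: (step_cases (i - 1)) => ->.
Qed.

Lemma corner_turn (i : int) : ~~ straight i -> exists b, turn b i.
Proof. by case: (turn_cases i) => [->//|t _|t _]; [exists true|exists false]. Qed.

Lemma beside_self (b : bool) (i j : int) : A j = beside b i i -> turn b i /\ A j = A (i - 1).
Proof.
move=> E; have /(cw_adj cw)[] : near (A i) (A j).
- by rewrite E /near /=; case: b {E}; case: (step_cases i) => -> /=; lia.
- rewrite E => /eqP; rewrite A_step ptE /beside /=.
  by case: b {E}; case: (step_cases i) => -> /=; lia.
- move=> E'; split=> //; move/eqP: E; rewrite E' A_step_prev ptE /beside /turn ptE /=.
  by case: b; case: (step_cases i) => ->; case: (step_cases (i - 1)) => -> /=; lia.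
Qed.

Lemma turn_prev (b : bool) (i : int) : turn b i -> A (i - 1) = beside b i i.
Proof.
rewrite A_step_prev /beside /turn => /eqP->; apply: pt_eq => /=;
by case: b; case: (step_cases (i - 1)) => -> /=; lia.
Qed.

Lemma beside_next (b : bool) (i j : int) :
  A j = beside b i (i + 1) -> turn b (i + 1) /\ A j = A (i + 1 + 1).
Proof.
move=> E; have /(cw_adj cw)[] : near (A (i + 1)) (A j).
- by rewrite E /near /=; case: b {E}; case: (step_cases i) => -> /=; lia.
- move=> E'; split=> //; move/eqP: E; rewrite E' (A_step (i + 1)) ptE /turn addrK ptE.
  by rewrite /beside /=; case: b; case: (step_cases i) => ->;
    case: (step_cases (i + 1)) => -> /=; lia.
- rewrite addrK E => /eqP; rewrite ptE /beside A_step /=.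
  by case: b {E}; case: (step_cases i) => -> /=; lia.
Qed.

Lemma turn_next (b : bool) (i : int) : turn b (i + 1) -> A (i + 1 + 1) = beside b i (i + 1).
Proof.
rewrite (A_step (i + 1)) /beside /turn addrK => /eqP->.
by case: b.
Qed.

(* Otherwise the four cells around the common corner would close up. *)
Lemma turn_alternate (b : bool) (i : int) : turn b i -> turn b (i + 1) = false.
Proof.
move=> t; apply/negP => t'.
have nr : near (A (i - 1)) (A (i + 1 + 1)).
  rewrite (turn_next t') (turn_prev t) /near /beside A_step /=.
  by case: b {t t'}; case: (step_cases i) => -> /=; lia.
have := cw_adj cw nr; rewrite subrK => -[].
- by rewrite -addrA; apply: (@cw_neq i 2).
- have -> : i + 1 + 1 = i - 1 - 1 + 4 by lia.
  exact: (@cw_neq (i - 1 - 1) 4).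
Qed.

Lemma hor_straight (i : int) : straight i -> hor i = hor (i - 1).
Proof. by rewrite /hor /straight => /eqP->. Qed.

Lemma hor_turn (b : bool) (i : int) : turn b i -> hor i = ~~ hor (i - 1).
Proof.
rewrite /hor /turn => /eqP->.
by case: b; case: (step_cases (i - 1)) => ->.
Qed.

(** The two edges that the walk crosses at a corner cell meet in its inner corner. *)
Lemma sd_turn (b : bool) (i : int) : turn b i -> sd b i = sd b (i - 1).
Proof.
move=> t; have := A_step_prev i; rewrite /sd => ->.
move: t; rewrite /turn => /eqP->.
by case: b; case: (step_cases (i - 1)) => -> /=; apply: pt_eq => /=; lia.
Qed.

Lemma back_straight (b : bool) (i : int) : straight i -> back b i = sd b (i - 1).
Proof.
move=> t; have := A_step_prev i; rewrite /back /oppc /sd => ->.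
move: t; rewrite /straight => /eqP->.
by case: b; case: (step_cases (i - 1)) => -> /=; apply: pt_eq => /=; lia.
Qed.

Lemma front_straight (b : bool) (i : int) : straight i -> front b i = sd b i.
Proof.
move=> t; have := A_step_prev i; rewrite /front /oppc /sd => ->.
move: t; rewrite /straight => /eqP->.
by case: b; case: (step_cases (i - 1)) => -> /=; apply: pt_eq => /=; lia.
Qed.

Lemma back_turn (b : bool) (i : int) : turn b i -> back b i = sd (~~ b) (i - 1).
Proof.
move=> t; have := A_step_prev i; rewrite /back /oppc /sd => ->.
move: t; rewrite /turn => /eqP->.
by case: b; case: (step_cases (i - 1)) => -> /=; apply: pt_eq => /=; lia.
Qed.

Lemma front_turn (b : bool) (i : int) : turn b i -> front b i = sd (~~ b) i.
Proof.
move=> t; have := A_step_prev i; rewrite /front /oppc /sd => ->.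
move: t; rewrite /turn => /eqP->.
by case: b; case: (step_cases (i - 1)) => -> /=; apply: pt_eq => /=; lia.
Qed.

Lemma back_outer (b : bool) (i : int) : back (~~ b) i = oppc i (sd b i).
Proof. by rewrite /back negbK. Qed.

Lemma front_outer (b : bool) (i : int) : turn b i -> front (~~ b) i = oppc i (sd b i).
Proof. by move=> t; rewrite /front negbK (sd_turn t). Qed.

Section Height.
Variable c : point -> int.
Hypothesis c_off : forall x, (forall i : int, x <> A i) -> c x = 0.

Lemma c_beside (b : bool) (i : int) : c (beside b i i) = if turn b i then c (A (i - 1)) else 0.
Proof.
case: ifP => [/turn_prev<-//|tF]; apply: c_off => j E.
by have [] := beside_self (esym E); rewrite tF.
Qed.

Lemma c_beside_next (b : bool) (i : int) :
  c (beside b i (i + 1)) = if turn b (i + 1) then c (A (i + 1 + 1)) else 0.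
Proof.
case: ifP => [/turn_next<-//|tF]; apply: c_off => j E.
by have [] := beside_next (esym E); rewrite tF.
Qed.

Lemma D_sd_beside (b : bool) (i : int) : D c (sd b i) = sg (hor i) * sg b *
  (c (A i) - c (A (i + 1)) + c (beside b i (i + 1)) - c (beside b i i)).
Proof.
rewrite /hor /D /sd /beside A_step.
case: (A i) => x y; case: b; case: (step_cases i) => -> /=;
  rewrite /sg ?oppr0 ?addr0 ?opprK ?addrK ?subrK ?subr0 /=; ring.
Qed.

(** The four cells around [sd b i] are cells i, i+1 and the two beside them on side [b]. A cell
    beside the walk belongs to the path only at a turn to that side, and then it is the next or the
    previous cell. *)
Lemma D_sd (b : bool) (i : int) : D c (sd b i) = sg (hor i) * sg b *
  (c (A i) - c (A (i + 1)) + (if turn b (i + 1) then c (A (i + 1 + 1)) else 0)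
   - (if turn b i then c (A (i - 1)) else 0)).
Proof. by rewrite D_sd_beside c_beside c_beside_next. Qed.

(** Of the four cells around the outer corner of a turn only the corner cell is in the path, so its
    height alone decides which distribution has a token there. *)
Lemma D_outer (b : bool) (i : int) : turn b i -> D c (oppc i (sd b i)) = sg (hor i) * sg b * c (A i).
Proof.
move=> t.
pose f := step (i - 1); pose g := step i.
have off0 : c ((A i).1 + f.1, (A i).2 + f.2) = 0.
  have := c_beside (~~ b) i; rewrite (turnN t) => <-.
  congr (c (_, _)) => /=; move/eqP: t; rewrite /beside => ->; rewrite /f /=;
  by case: b; case: (step_cases (i - 1)) => -> /=; lia.
have off1 : c ((A i).1 - g.1, (A i).2 - g.2) = 0.
  have := c_beside_next (~~ b) (i - 1); rewrite subrK (turnN t) => <-.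
  congr (c (_, _)) => /=; move/eqP: t; rewrite /g => ->; rewrite /=;
  by case: b; case: (step_cases (i - 1)) => -> /=; lia.
(* The diagonal cell could only be cell i+2 or i-2, and neither is reachable by two unit steps of
   the walk in that direction. *)
have off2 : c ((A i).1 + f.1 - g.1, (A i).2 + f.2 - g.2) = 0.
  apply: c_off => j E; have : diagonal (A i) (A j).
    rewrite -E /diagonal /f; move/eqP: t; rewrite /g => ->.
    by case: b; case: (step_cases (i - 1)) => -> /=; lia.
  case/(cw_diag cw) => E'; move: E; rewrite E' => /eqP; rewrite ptE.
    rewrite (A_step (i + 1)) (A_step i) /f; move/eqP: t; rewrite /g => -> /=.
    by case: b; case: (step_cases (i - 1)) => ->; case: (step_cases (i + 1)) => -> /=; lia.
  rewrite (A_step_prev (i - 1)) (A_step_prev i) /f; move/eqP: t; rewrite /g => -> /=.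
  by case: b; case: (step_cases (i - 1)) => ->; case: (step_cases (i - 1 - 1)) => -> /=; lia.
move: off0 off1 off2; rewrite /f /g; move/eqP: (t) => ->.
rewrite /hor /D /oppc /sd; move/eqP: (t) => ->.
case: (A i) => x y {f g t}; case: b; case: (step_cases (i - 1)) => -> /=.
all: rewrite /sg ?oppr0 ?addr0 ?opprK ?addrK ?subrK ?subr0 /=.
all: have H0 (u : int) : u * 2 + 1 - (u + 1) = u by lia.
all: have H1 (u : int) : u * 2 + 1 - u = u + 1 by lia.
all: by rewrite ?H0 ?H1 ?addrK => -> -> ->; ring.
Qed.

End Height.

End Walk.

(** * Walking backwards *)

Section Reversal.
Variables (A : int -> point) (n : nat).
Hypothesis cw : closed_walk A n.

(** Reversal exchanges the two sides and the roles of [front] and [back], so statements about right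
    ends yield those about left ends. *)
Definition reversed (i : int) : point := A (- i).

Lemma near_sym p q : near p q = near q p.
Proof. by rewrite /near; lia. Qed.

Lemma reversed_walk : closed_walk reversed n.
Proof.
split; rewrite /reversed.
- exact: cw_n cw.
- by move=> i; rewrite -(cw_per cw); congr (A _); lia.
- move=> i j /(cw_inj cw)/dvdzP[q E]; apply/dvdzP; exists (- q); rewrite mulNr -E; lia.
- move=> i; rewrite near_sym; have := cw_near cw (- (i + 1)).
  by congr (near _ (A _)); lia.
- move=> i j /(cw_adj cw)[->|->]; [right|left]; congr (A _); lia.
- move=> i j /(cw_diag cw)[->|->]; [right|left]; congr (A _); lia.
Qed.

Lemma step_reversed (i : int) :
  step reversed i = (- (step A (- i - 1)).1, - (step A (- i - 1)).2).
Proof.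
rewrite !stepE /reversed; have -> : - (i + 1) = - i - 1 by lia.
by rewrite subrK; apply: pt_eq => /=; lia.
Qed.

Lemma hor_reversed (i : int) : hor reversed i = hor A (- i - 1).
Proof. by rewrite /hor step_reversed /=; lia. Qed.

Lemma turn_reversed (b : bool) (i : int) : turn reversed b i = turn A (~~ b) (- i).
Proof.
rewrite /turn !step_reversed; have -> : - (i - 1) - 1 = - i by lia.
by case: b; case: (step_cases cw (- i)) => ->; case: (step_cases cw (- i - 1)) => ->.
Qed.

Lemma straight_reversed (i : int) : straight reversed i = straight A (- i).
Proof.
rewrite /straight !step_reversed; have -> : - (i - 1) - 1 = - i by lia.
by case: (step_cases cw (- i)) => ->; case: (step_cases cw (- i - 1)) => ->.
Qed.

Lemma sd_reversed (b : bool) (i : int) : sd reversed b i = sd A (~~ b) (- i - 1).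
Proof.
rewrite /sd !step_reversed /reversed (A_step_prev A).
by case: b; case: (step_cases cw (- i - 1)) => ->; apply: pt_eq => /=; lia.
Qed.

Lemma front_reversed (b : bool) (i : int) : front reversed b i = back A (~~ b) (- i).
Proof.
rewrite /front /back sd_reversed; have -> : - (i - 1) - 1 = - i by lia.
by [].
Qed.

End Reversal.

(** * Straight strips of cells *)

Section Run.
Variables (A : int -> point) (n : nat).
Hypothesis cw : closed_walk A n.

Notation step := (step A).
Notation straight := (straight A).

(* The cells a, ..., e form a straight strip whose direction is [step a]. *)
Definition run (a e : int) : Prop :=
  [/\ a <= e, forall j : int, a < j < e -> straight j & a = e -> straight a].

Definition strip (a e : int) : interval :=
  ((Num.min (A a).1 (A e).1, Num.min (A a).2 (A e).2),
   (Num.max (A a).1 (A e).1 + 1, Num.max (A a).2 (A e).2 + 1)).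

Lemma run_step (a e j : int) : run a e -> a <= j < e -> step j = step a.
Proof.
case=> _ st _ /andP[aj je]; have [k E] : exists k : nat, j = a + k%:Z by exists `|j - a|%N; lia.
rewrite {}E in aj je *; have : a + k%:Z < e by lia.
elim: k {aj je} => [|k IH] lt; first by rewrite addr0.
have /eqP -> : straight (a + k.+1%:Z) by apply: st; lia.
have -> : a + k.+1%:Z - 1 = a + k%:Z by lia.
by apply: IH; lia.
Qed.

Lemma run_A (a e j : int) : run a e -> a <= j <= e ->
  A j = ((A a).1 + (j - a) * (step a).1, (A a).2 + (j - a) * (step a).2).
Proof.
move=> r /andP[aj je]; have [k E] : exists k : nat, j = a + k%:Z by exists `|j - a|%N; lia.
rewrite {}E in aj je *; have : a + k%:Z <= e by lia.
elim: k {aj je} => [|k IH] lt.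
  by rewrite addr0 subrr !mul0r !addr0; case: (A a).
have -> : a + k.+1%:Z = a + k%:Z + 1 by lia.
rewrite (A_step A) (run_step r); last by lia.
by rewrite IH; last lia; apply: pt_eq => /=; ring.
Qed.

(** The last condition of [run] serves this case: for a single cell the incoming step, which
    determines [front], has to agree with the outgoing one, which determines [back]. *)
Lemma run_prev (a e : int) : run a e -> step (e - 1) = step a.
Proof.
move=> r; case: (r) => ae _ st; case: (eqVneq a e) => [E|ne].
  by have /eqP := st E; rewrite -E => ->.
by apply: (run_step r); lia.
Qed.

Lemma strip_proper (a e : int) : proper (strip a e).
Proof. by rewrite /proper /strip /=; lia. Qed.

Lemma strip_cell (a e : int) (x : point) : run a e ->
  reflect (exists2 j : int, a <= j <= e & x = A j) (subitv (cell x) (strip a e)).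
Proof.
move=> r; have ae : a <= e by case: r.
have Ee : a <= e <= e by lia.
rewrite subitv_cell /strip (run_A r Ee) /=; apply: (iffP idP).
(* The step is a unit vector along an axis, so the index is recovered by the scalar product of the
   displacement with it. *)
- case: x => x y /= xy; exists
    (a + (x - (A a).1) * (step a).1 + (y - (A a).2) * (step a).2).
    by move: xy; case: (step_cases cw a) => -> /=; lia.
  rewrite (run_A r); last by move: xy; case: (step_cases cw a) => -> /=; lia.
  by move: xy; case: (step_cases cw a) => -> /=; move=> xy; apply: pt_eq => /=; lia.
- case=> j aje ->; rewrite (run_A r aje) /=.
  by case: (step_cases cw a) => -> /=; lia.
Qed.

Lemma strip_quad (b : bool) (a e : int) : run a e ->
  quad (hor A a == b) (strip a e) (front A b e) (back A (~~ b) a)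
       (front A (~~ b) e) (back A b a).
Proof.
move=> r; have ae : a <= e by case: r.
have Ee : a <= e <= e by lia.
rewrite /hor /front /back /oppc /sd (A_step_prev A e) (run_prev r).
rewrite /quad /strip (run_A r Ee) /ulc /lrc !ptE /=.
by case: b; case: (step_cases cw a) => -> /=; lia.
Qed.

(* A corner cell is a strip that the run lemmas do not cover. *)
Lemma cell_quad (b : bool) (i : int) : turn A b i ->
  quad (hor A i == ~~ b) (cell (A i)) (sd A (~~ b) i) (sd A (~~ b) (i - 1))
       (sd A b i) (oppc A i (sd A b i)).
Proof.
move=> /eqP t; rewrite /hor /oppc /sd (A_step_prev A i) t.
rewrite /quad /cell /ulc /lrc !ptE /=.
by case: b {t}; case: (step_cases cw (i - 1)) => -> /=; lia.
Qed.

End Run.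

Lemma sgN b : sg (~~ b) = - sg b.
Proof. by case: b. Qed.

(** * Moves and height functions *)

Section Moves.
Variable P : {fset point}.

(* A monomial is a distribution of tokens on the lattice points, with the exponent of
   x_p as the number of tokens at [p]. *)
Definition imove (m m' : point -> nat) : Prop :=
  exists I t p q r s (m0 : point -> nat),
    [/\ inner_interval P I, quad t I p q r s,
        m =1 (fun x => m0 x + (x == p) + (x == q))%N &
        m' =1 (fun x => m0 x + (x == r) + (x == s))%N].

Inductive conn (m m' : point -> nat) : Prop :=
| conn_refl of m =1 m'
| conn_step m1 of imove m m1 & conn m1 m'.

Lemma imove_sym m m' : imove m m' -> imove m' m.
Proof.
case=> I [t] [p] [q] [r] [s] [m0] [iI qd e e'].
by exists I, (~~ t), r, s, p, q, m0; rewrite -quadC.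
Qed.

Lemma imove_eq m1 m2 m : m1 =1 m2 -> imove m2 m -> imove m1 m.
Proof.
move=> e [I [t [p [q [r [s [m0 [iI qd e1 e2]]]]]]]].
by exists I, t, p, q, r, s, m0; split=> // x; rewrite e.
Qed.

Lemma conn_eql m1 m2 m : m1 =1 m2 -> conn m2 m -> conn m1 m.
Proof.
move=> e [e'|m3 mv C]; first by apply: conn_refl => x; rewrite e.
exact: conn_step (imove_eq e mv) C.
Qed.

Lemma conn_trans m1 m2 m3 : conn m1 m2 -> conn m2 m3 -> conn m1 m3.
Proof.
elim=> {m1 m2} [m1 m2 e|m1 m2 m4 mv _ IH] C; first exact: conn_eql e C.
exact: conn_step mv (IH C).
Qed.

Lemma conn_sym m1 m2 : conn m1 m2 -> conn m2 m1.
Proof.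
elim=> {m1 m2} [m1 m2 e|m1 m2 m3 mv _ C]; first exact: conn_refl.
by apply: conn_trans C (conn_step (imove_sym mv) _); apply: conn_refl.
Qed.

(* [tok true] and [tok false] are the two token distributions, [c] the height
   function on cells carrying the first to the second. *)
Definition balanced (tok : bool -> point -> nat) (c : point -> int) : Prop :=
  (forall p, (tok false p)%:Z - (tok true p)%:Z = D c p) /\
  (forall x, x \notin P -> c x = 0).

Definition weight (c : point -> int) : nat := (\sum_(x <- P) `|c x|)%N.

(** Both distributions may move before the weights are compared; [stuck_corner_next] needs one move
    on each. *)
Definition reducible (tok : bool -> point -> nat) (c : point -> int) : Prop :=
  exists tok' c', [/\ forall t, conn (tok t) (tok' t), balanced tok' c' &
    (weight c' < weight c)%N].

(** Every token used below comes from here: a point where one distribution exceeds the other holds a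
    token of the former. *)
Lemma balanced_tok tok c t p : balanced tok c -> sg t * D c p < 0 -> (0 < tok t p)%N.
Proof. by case=> /(_ p) <- _; case: t; rewrite /sg; lia. Qed.

Lemma weight_lt (c c' : point -> int) x : x \in P -> `|c' x| < `|c x| ->
  (forall y, `|c' y| <= `|c y|) -> (weight c' < weight c)%N.
Proof.
move=> xP lt le; rewrite /weight (big_fsetD1 x) //= [in ltnRHS](big_fsetD1 x) //=.
rewrite -addSn; apply: leq_add; first by move: lt; lia.
by apply: leq_sum => y _; have := le y; lia.
Qed.

Lemma one_move tok c t t' I p q r s : balanced tok c ->
  inner_interval P I -> quad t' I p q r s ->
  (0 < tok t p)%N -> (0 < tok t q)%N ->
  exists tok', [/\ forall u, conn (tok u) (tok' u), tok' (~~ t) =1 tok (~~ t) &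
    balanced tok' (fun x => c x + sg (t == t') * ind I x)].
Proof.
case=> bal off [pI iI] qd tp tq.
have npq : p != q.
  move: qd pI; rewrite /quad /proper /ulc /lrc !ptE; case: (I) => [[a b] [a' b']] /=.
  by case: (t'); case: p {tp} => ? ?; case: q {tq} => ? ? /=; lia.
(* The truncated subtraction is exact because p and q are distinct and each holds a token. *)
pose m0 x := (tok t x - (x == p) - (x == q))%N.
have m0E : tok t =1 (fun x => m0 x + (x == p) + (x == q))%N.
  move=> x; rewrite /m0; case: (eqVneq x p) => [->|_]; last first.
    by case: (eqVneq x q) => [->|_]; lia.
  by rewrite (negbTE npq); lia.
pose m1 x := (m0 x + (x == r) + (x == s))%N.
exists (fun u => if u == t then m1 else tok u); split.
- move=> u; case: eqP => [->|_]; last exact: conn_refl.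
  apply: (@conn_step _ _ m1); last exact: conn_refl.
  by exists I, t', p, q, r, s, m0.
- by move=> x; case: (t).
- split=> [x|x xP]; last first.
    rewrite off // /ind; case: (boolP (subitv _ _)) => [/iI xP'|_]; last by rewrite mulr0.
    by rewrite xP' in xP.
  rewrite D_lin -bal (D_quad _ pI qd) /sg.
  have := m0E x; rewrite /m1; case: (t) (t') => -[] /= ->; lia.
Qed.

End Moves.

Lemma int_first (Q : int -> bool) (x k : int) : x < k -> Q x ->
  (forall j : int, x <= j < k -> Q j) \/
  (exists y : int, [/\ x <= y, y + 1 < k, forall j : int, x <= j <= y -> Q j & ~~ Q (y + 1)]).
Proof.
move=> xk Qx; have [d ->] : exists d : nat, k = x + 1 + d%:Z.
  by exists `|(k - x - 1)%R|%N; lia.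
elim: d => [|d [IH|[y [xy yk Qy Ny]]]].
- by left=> j jP; have -> : j = x by lia.
- case: (boolP (Q (x + 1 + d%:Z))) => [Qd|Nd].
    left=> j jP; have [?|->] : j < x + 1 + d%:Z \/ j = x + 1 + d%:Z by lia.
      by apply: IH; lia.
    by [].
  right; exists (x + d%:Z); split; [lia|lia| |].
    by move=> j jP; apply: IH; lia.
  by have -> : x + d%:Z + 1 = x + 1 + d%:Z by lia.
- by right; exists y; split=> //; lia.
Qed.

Section Corners.
Variables (A : int -> point) (n : nat).
Hypothesis cw : closed_walk A n.

(** Without a corner the walk would be straight for n steps and could not return to its starting
    cell. *)
Lemma next_corner (x : int) : exists k : int,
  [/\ x < k, forall j : int, x < j < k -> straight A j & ~~ straight A k].
Proof.
(* Cell x may itself be a corner; only the cells after it are tested. *)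
pose Q j := (j == x) || straight A j; have Qx : Q x by rewrite /Q eqxx.
have n5 := cw_n cw.
have xk : x < x + n%:Z by lia.
have [all_st|[y [xy yk st Ny]]] := int_first xk Qx.
  have r : run A x (x + n%:Z).
    by split=> [|j jP|]; [lia| |lia]; have := all_st j; rewrite /Q; lia.
  have := run_A r (j := x + n%:Z); rewrite (cw_per cw).
  have le : x <= x + n%:Z <= x + n%:Z by lia.
  by move=> /(_ le)/eqP; rewrite ptE; case: (step_cases cw x) => -> /=; lia.
exists (y + 1); split; first lia.
  by move=> j jP; have := st j; rewrite /Q; lia.
by move: Ny; rewrite /Q negb_or => /andP[].
Qed.

Lemma straight_hor (x e : int) : (forall j : int, x < j <= e -> straight A j) ->
  x <= e -> hor A e = hor A x.
Proof.
move=> st xe; have [d E] : exists d : nat, e = x + d%:Z by exists `|e - x|%N; lia.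
rewrite {}E in st xe *; elim: d st xe => [|d IH] st xe; first by rewrite addr0.
rewrite hor_straight; last by apply: st; lia.
have -> : x + d.+1%:Z - 1 = x + d%:Z by lia.
by apply: IH => [j jP|]; [apply: st|]; lia.
Qed.

End Corners.

(** * Tokens at the ends of a block *)

Section Ends.
Variables (P : {fset point}) (A : int -> point) (n : nat).
Hypothesis cw : closed_walk A n.
Hypothesis PA : forall x, x \in P <-> exists i : int, x = A i.
Variables (tok : bool -> point -> nat) (c : point -> int).
Hypothesis bal : balanced P tok c.

Notation h s i := (sg s * c (A i)).

Lemma off_walk x : (forall i : int, x <> A i) -> c x = 0.
Proof. by move=> xA; apply: bal.2; apply/negP => /PA[i /xA]. Qed.

(** The distribution is the one on which a move lowers a strip of sign [s] parallel to the walk at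
    x. [back_tok] with side [b] and [front_tok] with side [~~ b] refer to the same distribution and
    to opposite corners of the strip. *)
Definition front_tok (s : bool) (x : int) (b : bool) (e : int) : bool :=
  (0 < tok (s == (hor A x == ~~ b)) (front A b e))%N.
Definition back_tok (s : bool) (x : int) (b : bool) (a : int) : bool :=
  (0 < tok (s == (hor A x == b)) (back A b a))%N.

Definition right_end (s : bool) (x : int) (b : bool) : Prop :=
  exists e : int, [/\ x <= e, forall j : int, x < j < e -> straight A j,
    forall j : int, x <= j <= e -> 0 < h s j & front_tok s x b e].
Definition left_end (s : bool) (x : int) (b : bool) : Prop :=
  exists a : int, [/\ a <= x, forall j : int, a < j < x -> straight A j,
    forall j : int, a <= j <= x -> 0 < h s j & back_tok s x b a].

(** The block stops before the corner k, or includes it. The inequalities negate the conditions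
    under which [D c] would force a token at an inner front corner, for each place where the block
    could stop; only the outer token remains. *)
Definition right_stuck (s : bool) (x k : int) (b : bool) : Prop :=
  [/\ h s k <= 0, h s (k + 1) <= h s k - h s (k - 1) & front_tok s x (~~ b) (k - 1)] \/
  [/\ 0 < h s k, ~~ straight A (k + 1),
      h s (k + 1 + 1) <= h s (k + 1) - h s k,
      h s (k + 1) <= h s k - h s (k - 1) & front_tok s x (~~ b) k].
Definition left_stuck (s : bool) (x k : int) (b : bool) : Prop :=
  [/\ h s k <= 0, h s (k - 1) <= h s k - h s (k + 1) & back_tok s x (~~ b) (k + 1)] \/
  [/\ 0 < h s k, ~~ straight A (k - 1),
      h s (k - 1 - 1) <= h s (k - 1) - h s k,
      h s (k - 1) <= h s k - h s (k + 1) & back_tok s x (~~ b) k].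

Lemma front_tok_straight (s : bool) (x : int) (b : bool) (e : int) :
  straight A e -> hor A e = hor A x ->
  h s (e + 1) < h s e + (if turn A b (e + 1) then h s (e + 1 + 1) else 0) ->
  front_tok s x b e.
Proof.
move=> st he lt; apply: (balanced_tok bal); rewrite (front_straight cw) //.
rewrite (D_sd cw off_walk) he !sgM.
have -> : turn A b e = false by apply/negP => /(turn_corner cw); rewrite st.
by move: lt; case: (turn _ _ _); case: s; case: b; case: (hor A x); rewrite /sg /=; lia.
Qed.

Lemma front_tok_outer (s : bool) (x : int) (b : bool) (k : int) :
  turn A b k -> hor A k = ~~ hor A x -> 0 < h s k -> front_tok s x (~~ b) k.
Proof.
move=> t hk lt; apply: (balanced_tok bal); rewrite (front_outer cw) // (D_outer cw off_walk t) hk !sgM.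
by move: lt; clear t; case: s; case: b; case: (hor A x); rewrite /sg /=; lia.
Qed.

Lemma front_tok_inner (s : bool) (x : int) (b : bool) (k : int) :
  turn A b k -> hor A k = ~~ hor A x ->
  h s (k + 1) < h s k + (if turn A (~~ b) (k + 1) then h s (k + 1 + 1) else 0) ->
  front_tok s x b k.
Proof.
move=> t hk lt; apply: (balanced_tok bal); rewrite (front_turn cw) //.
rewrite (D_sd cw off_walk) hk (turnN cw t) !sgM.
by move: lt; case: (turn _ _ _); clear t; case: s; case: b; case: (hor A x); rewrite /sg /=; lia.
Qed.

Lemma right_cases (s : bool) (x : int) : straight A x -> 0 < h s x ->
  (forall b, right_end s x b) \/
  exists (k : int) (b : bool), [/\ x < k, forall j : int, x < j < k -> straight A j,
    forall j : int, x <= j < k -> 0 < h s j, turn A b k & right_stuck s x k b].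
Proof.
move=> stx hx; have [k [xk st Nk]] := next_corner cw x.
have straightx (j : int) : x <= j < k -> straight A j.
  by move=> jP; case: (eqVneq j x) => [->//|?]; apply: st; lia.
have horx (j : int) : x <= j < k -> hor A j = hor A x.
  by move=> jP; apply: straight_hor; [move=> i iP; apply: st|]; lia.
have [pos|[y [xy yk pos Ny]]] := @int_first (fun j => 0 < h s j) x k xk hx; last first.
  (* The sign is lost before the corner, so both front corners hold a token. *)
  left=> b; exists y; split=> // [j jP|]; first by apply: st; lia.
  apply: front_tok_straight; [apply: straightx; lia|apply: horx; lia|].
  have -> : turn A b (y + 1) = false.
    by apply/negP => /(turn_corner cw); rewrite st //; lia.
  by have := pos y; move: Ny; lia.
have [b t] := corner_turn cw Nk.
have hk : hor A k = ~~ hor A x.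
  by rewrite (hor_turn cw t) horx //; lia.
have posk1 : 0 < h s (k - 1) by apply: pos; lia.
have fr (e : int) (b' : bool) : x <= e <= k -> (e = k -> 0 < h s k) ->
    front_tok s x b' e -> right_end s x b'.
  move=> xe ek ft; exists e; split=> // [|j jP|j jP]; [lia|apply: st; lia|].
  by case: (eqVneq j k) => [E|?]; [rewrite E; apply: ek; lia|apply: pos; lia].
have inner1 (b' : bool) : b' = b -> h s k < h s (k - 1) + h s (k + 1) -> right_end s x b'.
  move=> -> lt; apply: (fr (k - 1)); [lia|lia|].
  by apply: front_tok_straight; rewrite ?subrK ?t; [apply: straightx|apply: horx|]; lia.
have outer1 (b' : bool) : b' = ~~ b -> h s k < h s (k - 1) -> front_tok s x b' (k - 1).
  move=> -> lt; apply: front_tok_straight; rewrite ?subrK ?(turnN cw t);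
    [apply: straightx|apply: horx|]; lia.
have bb (b' : bool) : b' = b \/ b' = ~~ b.
  by clear; case: b'; case: b; [left|right|right|left].
case: (lerP (h s k) 0) => hk0.
  have [lt|ge] := ltrP (h s k) (h s (k - 1) + h s (k + 1)).
    left=> b'; case: (bb b') => E; first exact: inner1.
    by apply: (fr (k - 1)); [lia|lia|apply: outer1 => //; lia].
  by right; exists k, b; split=> //; left; split=> //; [lia|apply: outer1 => //; lia].
have out : front_tok s x (~~ b) k by apply: front_tok_outer.
have flex : right_end s x b -> forall b', right_end s x b'.
  by move=> re b'; case: (bb b') => ->//; apply: (fr k) => //; lia.
have [lt|ge] := ltrP (h s k) (h s (k - 1) + h s (k + 1)).
  by left; apply: flex; apply: inner1.
case: (boolP (turn A (~~ b) (k + 1))) => t'; last first.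
  left; apply: flex; apply: (fr k) => //; first lia.
  by apply: front_tok_inner => //; rewrite (negbTE t'); lia.
have [lt|ge'] := ltrP (h s (k + 1)) (h s k + h s (k + 1 + 1)).
  left; apply: flex; apply: (fr k) => //; first lia.
  by apply: front_tok_inner => //; rewrite t'.
right; exists k, b; split=> //; right; split=> //; try lia.
by apply/negP => st'; rewrite (turn_corner cw t') in st'.
Qed.

End Ends.

Section Irreducible.
Variables (P : {fset point}) (A : int -> point) (n : nat).
Hypothesis cw : closed_walk A n.
Hypothesis PA : forall x, x \in P <-> exists i : int, x = A i.

(** This is [right_cases] for the reversed walk, with the side of the turn negated. *)
Lemma left_cases tok c (s : bool) (x : int) : balanced P tok c ->
  straight A x -> 0 < sg s * c (A x) ->
  (forall b, left_end A tok c s x b) \/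
  exists (k : int) (b : bool), [/\ k < x, forall j : int, k < j < x -> straight A j,
    forall j : int, k < j <= x -> 0 < sg s * c (A j), turn A b k &
    left_stuck A tok c s x k b].
Proof.
move=> bal stx hx.
have PA' y : y \in P <-> exists i : int, y = reversed A i.
  split=> [/PA[i ->]|[i ->]]; first by exists (- i); rewrite /reversed opprK.
  by apply/PA; exists (- i).
have revE (i : int) : reversed A (- i) = A i by rewrite /reversed opprK.
have rcw := reversed_walk cw.
have st' : straight (reversed A) (- x) by rewrite (straight_reversed cw) opprK.
have hx' : 0 < sg s * c (reversed A (- x)) by rewrite revE.
have stj (j : int) : straight (reversed A) (- j) = straight A j.
  by rewrite (straight_reversed cw) opprK.
(* Reversal shifts the index of a step by one; this is harmless because x is straight. *)
have hr : hor (reversed A) (- x) = hor A x.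
  by rewrite hor_reversed opprK -(hor_straight stx).
have ft b (e : int) : front_tok (reversed A) tok s (- x) b e = back_tok A tok s x (~~ b) (- e).
  by rewrite /front_tok /back_tok hr (front_reversed cw).
have [H|[k [b [xk st pos t stuck]]]] := right_cases rcw PA' bal st' hx'.
  left=> b; have [e [xe st pos tk]] := H (~~ b); exists (- e); split.
  - lia.
  - by move=> j jP; rewrite -stj; apply: st; lia.
  - by move=> j jP; rewrite -revE; apply: pos; lia.
  - by rewrite ft negbK in tk.
right; exists (- k), (~~ b); split.
- lia.
- by move=> j jP; rewrite -stj; apply: st; lia.
- by move=> j jP; rewrite -revE; apply: pos; lia.
- by rewrite (turn_reversed cw) in t.
have r1 (i j : int) : i = - j -> reversed A i = A j by move=> ->; rewrite revE.
case: stuck => -[h1 h2 h3]; [left; move: h1 h2 h3|move=> h4 h5; right; move: h1 h2 h3 h4 h5].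
  rewrite ft (r1 k (- k)) ?opprK // (r1 (k + 1) (- k - 1)); last lia.
  rewrite (r1 (k - 1) (- k + 1)); last lia.
  by have -> : - (k - 1) = - k + 1 by lia.
rewrite ft (r1 k (- k)) ?opprK // (r1 (k + 1) (- k - 1)); last lia.
rewrite (r1 (k - 1) (- k + 1)); last lia.
rewrite (r1 (k + 1 + 1) (- k - 1 - 1)); last lia.
have -> : k + 1 = - (- k - 1) by lia.
by rewrite stj.
Qed.

Variables (tok : bool -> point -> nat) (c : point -> int).
Hypothesis bal : balanced P tok c.
Hypothesis irr : ~ reducible P tok c.

Notation h s i := (sg s * c (A i)).

Let off := off_walk PA bal.

Lemma A_in (i : int) : A i \in P.
Proof. by apply/PA; exists i. Qed.

Lemma strip_inner (a e : int) : run A a e -> inner_interval P (strip A a e).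
Proof.
move=> r; split=> [|x /(strip_cell cw _ r)[j _ ->]]; first exact: strip_proper.
exact: A_in.
Qed.

Lemma cell_inner (i : int) : inner_interval P (cell (A i)).
Proof.
split=> [|x]; first by rewrite /proper /=; lia.
rewrite subitv_cell /= => H; have -> : x = A i by apply: pt_eq; lia.
exact: A_in.
Qed.

Lemma lower_weight (s : bool) (I : interval) :
  inner_interval P I -> (forall x, subitv (cell x) I -> 0 < sg s * c x) ->
  (weight P (fun x => c x + sg (~~ s) * ind I x)%R < weight P c)%N.
Proof.
case: I => -[a b] a' [/andP[/= l1 l2] inP] pos.
have sub : subitv (cell (a, b)) ((a, b), a') by rewrite subitv_cell /=; lia.
apply: (weight_lt (inP _ sub)).
  by have := pos _ sub; rewrite /ind sub sgN; case: s pos => pos; rewrite /sg; lia.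
move=> y; rewrite /ind; case: (boolP (subitv _ _)) => [/pos|]; last by rewrite mulr0 addr0.
by rewrite sgN; case: s pos => pos; rewrite /sg; lia.
Qed.

Lemma quad_irr (s t t' : bool) I p q r u : inner_interval P I ->
  (forall x, subitv (cell x) I -> 0 < sg s * c x) ->
  quad t' I p q r u -> (0 < tok t p)%N -> (0 < tok t q)%N -> t = (s == ~~ t') -> False.
Proof.
move=> iI pos qd tp tq E; apply: irr.
have [tok' [C _ bal']] := one_move bal iI qd tp tq.
exists tok', (fun x => c x + sg (~~ s) * ind I x); split=> //; last exact: lower_weight.
by have <- : (t == t') = ~~ s by rewrite E; case: (s) (t') => -[].
Qed.

Lemma strip_irr (s : bool) (a e : int) (b : bool) : run A a e ->
  (forall j : int, a <= j <= e -> 0 < h s j) ->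
  (0 < tok (s == (hor A a == b)) (back A b a))%N ->
  (0 < tok (s == (hor A a == b)) (front A (~~ b) e))%N -> False.
Proof.
move=> r pos tb tf; have := strip_quad cw b r; rewrite quadC => qd.
apply: (quad_irr (strip_inner r) _ qd tf tb (s := s)); last by rewrite negbK.
by move=> x /(strip_cell cw _ r)[j jP ->]; apply: pos.
Qed.

Lemma ends_irr (s : bool) (x : int) (b : bool) : straight A x ->
  left_end A tok c s x b -> right_end A tok c s x (~~ b) -> False.
Proof.
move=> stx [a [ax st1 pos1 tb]] [e [xe st2 pos2 tf]].
have r : run A a e.
  split=> [|j jP|ae]; [lia| |by have -> : a = x by lia].
  have [?|[->//|?]] : j < x \/ j = x \/ x < j by lia.
    by apply: st1; lia.
  by apply: st2; lia.
have hx : hor A x = hor A a.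
  rewrite /hor; case: (ltrP x e) => xe'; first by rewrite (run_step r) //; lia.
  move: stx; rewrite /straight => /eqP ->; have -> : x = e by lia.
  by rewrite (run_prev r).
apply: (strip_irr r (s := s) (b := b)).
- by move=> j jP; case: (lerP j x) => ?; [apply: pos1|apply: pos2]; lia.
- by rewrite -hx.
- by rewrite -hx; move: tf; rewrite /front_tok negbK.
Qed.

(** By [turn_alternate] the two turns go to opposite sides. Their outer corners, which hold tokens,
    are then opposite corners of the strip formed by the two cells. *)
Lemma corners_irr (s : bool) (i : int) : ~~ straight A i -> ~~ straight A (i + 1) ->
  0 < h s i -> 0 < h s (i + 1) -> False.
Proof.
move=> /(corner_turn cw)[b t] Ni hi hi1.
have t1 : turn A (~~ b) (i + 1).
  by move: (turn_alternate cw t) Ni; case: (turn_cases cw (i + 1)) => [->//|t1|t1];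
    case: (b) => /=; rewrite t1.
have r : run A i (i + 1) by split; lia.
have hor1 := hor_turn cw t1; rewrite addrK in hor1.
apply: (strip_irr r (s := s) (b := ~~ b)).
- by move=> j jP; have [->|->] : j = i \/ j = i + 1 by lia.
- apply: (balanced_tok bal); rewrite back_outer (D_outer cw off t) !sgM.
  by move: hi; clear; case: s; case: b; case: (hor A i); rewrite /sg /=; lia.
- apply: (balanced_tok bal); rewrite (front_outer cw) // (D_outer cw off t1) hor1 !sgM.
  by move: hi1; clear; case: s; case: b; case: (hor A i); rewrite /sg /=; lia.
Qed.

(** An isolated corner cell has tokens at its outer and at its inner corner, which are opposite, so
    the cell can be lowered alone. *)
Lemma corner_irr (s : bool) (i : int) : ~~ straight A i ->
  h s (i - 1) <= 0 -> 0 < h s i -> h s (i + 1) <= 0 -> False.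
Proof.
move=> /(corner_turn cw)[b t] h0 h1 h2.
have := cell_quad cw t; rewrite quadC => qd.
apply: (quad_irr (cell_inner i) _ qd (s := s) _ _ (erefl _)).
- move=> x; rewrite subitv_cell /= => H; have -> : x = A i by apply: pt_eq; lia.
  by [].
- apply: (balanced_tok bal); rewrite (D_sd cw off) t (turn_alternate cw t) !sgM !sgN.
  by move: h0 h1 h2; clear; case: s; case: b; case: (hor A i); rewrite /sg /=; lia.
- apply: (balanced_tok bal); rewrite (D_outer cw off t) !sgM !sgN.
  by move: h0 h1 h2; clear; case: s; case: b; case: (hor A i); rewrite /sg /=; lia.
Qed.

(** A free end offers tokens on both sides and could be matched with any other end. Two stuck ends
    with turns to different sides have their outer tokens at opposite corners. So both ends are
    stuck and turn to the same side. *)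
Lemma stuck_block (s : bool) (x : int) : straight A x -> 0 < h s x ->
  exists (j k : int) (b : bool), [/\ j < x < k,
    forall i : int, j < i < k -> straight A i /\ 0 < h s i,
    turn A b j /\ turn A b k, left_stuck A tok c s x j b & right_stuck A tok c s x k b].
Proof.
move=> stx hx.
have LE (k : int) (b : bool) : k < x -> (forall j : int, k < j < x -> straight A j) ->
    (forall j : int, k < j <= x -> 0 < h s j) -> left_stuck A tok c s x k b ->
    left_end A tok c s x (~~ b).
  move=> kx st pos [[h1 h2 h3]|[h1 h2 h3 h4 h5]].
    by exists (k + 1); split=> // [|j jP|j jP]; [lia|apply: st; lia|apply: pos; lia].
  exists k; split=> // [|j jP]; first lia.
  by case: (eqVneq j k) => [->//|?]; apply: pos; lia.
have RE (k : int) (b : bool) : x < k -> (forall j : int, x < j < k -> straight A j) ->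
    (forall j : int, x <= j < k -> 0 < h s j) -> right_stuck A tok c s x k b ->
    right_end A tok c s x (~~ b).
  move=> kx st pos [[h1 h2 h3]|[h1 h2 h3 h4 h5]].
    by exists (k - 1); split=> // [|j jP|j jP]; [lia|apply: st; lia|apply: pos; lia].
  exists k; split=> // [|j jP]; first lia.
  by case: (eqVneq j k) => [->//|?]; apply: pos; lia.
have irrb b : left_end A tok c s x b -> right_end A tok c s x (~~ b) -> False.
  exact: ends_irr.
have [RF|[k [b [xk st2 pos2 t2 stk2]]]] := right_cases cw PA bal stx hx;
  have [LF|[j [b' [jx st1 pos1 t1 stk1]]]] := left_cases bal stx hx.
- by case: (irrb true).
- by case: (irrb (~~ b')) => //; apply: (LE j).
- by case: (irrb b) => //; apply: (RE k).
have E : b' = b.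
  case: (eqVneq b' b) => // ne; exfalso; apply: (irrb b); last exact: (RE k).
  have -> : b = ~~ b' by case: b b' ne {st2 pos2 t2 stk2 st1 pos1 t1 stk1} => -[].
  exact: (LE j).
rewrite {}E in t1 stk1.
exists j, k, b; split=> //; first lia.
move=> i iP; have [?|[->//|?]] : i < x \/ i = x \/ x < i by lia.
  by split; [apply: st1|apply: pos1]; lia.
by split; [apply: st2|apply: pos2]; lia.
Qed.

End Irreducible.

Lemma sg_eq0 (s : bool) (z : int) : sg s * z = 0 -> z = 0.
Proof. by case: s; rewrite /sg; lia. Qed.

Lemma sg_neq0 (s : bool) (z : int) : 0 < sg s * z -> z != 0.
Proof. by case: s; rewrite /sg; lia. Qed.

Lemma sg_sub (s : bool) (z : int) : 0 < sg s * z -> `|z - sg s| < `|z|.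
Proof. by case: s; rewrite /sg; lia. Qed.

Lemma sg_add (s : bool) (z : int) : sg s * z < 0 -> `|z + sg s| < `|z|.
Proof. by case: s; rewrite /sg; lia. Qed.

(* Boolean equations in the context make [lia] split cases. *)
Ltac ilia := repeat match goal with H : @eq bool _ _ |- _ => clear H end; lia.

(** * Stuck blocks *)

Section Junctions.
Variables (P : {fset point}) (A : int -> point) (n : nat).
Hypothesis cw : closed_walk A n.
Hypothesis PA : forall x, x \in P <-> exists i : int, x = A i.
Variables (tok : bool -> point -> nat) (c : point -> int).
Hypothesis bal : balanced P tok c.
Hypothesis irr : ~ reducible P tok c.

Notation h s i := (sg s * c (A i)).

Let off := off_walk PA bal.

(* The end corners j and k belong to the block; the last two conditions say that
   no move is available at its ends. *)
Definition stuck (s : bool) (j k : int) (b : bool) : Prop :=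
  [/\ j + 1 < k, forall i : int, j < i < k -> straight A i /\ 0 < h s i,
    turn A b j /\ turn A b k, left_stuck A tok c s (k - 1) j b &
    right_stuck A tok c s (k - 1) k b].

Lemma stuck_ex (s : bool) (x : int) : straight A x -> 0 < h s x ->
  exists (j k : int) (b : bool), j < x < k /\ stuck s j k b.
Proof.
move=> stx hx; have [j [k [b [jxk inner [tj tk] ls rs]]]] := stuck_block cw PA bal irr stx hx.
have hk : hor A (k - 1) = hor A x.
  by apply: straight_hor => [i iP|]; [have [] := inner i|]; ilia.
exists j, k, b; split=> //; split=> //; first ilia.
- by move: ls; rewrite /left_stuck /back_tok hk.
- by move: rs; rewrite /right_stuck /front_tok hk.
Qed.

Lemma stuck_left (s : bool) (j k : int) (b : bool) : stuck s j k b ->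
  exists a : int, [/\ j <= a <= j + 1, forall i : int, a <= i < k -> 0 < h s i &
    back_tok A tok s (k - 1) (~~ b) a].
Proof.
case=> jk inner _ [[_ _ bt]|[hj _ _ _ bt]] _; [exists (j + 1)|exists j]; split=> //.
- by ilia.
- by move=> i iP; have [] := inner i; ilia.
- by ilia.
- by move=> i iP; case: (eqVneq i j) => [->//|?]; have [] := inner i; ilia.
Qed.

Lemma stuck_right (s : bool) (j k : int) (b : bool) : stuck s j k b ->
  exists e : int, [/\ k - 1 <= e <= k, forall i : int, j < i <= e -> 0 < h s i &
    front_tok A tok s (k - 1) (~~ b) e].
Proof.
case=> jk inner _ _ [[_ _ bt]|[hk _ _ _ bt]]; [exists (k - 1)|exists k]; split=> //.
- by ilia.
- by move=> i iP; have [] := inner i; ilia.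
- by ilia.
- by move=> i iP; case: (eqVneq i k) => [->//|?]; have [] := inner i; ilia.
Qed.

(* If the next block started right at corner k, two moves, one on each token
   distribution, would leave c (A k) = 0 unchanged and reduce both blocks. *)
Lemma stuck_corner_next (s : bool) (j k : int) (b : bool) :
  stuck s j k b -> ~~ straight A (k + 1).
Proof.
move=> st0; case: (st0) => jk inner [tj tk] ls [[hk0 hk1 ft]|[_ ->//]].
apply/negP => st1.
have [stk1 posk1] : straight A (k - 1) /\ 0 < h s (k - 1) by apply: inner; ilia.
have hk1' : 0 < h (~~ s) (k + 1) by rewrite sgN; ilia.
have [j' [k' [b' [jk' st0']]]] := stuck_ex st1 hk1'.
case: (st0') => _ inner' [tj' tk'] ls' rs'.
(* The corner k cannot be interior to a block. *)
have Ej : j' = k.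
  case: (ltrP j' k) => [lt|]; last by ilia.
  by have [|] := inner' k; [ilia|rewrite (turn_corner cw tk)].
rewrite {}Ej in st0' inner' tj' ls' jk'.
have Eb : b' = b.
  have := turnN cw tk; case: b' b tj' tk {st0' tk' ls' rs' st0 tj ls ft} => -[] //= ->//.
rewrite {}Eb in st0' tj' tk' ls' rs'.
have hor1 : hor A (k' - 1) = hor A (k + 1).
  by apply: straight_hor => [i iP|]; [have [] := inner' i|]; ilia.
have hork : hor A (k + 1) = hor A k by have := hor_straight st1; rewrite addrK.
have horx : hor A k = ~~ hor A (k - 1) by rewrite (hor_turn cw tk).
case: ls' => [[hk0' _ bt]|[_ ncor]]; last by rewrite stk1 in ncor.
have hk : c (A k) = 0 by apply: (@sg_eq0 s); move: hk0 hk0'; rewrite sgN; clear; ilia.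
have [a [ja posa bta]] := stuck_left st0.
have [e [ke pose fte]] := stuck_right st0'.
have r1 : run A k e.
  split=> [|i iP|]; [by clear -ke jk'; lia| |by clear -ke jk'; lia].
  by have [|//] := inner' i; clear -iP ke; lia.
have r2 : run A a k.
  split=> [|i iP|]; [by clear -ja jk; lia| |by clear -ja jk; lia].
  by have [|//] := inner i; clear -iP ja; lia.
have hora : hor A a = hor A (k - 1) by rewrite /hor (run_prev r2).
have q1 := strip_quad cw b r1; rewrite quadC in q1.
have q2 := strip_quad cw (~~ b) r2; rewrite quadC in q2.
have i1 := strip_inner cw PA r1; have i2 := strip_inner cw PA r2.
(* The tokens cross over: the token at which each block is stuck here is also a corner of the other
   block's strip, once that strip is extended to cell k. *)
have B1 : back A b k = front A (~~ b) (k - 1).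
  by rewrite (back_turn cw tk) (front_straight cw).
have B2 : front A (~~ ~~ b) k = back A (~~ b) (k + 1).
  by rewrite negbK (front_turn cw tk) (back_straight cw) ?addrK.
(* The strip of the next block moves on distribution [t], the strip of this block on [~~ t], so the
   second move still finds its tokens. *)
pose t := s == (hor A (k - 1) == b).
have [||tok1 [C1 same bal1]] := one_move bal i1 q1 (t := t) _ _.
- by move: fte; rewrite /front_tok /t hor1 hork horx; case: (s) (hor A _) (b) => -[] [].
- by rewrite B1; move: ft; rewrite /front_tok /t negbK.
have [||tok2 [C2 _ bal2]] := one_move bal1 i2 q2 (t := ~~ t) _ _.
- rewrite same B2; move: bt; rewrite /back_tok /t hor1 hork horx.
  by case: (s) (hor A _) (b) => -[] [].
- rewrite same; move: bta; rewrite /back_tok /t.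
  by case: (s) (hor A _) (b) => -[] [].
have E1 : (t == ~~ (hor A k == b)) = s.
  by rewrite /t horx; case: (s) (hor A _) (b) => -[] [].
have E2 : (~~ t == ~~ (hor A a == ~~ b)) = ~~ s.
  by rewrite /t hora; case: (s) (hor A _) (b) => -[] [].
rewrite E1 E2 in bal2.
apply: irr; exists tok2; eexists; split; [|exact: bal2|].
- by move=> u; apply: conn_trans (C1 u) (C2 u).
- have in1 y : subitv (cell y) (strip A k e) -> y = A k \/ sg s * c y < 0.
    move=> /(strip_cell cw _ r1)[i iP ->]; case: (eqVneq i k) => [->|ne]; first by left.
    by right; have := pose i; rewrite sgN; clear -iP ne; lia.
  have in2 y : subitv (cell y) (strip A a k) -> y = A k \/ 0 < sg s * c y.
    move=> /(strip_cell cw _ r2)[i iP ->]; case: (eqVneq i k) => [->|ne]; first by left.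
    by right; apply: posa; clear -iP ne; lia.
  have kin1 : subitv (cell (A k)) (strip A k e) by apply/(strip_cell cw _ r1); exists k => //; clear -ke jk'; lia.
  have kin2 : subitv (cell (A k)) (strip A a k) by apply/(strip_cell cw _ r2); exists k => //; clear -ja jk; lia.
  have ain : subitv (cell (A a)) (strip A a k) by apply/(strip_cell cw _ r2); exists a => //; clear -ja jk; lia.
  rewrite sgN.
  have pa : 0 < h s a by apply: posa; clear -ja jk; lia.
  apply: (@weight_lt _ _ _ (A a)); first exact: (A_in PA).
    rewrite /ind ain; case: (boolP (subitv _ _)) => [/in1[E|]|_].
    + by rewrite E hk mulr0 in pa.
    + by rewrite ltNge (ltW pa).
    + by rewrite mulr0 addr0 mulr1 sg_sub.
  move=> y; rewrite /ind; case: (boolP (subitv _ _)) => [/in1[->|m1]|n1].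
  + by rewrite kin2 hk !mulr1 add0r subrr.
  + case: (boolP (subitv _ _)) => [/in2[->|m2]|_].
    * by rewrite hk !mulr1 add0r subrr.
    * by move: m1; rewrite ltNge (ltW m2).
    * by rewrite mulr0 addr0 mulr1 ltW // sg_add.
  + case: (boolP (subitv _ _)) => [/in2[E|m2]|_]; last by rewrite !mulr0 !addr0.
      by rewrite E kin1 in n1.
    by rewrite mulr0 addr0 mulr1 ltW // sg_sub.
Qed.

(* The strip of a stuck block contains its end corner k unless [c] vanishes there, and its
   first corner j only if [c] vanishes on the cell before; with this asymmetric rule
   the strips of consecutive blocks share a single vertex. *)
Definition stop (k : int) : int := if c (A k) == 0 then k - 1 else k.
Definition start (j : int) : int := if c (A (j - 1)) == 0 then j else j + 1.

Lemma stuck_stop (s : bool) (j k : int) (b : bool) : stuck s j k b ->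
  [/\ k - 1 <= stop k <= k, forall i : int, j < i <= stop k -> 0 < h s i,
      front_tok A tok s (k - 1) (~~ b) (stop k) & h s (stop k + 2) < 0].
Proof.
move=> st0; have Nk := stuck_corner_next st0.
case: (st0) => jk inner [tj tk] ls rs.
have [stk1 posk1] : straight A (k - 1) /\ 0 < h s (k - 1) by apply: inner; ilia.
have E12 : k + 1 + 1 = k + 2 by ilia.
rewrite /stop; case: rs => [[hk0 hk1 ft]|[hk _ h2 _ ft]].
  have -> : c (A k) = 0.
    (* A nonzero corner k would have sign [~~ s], and so would the corner k+1, against
       [corners_irr]. *)
    case: (eqVneq (c (A k)) 0) => // ne; exfalso.
    apply: (corners_irr cw PA bal irr (s := ~~ s) _ Nk); rewrite ?(turn_corner cw tk) // sgN.
      by move: ne hk0; clear; case: (s); rewrite /sg; ilia.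
    by ilia.
  rewrite eqxx; split=> //; [ilia| |].
    by move=> i iP; have [] := inner i; ilia.
  have -> : k - 1 + 2 = k + 1 by lia.
  by apply: (le_lt_trans hk1); lia.
rewrite (negbTE (sg_neq0 hk)); split=> //; [ilia| |].
  by move=> i iP; case: (eqVneq i k) => [->//|?]; have [] := inner i; ilia.
rewrite -E12; suff : h s (k + 1) <= 0 by ilia.
rewrite leNgt; apply/negP => hk1.
by apply: (corners_irr cw PA bal irr (s := s) _ Nk); rewrite ?(turn_corner cw tk).
Qed.

(** If c vanishes before j, the first alternative of [left_stuck] contradicts the positive height at
    j+1, so the corner j has the sign of the block whenever the strip includes it. *)
Lemma stuck_start (s : bool) (j k : int) (b : bool) : stuck s j k b ->
  j <= start j <= j + 1 /\ forall i : int, start j <= i < k -> 0 < h s i.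
Proof.
case=> jk inner _ ls _; rewrite /start; case: eqP => E; split; try ilia; move=> i iP.
  case: (eqVneq i j) => [->|?]; last by have [] := inner i; ilia.
  case: ls => [[h1 h2 _]|[//]].
  by have [] := inner (j + 1); [ilia|]; move: h2; rewrite E mulr0; ilia.
by have [] := inner i; ilia.
Qed.

(** Cell k+1 is a corner. If k+2 is straight, the next block begins at k+1, otherwise at k+2 after
    three corners. Either way exactly one cell lies between the strips, and they share its inner
    corner. The last equation says that the far tokens of both blocks belong to the same
    distribution. *)
Lemma stuck_next (s : bool) (j k : int) (b : bool) : stuck s j k b ->
  exists (j' k' : int) (b' : bool),
    [/\ stuck (~~ s) j' k' b', k < j' <= k + 2 /\ (forall i : int, k <= i <= j' -> ~~ straight A i),
        j' = if straight A (k + 2) then k + 1 else k + 2,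
        start j' = stop k + 2 &
        back A b' (start j') = front A b (stop k) /\
        (~~ s == (hor A (k' - 1) == b')) = (s == (hor A (k - 1) == b))].
Proof.
move=> st0; have Nk := stuck_corner_next st0.
have [ek pos ft h2] := stuck_stop st0.
case: (st0) => jk inner [tj tk] ls rs.
have Nk0 : ~~ straight A k by rewrite (turn_corner cw tk).
have [stk1 posk1] : straight A (k - 1) /\ 0 < h s (k - 1) by apply: inner; ilia.
have tk1 : turn A (~~ b) (k + 1).
  by move: (turn_alternate cw tk) Nk; case: (turn_cases cw (k + 1)) => [->//|t1|t1];
    case: (b) => /=; rewrite t1.
have E12 : k + 1 + 1 = k + 2 by ilia.
have E23 : k + 2 + 1 = k + 3 by ilia.
have hork : hor A k = ~~ hor A (k - 1) by rewrite (hor_turn cw tk).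
have hork1 : hor A (k + 1) = hor A (k - 1).
  by rewrite (hor_turn cw tk1) addrK hork negbK.
(* A stuck block of the other sign through a straight cell that follows a corner must begin at that
   corner. *)
have leftc (x : int) : straight A x -> ~~ straight A (x - 1) -> h s x < 0 -> 
    exists k' b', stuck (~~ s) (x - 1) k' b'.
  move=> stx Nx hx; have [j' [k' [b' [jk' st']]]] : exists (j' k' : int) (b' : bool),
      j' < x < k' /\ stuck (~~ s) j' k' b' by apply: stuck_ex => //; rewrite sgN; ilia.
  exists k', b'; suff <- : j' = x - 1 by [].
  case: (ltrP j' (x - 1)) => [lt|]; last by ilia.
  by case: st' => _ inn _ _ _; have [|] := inn (x - 1); [ilia|rewrite (negbTE Nx)].
have hk2 : h s (k + 2) < 0.
  case: (eqVneq (stop k) k) => [E|ne]; first by rewrite -{1}E.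
  have Es : stop k = k - 1 by ilia.
  have ck : c (A k) = 0.
    by move: Es; rewrite /stop; case: eqP => // _; ilia.
  rewrite Es (_ : k - 1 + 2 = k + 1) in h2; last by ilia.
  rewrite ltNge; apply/negP => ge.
  apply: (corner_irr cw PA bal irr (s := ~~ s) Nk); rewrite ?addrK ?E12 ?sgN ?ck ?mulr0; ilia.
have hors (x k' : int) b' : stuck (~~ s) x k' b' -> hor A (k' - 1) = hor A (x + 1).
  by case=> xk inn _ _ _; apply: straight_hor => [i iP|]; [have [] := inn i|]; ilia.
have sN : (~~ s == ~~ (hor A (k - 1) == b)) = (s == (hor A (k - 1) == b)).
  by clear; case: (s) (hor A _) (b) => -[] [].
have turnb (x : int) b1 b2 : turn A b1 x -> turn A b2 x -> b1 = b2.
  move=> t1 t2; case: (eqVneq b1 b2) => // ne; have := turnN cw t1.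
  by (have -> : ~~ b1 = b2 by move: ne; clear; case: b1; case: b2); rewrite t2.
case: (boolP (straight A (k + 2))) => stk2.
  have Ek : k + 2 - 1 = k + 1 by ilia.
  have := leftc (k + 2) stk2; rewrite Ek => /(_ Nk hk2)[k' [b' st']].
  have Eb : b' = ~~ b by case: (st') => _ _ [t' _] _ _; apply: turnb t' tk1.
  rewrite {}Eb in st'; exists (k + 1), k', (~~ b); split=> //.
  - split; first ilia.
    by move=> i iP; have [->|->] : i = k \/ i = k + 1 by ilia.
  - by rewrite /start /stop addrK; case: eqP; ilia.
  split; last first.
    rewrite (hors _ _ _ st') E12 (hor_straight stk2) Ek hork1 -sN.
    by clear; case: (s) (hor A _) (b) => -[] [].
  rewrite /start /stop addrK; case: eqP => _.
    by rewrite (back_turn cw tk1) addrK negbK (front_straight cw _ stk1) (sd_turn cw tk).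
  by rewrite E12 (back_straight cw _ stk2) Ek (front_turn cw tk) (sd_turn cw tk1) addrK.
(* Otherwise the corners k+1 and k+2 would both have sign [~~ s]. *)
have stopk : stop k = k.
  case: (eqVneq (stop k) k) => // ne; exfalso.
  have Ek : stop k + 2 = k + 1 by ilia.
  rewrite Ek in h2.
  by apply: (corners_irr cw PA bal irr (s := ~~ s) (i := k + 1)); rewrite ?E12 // sgN; ilia.
have ck1 : c (A (k + 1)) = 0.
  case: (eqVneq (c (A (k + 1))) 0) => // ne; exfalso.
  case: (ltrP 0 (h s (k + 1))) => hk1.
    apply: (corners_irr cw PA bal irr (s := s) Nk0 Nk) => //.
    by apply: pos; rewrite stopk; ilia.
  apply: (corners_irr cw PA bal irr (s := ~~ s) (i := k + 1)); rewrite ?E12 // sgN; last ilia.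
  by move: ne hk1; clear; case: (s); rewrite /sg; ilia.
have Ek2 : k + 2 - 1 = k + 1 by clear; lia.
have hk3 : h s (k + 3) < 0.
  rewrite ltNge; apply/negP => ge.
  apply: (corner_irr cw PA bal irr (s := ~~ s) stk2); rewrite ?E23 ?Ek2 ?ck1 ?sgN ?mulr0 //; first by rewrite mulNr oppr_gt0.
  by rewrite mulNr oppr_le0.
(* A fourth corner would have the same sign as the corner k+2. *)
have stk3 : straight A (k + 3).
  apply/negPn/negP => Nk3.
  by apply: (corners_irr cw PA bal irr (s := ~~ s) (i := k + 2)); rewrite ?E23 ?sgN //; ilia.
have Ek : k + 3 - 1 = k + 2 by clear; lia.
have tk2 : turn A b (k + 2).
  move: (turn_alternate cw tk1) stk2; rewrite E12.
  by case: (turn_cases cw (k + 2)) => [->//|t1|t1]; case: (b) => /=; rewrite t1.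
have := leftc (k + 3) stk3; rewrite Ek => /(_ stk2 hk3)[k' [b' st']].
have Eb : b' = b by case: (st') => _ _ [t' _] _ _; apply: turnb t' tk2.
rewrite {}Eb in st'; exists (k + 2), k', b; split=> //.
- split; first ilia.
  by move=> i iP; have [->|[->|->]] : i = k \/ i = k + 1 \/ i = k + 2 by ilia.
- by rewrite /start Ek2 ck1 eqxx stopk.
rewrite /start Ek2 ck1 eqxx stopk; split.
  by rewrite (back_turn cw tk2) Ek2 (sd_turn cw tk1) addrK (front_turn cw tk).
rewrite (hors _ _ _ st') E23 (hor_straight stk3) Ek (hor_turn cw tk2) Ek2 hork1 -sN.
by clear; case: (s) (hor A _) (b) => -[] [].
Qed.

End Junctions.

(** * Periodicity *)

Section Shift.
Variables (A : int -> point) (n : nat).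
Hypothesis cw : closed_walk A n.

Lemma A_shift (i q : int) : A (i + q * n%:Z) = A i.
Proof.
have pos (m : nat) (j : int) : A (j + m%:Z * n%:Z) = A j.
  elim: m j => [|m IH] j; first by rewrite mul0r addr0.
  have -> : j + m.+1%:Z * n%:Z = j + m%:Z * n%:Z + n%:Z by lia.
  by rewrite (cw_per cw).
case: q => m; first exact: pos.
by rewrite -(pos m.+1 (i + _)); congr (A _); lia.
Qed.

Lemma A_eq_shift (i j : int) : A i = A j -> exists q : int, i = j + q * n%:Z.
Proof. by move/(cw_inj cw)/dvdzP=> [q E]; exists q; rewrite -E; lia. Qed.

Lemma step_shift (i q : int) : step A (i + q * n%:Z) = step A i.
Proof.
rewrite !stepE A_shift; have -> : i + q * n%:Z + 1 = i + 1 + q * n%:Z by lia.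
by rewrite A_shift.
Qed.

Lemma shiftC (i d q : int) : i + q * n%:Z + d = i + d + q * n%:Z.
Proof. by lia. Qed.

Lemma straight_shift (i q : int) : straight A (i + q * n%:Z) = straight A i.
Proof. by rewrite /straight shiftC !step_shift. Qed.

Lemma turn_shift (b : bool) (i q : int) : turn A b (i + q * n%:Z) = turn A b i.
Proof. by rewrite /turn shiftC !step_shift. Qed.

Lemma hor_shift (i q : int) : hor A (i + q * n%:Z) = hor A i.
Proof. by rewrite /hor step_shift. Qed.

Lemma sd_shift (b : bool) (i q : int) : sd A b (i + q * n%:Z) = sd A b i.
Proof. by rewrite /sd step_shift A_shift. Qed.

Lemma back_shift (b : bool) (i q : int) : back A b (i + q * n%:Z) = back A b i.
Proof. by rewrite /back /oppc sd_shift A_shift. Qed.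

Lemma front_shift (b : bool) (i q : int) : front A b (i + q * n%:Z) = front A b i.
Proof. by rewrite /front /oppc shiftC sd_shift A_shift. Qed.

Lemma strip_shift (a e q : int) : strip A (a + q * n%:Z) (e + q * n%:Z) = strip A a e.
Proof. by rewrite /strip !A_shift. Qed.

Variables (tok : bool -> point -> nat) (c : point -> int).

Lemma stop_shift (k q : int) : stop A c (k + q * n%:Z) = stop A c k + q * n%:Z.
Proof. by rewrite /stop A_shift; case: eqP; rewrite ?shiftC. Qed.

Lemma start_shift (k q : int) : start A c (k + q * n%:Z) = start A c k + q * n%:Z.
Proof. by rewrite /start shiftC A_shift; case: eqP; rewrite ?shiftC. Qed.

Lemma stuck_shift (s : bool) (j k q : int) (b : bool) :
  stuck A tok c s j k b -> stuck A tok c s (j + q * n%:Z) (k + q * n%:Z) b.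
Proof.
case=> jk inner [tj tk] ls rs; split.
- by rewrite shiftC; clear -jk; lia.
- move=> i iP; have -> : i = i - q * n%:Z + q * n%:Z by rewrite subrK.
  by rewrite straight_shift A_shift; apply: inner; clear -iP; lia.
- by rewrite !turn_shift.
- by move: ls; rewrite /left_stuck /back_tok !shiftC !A_shift !straight_shift
    !hor_shift !back_shift.
- by move: rs; rewrite /right_stuck /front_tok !shiftC !A_shift !straight_shift
    !hor_shift !front_shift.
Qed.

End Shift.

Section StuckFacts.
Variables (P : {fset point}) (A : int -> point) (n : nat).
Hypothesis cw : closed_walk A n.
Hypothesis PA : forall x, x \in P <-> exists i : int, x = A i.
Variables (tok : bool -> point -> nat) (c : point -> int).
Hypothesis bal : balanced P tok c.
Hypothesis irr : ~ reducible P tok c.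

Notation h s i := (sg s * c (A i)).
Notation stuck := (stuck A tok c).
Notation start := (start A c).
Notation stop := (stop A c).

(** A nonzero corner has a neighbour of its own sign by [corner_irr], which is straight by
    [corners_irr]; a block passes through it. *)
Lemma exists_stuck (x : point) : c x != 0 ->
  exists (s : bool) (j k : int) (b : bool), stuck s j k b.
Proof.
move=> cx; have /PA[i E] : x \in P.
  by case: (boolP (x \in P)) => // /(bal.2) E; rewrite E in cx.
rewrite {x}E in cx.
have [s hs] : exists s, 0 < h s i.
  by case: (ltrgtP 0 (c (A i))) cx => // ? _; [exists true|exists false]; rewrite /sg; lia.
case: (boolP (straight A i)) => [st|Ni].
  by have [j [k [b [_ stk]]]] := stuck_ex cw PA bal irr st hs; exists s, j, k, b.
have nb (i' : int) : straight A i' -> 0 < h s i' ->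
    exists (s : bool) (j k : int) (b : bool), stuck s j k b.
  by move=> st hs'; have [j [k [b [_ stk]]]] := stuck_ex cw PA bal irr st hs'; exists s, j, k, b.
case: (ltrP 0 (h s (i - 1))) => h1.
  apply: (nb (i - 1)) => //; apply/negPn/negP => Ni1.
  by apply: (corners_irr cw PA bal irr (s := s) Ni1); rewrite ?subrK.
case: (ltrP 0 (h s (i + 1))) => h2.
  apply: (nb (i + 1)) => //; apply/negPn/negP => Ni1.
  exact: (corners_irr cw PA bal irr (s := s) Ni).
by case: (corner_irr cw PA bal irr Ni h1 hs h2).
Qed.

(** At most three corners separate a block from the next, so passing from block to block never gets
    across four corners in a row. *)
Lemma no_four_corners (k0 : int) : (forall i : int, k0 <= i <= k0 + 3 -> ~~ straight A i) ->
  forall s j k b, stuck s j k b -> False.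
Proof.
move=> Nk s j k b st.
have [q jq] : exists q : int, j < k0 + q * n%:Z.
  by exists (`|j - k0| + 1); have := cw_n cw; clear; nia.
pose k1 := k0 + q * n%:Z.
have Nk1 (i : int) : k1 <= i <= k1 + 3 -> ~~ straight A i.
  move=> iP; have -> : i = i - q * n%:Z + q * n%:Z by rewrite subrK.
  by rewrite (straight_shift cw); apply: Nk; move: iP; rewrite /k1; clear; lia.
have [d E] : exists d : nat, k1 = j + d%:Z.
  by exists `|(k1 - j)%R|%N; move: jq; rewrite -/k1; clear; lia.
elim/ltn_ind: d s j k b st {jq} E => d IH s j k b st E.
case: (posnP d) => [d0|d0].
  case: st => jk inner _ _ _; have [|st1 _] := inner (j + 1); first by clear -jk; lia.
  by have := Nk1 (j + 1); rewrite st1 => H; have : false by apply: H; clear -E d0; lia.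
have kk1 : k <= k1.
  rewrite leNgt; apply/negP => lt; case: (st) => jk inner _ _ _.
  have [|st1 _] := inner k1; first by clear -lt E d0; lia.
  by have := Nk1 k1; rewrite st1 => H; have : false by apply: H; clear; lia.
have [j' [k' [b' [st' [jk' cor] _ _ _]]]] := stuck_next cw PA bal irr st.
case: (ltrP j' k1) => lt.
  have jk : j < k by case: (st) => jk _ _ _ _; clear -jk; lia.
  have [d' E'] : exists d' : nat, k1 = j' + d'%:Z.
    by exists `|(k1 - j')%R|%N; clear -lt; lia.
  by apply: (IH d' _ _ _ _ _ st' E'); clear -E E' jk' jk; lia.
case: st' => jk'' inner' _ _ _; have [|st1 _] := inner' (j' + 1); first by clear -jk''; lia.
have := Nk1 (j' + 1); rewrite st1 => H; have : false by apply: H; clear -jk' kk1 lt; lia.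
by [].
Qed.

(** After a shift both blocks contain the same index x. The earlier one ends at a corner followed by
    another corner, so the later one, which needs a straight cell after its first corner, begins
    beyond x. *)
Lemma strips_disjoint (s s' : bool) (j k j' k' x x' : int) (b b' : bool) :
  stuck s j k b -> stuck s' j' k' b' ->
  start j <= x <= stop k -> start j' <= x' <= stop k' -> A x = A x' -> A k = A k'.
Proof.
move=> st st' xP xP' /(A_eq_shift cw)[q E].
have := stuck_shift cw q st'; set j1 := j' + _; set k1 := k' + _ => st1.
have x1 : start j1 <= x <= stop k1.
  by rewrite /j1 /k1 (start_shift cw) (stop_shift cw) E; clear -xP'; lia.
suff -> : k = k1 by rewrite (A_shift cw).
have key sa sb (ja ka jb kb : int) ba bb : stuck sa ja ka ba -> stuck sb jb kb bb ->
    start ja <= x <= stop ka -> start jb <= x <= stop kb -> ka < kb -> False.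
  move=> sta stb xa xb kk.
  have [ja1 _] := stuck_start sta; have [jb1 _] := stuck_start stb.
  have [ka1 _ _ _] := stuck_stop cw PA bal irr sta.
  have Nka := stuck_corner_next cw PA bal irr sta.
  case: sta => jka inna [tja tka] _ _; case: stb => jkb innb [tjb _] _ _.
  have xle : jb <= x <= ka by clear -xa xb ja1 jb1 ka1; lia.
  have jbka : ~~ (jb < ka).
    by apply/negP => lt; have [|] := innb ka; [clear -lt kk; lia|rewrite (turn_corner cw tka)].
  have Ejb : jb = ka by clear -xle jbka; lia.
  by have [|] := innb (ka + 1); [clear -Ejb jkb; lia|rewrite (negbTE Nka)].
case: (ltrgtP k k1) => // lt; first by case: (key _ _ _ _ _ _ _ _ st st1).
by case: (key _ _ _ _ _ _ _ _ st1 st).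
Qed.

End StuckFacts.

Lemma pts_cell (p x : point) :
  (p \in pts (cell x)) = (x.1 <= p.1 <= x.1 + 1) && (x.2 <= p.2 <= x.2 + 1).
Proof. by rewrite inE. Qed.

Lemma cell_at (I : interval) (p : point) : proper I -> p \in pts I ->
  exists2 x, subitv (cell x) I & p \in pts (cell x).
Proof.
case: I p => [[a b] [a' b']] [x y] /andP[/= la lb]; rewrite inE /= => H.
exists (if x == a' then x - 1 else x, if y == b' then y - 1 else y).
  by rewrite subitv_cell /=; move: H; clear -la lb; do 2?case: eqP; lia.
by rewrite pts_cell /=; do 2?case: eqP; lia.
Qed.

Lemma cell_sub (I : interval) (x p : point) :
  subitv (cell x) I -> p \in pts (cell x) -> p \in pts I.
Proof. exact: subitv_pts. Qed.

(** * Cells that share a vertex *)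

Section Touch.
Variables (P : {fset point}) (A : int -> point) (n : nat).
Hypothesis cw : closed_walk A n.
Hypothesis PA : forall x, x \in P <-> exists i : int, x = A i.

Lemma touch (p : point) (i j : int) : p \in pts (cell (A i)) -> p \in pts (cell (A j)) ->
  [\/ A j = A i, A j = A (i + 1), A j = A (i - 1) | A j = A (i + 2) \/ A j = A (i - 2)].
Proof.
rewrite !pts_cell => pi pj.
have [E|[/(cw_adj cw)[]E|/(cw_diag cw)[]E]] :
    A j = A i \/ near (A i) (A j) \/ diagonal (A i) (A j).
- case: (eqVneq (A j) (A i)) => [|ne]; first by left.
  right; move: ne pi pj; rewrite ptE /near /diagonal.
  by clear; case: (A i) (A j) p => [x y] [x' y'] [u v] /=; lia.
- by constructor 1.
- by constructor 2.
- by constructor 3.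
- by constructor 4; left; rewrite E; congr (A _); lia.
- by constructor 4; right; rewrite E; congr (A _); lia.
Qed.

Lemma A_back2 (i : int) : A (i - 2) =
  ((A i).1 - (step A (i - 1)).1 - (step A (i - 1 - 1)).1,
   (A i).2 - (step A (i - 1)).2 - (step A (i - 1 - 1)).2).
Proof.
have -> : i - 2 = i - 1 - 1 by lia.
by rewrite (A_step_prev A (i - 1)) (A_step_prev A i).
Qed.

Lemma A_next2 (i : int) : A (i + 2) =
  ((A i).1 + (step A i).1 + (step A (i + 1)).1,
   (A i).2 + (step A i).2 + (step A (i + 1)).2).
Proof.
have -> : i + 2 = i + 1 + 1 by lia.
by rewrite (A_step A (i + 1)) (A_step A i).
Qed.

Lemma outer_self (b : bool) (i : int) : oppc A i (sd A b i) \in pts (cell (A i)).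
Proof.
rewrite pts_cell /oppc /sd.
by case: b; case: (step_cases cw i) => -> /=; lia.
Qed.

Lemma sd_self (b : bool) (i : int) : sd A b i \in pts (cell (A i)).
Proof.
rewrite pts_cell /sd.
by case: b; case: (step_cases cw i) => -> /=; lia.
Qed.

Lemma sd_next (b : bool) (i : int) : sd A b i \in pts (cell (A (i + 1))).
Proof.
rewrite pts_cell /sd (A_step A i).
by case: b; case: (step_cases cw i) => -> /=; lia.
Qed.

(** Together with [sd_cells] this tells which cells contain the far corners of a zig-zag walk, the
    input to condition (3). *)
Lemma outer_cells (b : bool) (i j : int) : turn A b i ->
  oppc A i (sd A b i) \in pts (cell (A j)) -> A j = A i.
Proof.
move=> /eqP t oj; have := touch (outer_self b i) oj; move: oj; rewrite pts_cell /oppc /sd => oj.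
case: (eqVneq (A j) (A i)) => [//|ne].
case=> [//|E|E|[]E]; move: ne oj; rewrite E ptE.
all: rewrite ?(A_step A i) ?(A_step_prev A i) ?(A_back2 i) ?(A_next2 i) t => ne H; exfalso; move: ne H.
- by clear -cw; case: b; case: (step_cases cw (i - 1)) => -> /=; lia.
- by clear -cw; case: b; case: (step_cases cw (i - 1)) => -> /=; lia.
- by clear -cw; case: b; case: (step_cases cw (i - 1)) => ->;
    case: (step_cases cw (i + 1)) => -> /=; lia.
- by clear -cw; case: b; case: (step_cases cw (i - 1)) => ->;
    case: (step_cases cw (i - 1 - 1)) => -> /=; lia.
Qed.

Lemma sd_cells (b : bool) (i j : int) : straight A i -> turn A (~~ b) (i + 1) ->
  sd A b i \in pts (cell (A j)) -> A j = A i \/ A j = A (i + 1).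
Proof.
move=> /eqP st /eqP t oj; have := touch (sd_self b i) oj; move: oj; rewrite pts_cell /sd => oj; rewrite addrK in t.
case: (eqVneq (A j) (A i)) => [|ne]; first by left.
case=> [E|E|E|[]E]; [by left|by right|..]; move: ne oj; rewrite E ptE.
all: rewrite ?(A_step_prev A i) ?(A_back2 i) ?(A_next2 i) ?t ?st => ne H; exfalso; move: ne H.
- by clear -cw; case: b; case: (step_cases cw (i - 1)) => -> /=; lia.
- by clear -cw; case: b; case: (step_cases cw (i - 1)) => -> /=; lia.
- by clear -cw; case: b; case: (step_cases cw (i - 1)) => ->;
    case: (step_cases cw (i - 1 - 1)) => -> /=; lia.
Qed.

Lemma corner_meet (b : bool) (i : int) (p : point) : turn A b i ->
  p \in pts (cell (A (i - 1))) -> p \in pts (cell (A (i + 1))) -> p = sd A b i.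
Proof.
move=> /eqP t; rewrite !pts_cell /sd (A_step A i) (A_step_prev A i) t => H1 H2.
apply: pt_eq; move: H1 H2; clear -cw; case: b; case: (step_cases cw (i - 1)) => -> /=; lia.
Qed.

Lemma near_next (i : int) (w : point) : near w (0, 0) ->
  (forall t : int, 0 <= t <= 1 -> ((A i).1 + t * w.1, (A i).2 + t * w.2) \in P) ->
  ((A i).1 + w.1, (A i).2 + w.2) = A (i + 1) \/
  ((A i).1 + w.1, (A i).2 + w.2) = A (i - 1).
Proof.
move=> nw inP; have /PA[j E] : ((A i).1 + w.1, (A i).2 + w.2) \in P.
  by have := inP 1; rewrite !mul1r; apply.
have nr : near (A i) (A j) by rewrite -E; move: nw; rewrite /near /=; clear; lia.
by rewrite E; case: (cw_adj cw nr) => ->; [left|right].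
Qed.

Lemma line_forward (i d : int) (w : point) : 0 <= d -> near w (0, 0) ->
  (forall t : int, 0 <= t <= d -> ((A i).1 + t * w.1, (A i).2 + t * w.2) \in P) ->
  ((A i).1 + w.1, (A i).2 + w.2) = A (i + 1) ->
  forall t : int, 0 <= t <= d -> A (i + t) = ((A i).1 + t * w.1, (A i).2 + t * w.2).
Proof.
move=> d0 nw inP next t tP; have [m E] : exists m : nat, t = m%:Z.
  by exists `|t|%N; clear -tP; lia.
(* Two earlier cells are needed: the next cell on the line is a neighbour of the current one in the
   walk, and the backward neighbour is the cell just left. *)
rewrite {}E in tP *; elim/ltn_ind: m tP => -[|[|m]] IH tP.
- by rewrite addr0 !mul0r !addr0; case: (A i).
- by rewrite !mul1r.
have E1 : A (i + m.+1%:Z) = ((A i).1 + m.+1%:Z * w.1, (A i).2 + m.+1%:Z * w.2).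
  by apply: IH => //; clear -tP; lia.
have E0 : A (i + m%:Z) = ((A i).1 + m%:Z * w.1, (A i).2 + m%:Z * w.2).
  by apply: IH => //; clear -tP; lia.
have [j Ej] : exists j : int,
    ((A i).1 + m.+2%:Z * w.1, (A i).2 + m.+2%:Z * w.2) = A j.
  by have /PA[j] := inP _ tP; exists j.
have nr : near (A (i + m.+1%:Z)) (A j).
  rewrite -Ej E1 /near /=; have -> : m.+2%:Z = m.+1%:Z + 1 by clear; lia.
  by rewrite !mulrDl !mul1r; move: nw; rewrite /near /=; clear; lia.
have E2 : i + m.+2%:Z = i + m.+1%:Z + 1 by clear; lia.
case: (cw_adj cw nr) => Ej'; first by rewrite E2 -Ej' Ej.
have Em : i + m.+1%:Z - 1 = i + m%:Z by clear; lia.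
move: Ej' Ej => ->; rewrite Em E0 => /eqP; rewrite ptE /=.
have -> : m.+2%:Z = m%:Z + 1 + 1 by clear; lia.
by rewrite !mulrDl !mul1r => H; exfalso; move: H nw; rewrite /near /=; clear; lia.
Qed.

Lemma line_straight (i d : int) (w : point) : 0 <= d -> near w (0, 0) ->
  (forall t : int, 0 <= t <= d -> ((A i).1 + t * w.1, (A i).2 + t * w.2) \in P) ->
  ((A i).1 + w.1, (A i).2 + w.2) = A (i + 1) ->
  A (i + d) = ((A i).1 + d * w.1, (A i).2 + d * w.2) /\
  forall t : int, 0 < t < d -> straight A (i + t).
Proof.
move=> d0 nw inP next; have L := line_forward d0 nw inP next; split.
  by apply: L; clear -d0; lia.
move=> t tP; rewrite /straight !stepE.
have -> : i + t + 1 = i + (t + 1) by clear; lia.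
have -> : i + t - 1 = i + (t - 1) by clear; lia.
have -> : i + (t - 1) + 1 = i + t by clear; lia.
rewrite !L; try by clear -tP; lia.
by rewrite ptE /=; apply/andP; split; apply/eqP; ring.
Qed.

End Touch.

Section InnerLine.
Variables (P : {fset point}) (A : int -> point) (n : nat).
Hypothesis cw : closed_walk A n.
Hypothesis PA : forall x, x \in P <-> exists i : int, x = A i.

(** In a square of four cells, the one opposite to cell i would be both cell i+2 and cell i-2, which
    [cw_neq] excludes. *)
Lemma no_square (p : point) : p \in P -> (p.1 + 1, p.2) \in P ->
  (p.1, p.2 + 1) \in P -> (p.1 + 1, p.2 + 1) \in P -> False.
Proof.
move=> /PA[i ->] /PA[j Ej] /PA[k Ek] /PA[l El].
have nj : near (A i) (A j) by rewrite -Ej /near /=; clear; lia.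
have nk : near (A i) (A k) by rewrite -Ek /near /=; clear; lia.
have njl : near (A j) (A l) by rewrite -Ej -El /near /=; clear; lia.
have nkl : near (A k) (A l) by rewrite -Ek -El /near /=; clear; lia.
have jk : A j <> A k by rewrite -Ej -Ek => -[]; clear; lia.
have il : A l <> A i.
  by rewrite -El => /eqP; rewrite ptE /=; clear; lia.
have key (u v : int) : A u = A (i + 1) -> A v = A (i - 1) ->
    near (A u) (A l) -> near (A v) (A l) -> False.
  move=> -> -> /(cw_adj cw); rewrite addrK => -[El2|//].
  move=> /(cw_adj cw); rewrite subrK => -[//|]; rewrite El2.
  have -> : i + 1 + 1 = i - 1 - 1 + 4 by clear; lia.
  exact: (cw_neq cw (i := i - 1 - 1) (d := 4)).
have [Aj|Aj] := cw_adj cw nj; have [Ak|Ak] := cw_adj cw nk.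
- by rewrite Aj Ak in jk.
- exact: (key j k).
- exact: (key k j).
- by rewrite Aj Ak in jk.
Qed.

(** By [no_square] an inner interval is one cell wide, and in a line of path cells the walk has to
    follow the line. *)
Lemma inner_line (J : interval) (i i' : int) : inner_interval P J ->
  subitv (cell (A i)) J -> subitv (cell (A i')) J ->
  exists d : int, 0 <= d /\
    ((A i' = A (i + d) /\ forall t : int, 0 < t < d -> straight A (i + t)) \/
     (A i' = A (i - d) /\ forall t : int, 0 < t < d -> straight A (i - t))).
Proof.
move=> [_ inP]; rewrite !subitv_cell => ci ci'.
have box (x : point) : Num.min (A i).1 (A i').1 <= x.1 <= Num.max (A i).1 (A i').1 ->
    Num.min (A i).2 (A i').2 <= x.2 <= Num.max (A i).2 (A i').2 -> x \in P.
  by move=> x1 x2; apply: inP; rewrite subitv_cell; move: ci ci' x1 x2; clear; lia.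
have [w [d [d0 nw E]]] : exists (w : point) (d : int), [/\ 0 <= d, near w (0, 0) &
    A i' = ((A i).1 + d * w.1, (A i).2 + d * w.2)].
  case: (eqVneq (A i).1 (A i').1) => E1.
    case: (lerP (A i).2 (A i').2) => le.
      exists (0, 1), ((A i').2 - (A i).2); split=> //; first by clear -le; lia.
      by apply: pt_eq => /=; rewrite -?E1; clear; lia.
    exists (0, -1), ((A i).2 - (A i').2); split=> //; first by clear -le; lia.
    by apply: pt_eq => /=; rewrite -?E1; clear; lia.
  case: (eqVneq (A i).2 (A i').2) => E2.
    case: (lerP (A i).1 (A i').1) => le.
      exists (1, 0), ((A i').1 - (A i).1); split=> //; first by clear -le; lia.
      by apply: pt_eq => /=; rewrite -?E2; clear; lia.
    exists (-1, 0), ((A i).1 - (A i').1); split=> //; first by clear -le; lia.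
    by apply: pt_eq => /=; rewrite -?E2; clear; lia.
  exfalso; apply: (@no_square (Num.min (A i).1 (A i').1, Num.min (A i).2 (A i').2));
    by apply: box; move: E1 E2; clear => /=; lia.
exists d; split=> //.
have line t : 0 <= t <= d -> ((A i).1 + t * w.1, (A i).2 + t * w.2) \in P.
  move=> tP; apply: box; rewrite E /=; move: nw tP; rewrite /near /= => nw tP.
    have [->|[->|->]] : w.1 = 0 \/ w.1 = 1 \/ w.1 = -1 by clear -nw; lia.
    - by clear; lia.
    - by clear -tP; lia.
    - by clear -tP; lia.
  have [->|[->|->]] : w.2 = 0 \/ w.2 = 1 \/ w.2 = -1 by clear -nw; lia.
  - by clear; lia.
  - by clear -tP; lia.
  - by clear -tP; lia.
case: (eqVneq d 0) => [d00|dn].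
  left; split; last by move=> t; rewrite d00; clear; lia.
  by rewrite E d00 !mul0r !addr0; case: (A i).
have [|next|next] := near_next cw PA (i := i) nw.
- by move=> t tP; apply: line; move: tP dn d0; clear; lia.
- by left; rewrite E; have [-> st] := line_straight cw PA d0 nw line next.
(* The line runs against the walk, so [line_straight] is applied to the reversed walk. *)
right.
have PA' y : y \in P <-> exists i : int, y = reversed A i.
  split=> [/PA[u ->]|[u ->]]; first by exists (- u); rewrite /reversed opprK.
  by apply/PA; exists (- u).
have revi : reversed A (- i) = A i by rewrite /reversed opprK.
have [] := line_straight (reversed_walk cw) PA' (i := - i) (w := w) d0 nw.
- by rewrite revi.
- by rewrite revi next /reversed; congr (A _); clear; lia.
rewrite revi /reversed => E' st; split.
  by rewrite E -E'; congr (A _); clear; lia.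
move=> t tP; have := st t tP; rewrite (straight_reversed cw).
by congr (is_true (straight A _)); clear; lia.
Qed.

End InnerLine.

Section Sides.
Variable P : {fset point}.

Lemma quad_pts t I p q r s : proper I -> quad t I p q r s ->
  [/\ p \in pts I, q \in pts I, r \in pts I & s \in pts I].
Proof.
case: I => [[a b] [a' b']] /andP[/= la lb]; rewrite /quad /ulc /lrc; case: t => /= /andP[];
  by case/orP => /andP[/eqP-> /eqP->]; case/orP => /andP[/eqP-> /eqP->];
  split; rewrite inE /=; lia.
Qed.

Lemma vertical_side (I : interval) (x : int) : inner_interval P I ->
  x = I.1.1 \/ x = I.2.1 -> edge_interval P ((x, I.1.2), (x, I.2.2)).
Proof.
move=> [/andP[la lb] inP] xE; have vI : vertical ((x, I.1.2), (x, I.2.2)).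
  by rewrite /vertical /= eqxx.
rewrite vert_edge_interval //; apply/(all_vsegments P vI) => /= y yP.
apply/edges_P; case: xE => E.
  exists (x, y); first by apply: inP; rewrite subitv_cell /= E; move: yP la; clear; lia.
  by have [_ _] := sides_in (cell (x, y)).
exists (x - 1, y); first by apply: inP; rewrite subitv_cell /= E; move: yP la; clear; lia.
by have [_ _ _] := sides_in (cell (x - 1, y)); rewrite /lrc /cell /= subrK.
Qed.

Lemma horizontal_side (I : interval) (y : int) : inner_interval P I ->
  y = I.1.2 \/ y = I.2.2 -> edge_interval P ((I.1.1, y), (I.2.1, y)).
Proof.
move=> [/andP[la lb] inP] yE; have hI : horizontal ((I.1.1, y), (I.2.1, y)).
  by rewrite /horizontal /= eqxx.
rewrite hor_edge_interval //; apply/(all_hsegments P hI) => /= x xP.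
apply/edges_P; case: yE => E.
  exists (x, y); first by apply: inP; rewrite subitv_cell /= E; move: xP lb; clear; lia.
  by have [] := sides_in (cell (x, y)).
exists (x, y - 1); first by apply: inP; rewrite subitv_cell /= E; move: xP lb; clear; lia.
by have [_ + _ _] := sides_in (cell (x, y - 1)); rewrite /ulc /cell /= subrK.
Qed.

Lemma quad_side t I p q r s : inner_interval P I -> quad t I p q r s ->
  exists E, [/\ edge_interval P E, p \in pts E & r \in pts E].
Proof.
move=> iI; have [pI _] := iI.
have v0 := vertical_side iI (or_introl erefl); have v1 := vertical_side iI (or_intror erefl).
have h0 := horizontal_side iI (or_introl erefl); have h1 := horizontal_side iI (or_intror erefl).
move: pI v0 v1 h0 h1 {iI}; case: I => [[a b] [a' b']] /andP[/= la lb] v0 v1 h0 h1.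
rewrite /quad /ulc /lrc; case: t => /= /andP[];
  case/orP => /andP[/eqP-> _]; case/orP => /andP[/eqP-> _].
- by exists ((a, b), (a, b')); split=> //; rewrite inE /=; lia.
- by exists ((a, b), (a', b)); split=> //; rewrite inE /=; lia.
- by exists ((a, b'), (a', b')); split=> //; rewrite inE /=; lia.
- by exists ((a', b), (a', b')); split=> //; rewrite inE /=; lia.
- by exists ((a, b), (a, b')); split=> //; rewrite inE /=; lia.
- by exists ((a, b), (a', b)); split=> //; rewrite inE /=; lia.
- by exists ((a, b'), (a', b')); split=> //; rewrite inE /=; lia.
- by exists ((a', b), (a', b')); split=> //; rewrite inE /=; lia.
Qed.

Lemma inner_V (I : interval) : inner_interval P I ->
  [/\ I.1 \in V P, I.2 \in V P, ulc I \in V P & lrc I \in V P].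
Proof.
case: I => [[a b] [a' b']] [/andP[/= la lb] inP].
have cn (x y : int) : (a <= x < a') -> (b <= y < b') ->
    forall r, r \in corners (cell (x, y)) -> r \in V P.
  by move=> xP yP r rc; apply/V_P; exists (x, y) => //; apply: inP; rewrite subitv_cell /= xP yP.
split; rewrite /ulc /lrc /=.
- by apply: (cn a b); [lia|lia|apply/fset4P; constructor 1].
- by apply: (cn (a' - 1) (b' - 1)); [lia|lia|apply/fset4P; constructor 2; rewrite /= !subrK].
- by apply: (cn a (b' - 1)); [lia|lia|apply/fset4P; constructor 3; rewrite /ulc /= subrK].
- by apply: (cn (a' - 1) b); [lia|lia|apply/fset4P; constructor 4; rewrite /lrc /= subrK].
Qed.

Lemma quad_V t I p q r s : inner_interval P I -> quad t I p q r s ->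
  [/\ p \in V P, q \in V P, r \in V P & s \in V P].
Proof.
move/inner_V; case: I => [[a b] [a' b']] [/= v1 v2 v3 v4]; rewrite /quad; case: t => /= /andP[];
  by case/orP => /andP[/eqP-> /eqP->]; case/orP => /andP[/eqP-> /eqP->]; split.
Qed.

End Sides.

(** * The zig-zag walk of the stuck blocks *)

Section Staircase.
Variables (A : int -> point) (n : nat).
Hypothesis cw : closed_walk A n.

Lemma walk_dist (x y : int) : x <= y ->
  `|(A y).1 - (A x).1| + `|(A y).2 - (A x).2| <= y - x.
Proof.
move=> xy; have [m E] : exists m : nat, y = x + m%:Z.
  by exists `|y - x|%N; lia.
rewrite {y xy}E; elim: m => [|m IH]; first by rewrite addr0 !subrr.
have -> : x + m.+1%:Z = x + m%:Z + 1 by lia.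
have := cw_near cw (x + m%:Z); rewrite /near; move: IH; clear; lia.
Qed.

Lemma near0_cases (f : point) : near f (0, 0) ->
  [\/ f = (1, 0), f = (0, 1), f = (-1, 0) | f = (0, -1)].
Proof.
case: f => u v; rewrite /near /= => nf.
have [[->->]|[[->->]|[[->->]|[->->]]]] : (u = 1 /\ v = 0) \/ (u = 0 /\ v = 1) \/
    (u = -1 /\ v = 0) \/ (u = 0 /\ v = -1) by lia.
- by constructor 1.
- by constructor 2.
- by constructor 3.
- by constructor 4.
Qed.

(** The scalar product with [f + rot b f] grows by one at each step, so such an arc is a shortest
    path. *)
Lemma staircase (x y : int) (b : bool) (f : point) : x <= y -> near f (0, 0) ->
  (forall i : int, x <= i < y -> step A i = f \/ step A i = rot b f) ->
  (f.1 + (rot b f).1) * ((A y).1 - (A x).1) + (f.2 + (rot b f).2) * ((A y).2 - (A x).2)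
    = y - x.
Proof.
move=> xy nf; have [m E] : exists m : nat, y = x + m%:Z.
  by exists `|y - x|%N; lia.
rewrite {y xy}E; elim: m => [|m IH] st; first by rewrite addr0 !subrr !mulr0.
have -> : x + m.+1%:Z = x + m%:Z + 1 by lia.
rewrite A_step /=.
transitivity ((x + m%:Z - x) + ((f.1 + (rot b f).1) * (step A (x + m%:Z)).1 +
     (f.2 + (rot b f).2) * (step A (x + m%:Z)).2)).
  rewrite -IH; first by ring.
  by move=> i iP; apply: st; move: iP; clear; lia.
have -> : x + m%:Z + 1 - x = x + m%:Z - x + 1 by lia.
by congr (_ + _); have [|->|->] := st (x + m%:Z); [clear; lia|..];
  case: (near0_cases nf) => ->; case: (b).
Qed.

(** The remaining n - (y - x) steps must bridge the same distance y - x, so y - x is at most n/2,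
    which is below n - 2 since n > 5. *)
Lemma staircase_short (x y : int) (b : bool) (f : point) : x <= y -> near f (0, 0) ->
  (forall i : int, x <= i < y -> step A i = f \/ step A i = rot b f) -> y - x < n%:Z - 2.
Proof.
move=> xy nf st; have n5 := cw_n cw; case: (lerP (x + n%:Z) y) => le.
  exfalso; have xn : x <= x + n%:Z by lia.
  have := @staircase x (x + n%:Z) b f xn nf; rewrite (cw_per cw) !subrr !mulr0 => H.
  have : 0 + 0 = x + n%:Z - x by apply: H => i iP; apply: st; lia.
  by clear -n5; lia.
have := staircase xy nf st; have := @walk_dist y (x + n%:Z) (ltW le); rewrite (cw_per cw).
case: (A x) (A y) => a a' [c c'] /=.
by clear -n5 nf; case: (near0_cases nf) => ->; case: b => /=; lia.
Qed.

End Staircase.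

Section Arcs.
Variables (P : {fset point}) (A : int -> point) (n : nat).
Hypothesis cw : closed_walk A n.
Hypothesis PA : forall x, x \in P <-> exists i : int, x = A i.
Variables (tok : bool -> point -> nat) (c : point -> int).
Hypothesis bal : balanced P tok c.
Hypothesis irr : ~ reducible P tok c.

Notation h s i := (sg s * c (A i)).
Notation stuck := (stuck A tok c).
Notation start := (start A c).
Notation stop := (stop A c).

Lemma oppc_pts (i : int) (p : point) :
  p \in pts (cell (A i)) -> oppc A i p \in pts (cell (A i)).
Proof. by rewrite !pts_cell /oppc /=; lia. Qed.

Lemma back_pts (b : bool) (i : int) : back A b i \in pts (cell (A i)).
Proof. exact: oppc_pts (sd_self cw _ i). Qed.

Lemma front_pts (b : bool) (i : int) : front A b i \in pts (cell (A i)).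
Proof. by apply: oppc_pts; have := sd_next cw (~~ b) (i - 1); rewrite subrK. Qed.

Lemma stuck_run (s : bool) (j k : int) (b : bool) : stuck s j k b -> run A (start j) (stop k).
Proof.
move=> st; have [js _] := stuck_start st; have [ks _ _ _] := stuck_stop cw PA bal irr st.
case: st => jk inner _ _ _; split.
- by clear -jk js ks; lia.
- by move=> i iP; have [|//] := inner i; clear -iP js ks; lia.
- by move=> E; have [|//] := inner (start j); clear -E jk js ks; lia.
Qed.

Lemma stuck_inner (s : bool) (j k : int) (b : bool) : stuck s j k b ->
  inner_interval P (strip A (start j) (stop k)).
Proof. by move/stuck_run/(strip_inner cw PA). Qed.

Definition follows (s : bool) (j k : int) (b s' : bool) (j' k' : int) (b' : bool) : Prop :=
  [/\ stuck s j k b, stuck s' j' k' b', s' = ~~ s,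
      k < j' <= k + 2 /\ (forall i : int, k <= i <= j' -> ~~ straight A i) &
      [/\ start j' = stop k + 2, back A b' (start j') = front A b (stop k) &
          (s' == (hor A (k' - 1) == b')) = (s == (hor A (k - 1) == b))]].

Lemma arc_length (s s' : bool) (j k j' k' : int) (b b' : bool) :
  follows s j k b s' j' k' b' -> stop k' - start j < n%:Z - 2.
Proof.
case=> st st' _ [jk' cor] _.
have [js _] := stuck_start st; have [ks' _ _ _] := stuck_stop cw PA bal irr st'.
case: (st) => jk inner [_ tk] _ _; case: (st') => jk'' inner' _ _ _.
have r1 : run A (start j) k.
  split; [by clear -jk js; lia| |by clear -jk js; lia].
  by move=> i iP; have [|//] := inner i; clear -iP js; lia.
have r2 : run A j' k'.
  split; [by clear -jk''; lia| |by clear -jk''; lia].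
  by move=> i iP; have [|//] := inner' i; clear -iP; lia.
pose f := step A (start j).
have nf : near f (0, 0) by rewrite /f; case: (step_cases cw (start j)) => ->.
have s0 (i : int) : start j <= i < k -> step A i = f by apply: run_step r1.
have sk : step A k = rot b f.
  by move/eqP: tk => ->; rewrite s0 //; clear -jk js; lia.
have alt b0 (i : int) : turn A b0 i -> ~~ straight A (i + 1) -> turn A (~~ b0) (i + 1).
  move=> t Ni; move: (turn_alternate cw t) Ni.
  by case: (turn_cases cw (i + 1)) => [->//|t1|t1]; case: b0 {t} => /=; rewrite t1.
have tk1 : turn A (~~ b) (k + 1) by apply: alt => //; apply: cor; clear -jk'; lia.
have sk1 : step A (k + 1) = f.
  move/eqP: (tk1) => ->; rewrite addrK sk; clear.
  by case: f => u v; case: b => /=; rewrite opprK.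
apply: (staircase_short cw (b := b) (f := f)) => //.
  by clear -js jk jk' jk'' ks'; lia.
move=> i iP; case: (ltrP i k) => ik; first by left; apply: s0; clear -iP ik; lia.
case: (eqVneq i k) => [->|ik']; first by right.
case: (eqVneq i (k + 1)) => [->|ik1]; first by left.
have Ei : step A i = step A j' by apply: (run_step r2); clear -iP ik ik' ik1 ks' jk'; lia.
case: (eqVneq j' (k + 1)) => [E|ne]; first by left; rewrite Ei E.
right; have E : j' = k + 1 + 1 by clear -ne jk'; lia.
have /eqP : turn A (~~ ~~ b) (k + 1 + 1).
  by apply: alt => //; apply: cor; clear -E; lia.
by rewrite Ei E => ->; rewrite addrK sk1 negbK.
Qed.

(** Cells that share a vertex are at most two positions apart; by [arc_length] this happens only
    across the single cell between the strips, whose neighbours meet in its inner corner. *)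
Lemma arc_meet (s s' : bool) (j k j' k' : int) (b b' : bool) p :
  follows s j k b s' j' k' b' ->
  (p \in pts (strip A (start j) (stop k))) && (p \in pts (strip A (start j') (stop k')))
    = (p == front A b (stop k)).
Proof.
move=> fw; have len := arc_length fw.
case: (fw) => st st' _ [jk' cor] [Ea Eb _].
have r := stuck_run st; have r' := stuck_run st'.
have [ks _ _ _] := stuck_stop cw PA bal irr st.
have fe := front_pts b (stop k).
have fe' : front A b (stop k) \in pts (cell (A (stop k + 2))).
  by rewrite -Eb -Ea; apply: back_pts.
have [ae _ _] := r; have [ae' _ _] := r'.
apply/andP/eqP => [[pI pI']|->]; last first.
  split; first by apply: cell_sub fe; apply/(strip_cell cw _ r); exists (stop k) => //; rewrite ae lexx.
  apply: cell_sub fe'; apply/(strip_cell cw _ r'); exists (stop k + 2) => //.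
  by rewrite -Ea lexx ae'.
have [x /(strip_cell cw _ r)[i iP ->] pi] := cell_at (strip_proper A _ _) pI.
have [x' /(strip_cell cw _ r')[i' iP' ->] pi'] := cell_at (strip_proper A _ _) pI'.
have near_idx (d : int) : -2 <= d <= 2 -> A i' = A (i + d) -> i' - i = 2.
  move=> dP /(A_eq_shift cw)[q E]; have n5 := cw_n cw.
  have [q0|[q1|q1]] : q = 0 \/ 1 <= q \/ q <= -1 by clear; lia.
  - by move: E; rewrite q0 mul0r; clear -iP iP' Ea dP; lia.
  - have : n%:Z <= q * n%:Z by clear -q1 n5; nia.
    by clear -iP iP' Ea len dP E; lia.
  - have : q * n%:Z <= - n%:Z by clear -q1 n5; nia.
    by clear -iP iP' Ea len dP E n5; lia.
have E2 : i' - i = 2.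
  have [E|E|E|[]E] := touch cw pi pi'.
  - by apply: (near_idx 0); rewrite ?addr0.
  - exact: (near_idx 1).
  - exact: (near_idx (-1)).
  - exact: (near_idx 2).
  - exact: (near_idx (-2)).
have Ei : i = stop k by clear -E2 Ea iP iP'; lia.
have Ei' : i' = stop k + 1 + 1 by clear -E2 Ei; lia.
have [t tt] : exists t, turn A t (stop k + 1).
  by apply: (corner_turn cw); apply: cor; clear -ks jk'; lia.
rewrite Ei in pi; rewrite Ei' in pi'.
have E3 : stop k + 2 = stop k + 1 + 1 by clear; lia.
rewrite E3 in fe'.
rewrite (corner_meet cw tt (p := p)) ?addrK //.
by rewrite (corner_meet cw tt (p := front A b (stop k))) ?addrK.
Qed.

Lemma far_corner_cells (s : bool) (j k : int) (b : bool) (i : int) : stuck s j k b ->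
  front A (~~ b) (stop k) \in pts (cell (A i)) -> A i = A (k - 1) \/ A i = A k.
Proof.
case=> jk inner [_ tk] _ _; rewrite /stop; case: eqP => _; last first.
  by rewrite (front_outer cw tk) => /(outer_cells cw tk); right.
have [stk _] := inner (k - 1) ltac:(clear -jk; lia).
rewrite (front_straight cw _ stk) => /(sd_cells cw); rewrite subrK negbK.
exact.
Qed.

Lemma A_eq_straight (x y d : int) : A x = A y -> straight A (x + d) = straight A (y + d).
Proof. by move/(A_eq_shift cw)=> [q ->]; rewrite shiftC (straight_shift cw). Qed.

(** A far corner lies only in cells k-1 and k of its block. An inner interval is a straight line of
    cells, and a line leaving these cells forwards is stopped by the corners k and k+1. *)
Lemma arc_sep (s s' : bool) (j k j' k' : int) (b b' : bool) (J : interval) :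
  stuck s j k b -> stuck s' j' k' b' -> A k <> A k' -> inner_interval P J ->
  front A (~~ b) (stop k) \in pts J -> front A (~~ b') (stop k') \in pts J -> False.
Proof.
move=> st st' ne iJ; have [pJ _] := iJ; move=> /(cell_at pJ)[x xJ xp] /(cell_at pJ)[x' xJ' xp'].
have far sa ja ka ba (y : point) : stuck sa ja ka ba -> subitv (cell y) J ->
    front A (~~ ba) (stop ka) \in pts (cell y) ->
    exists2 i : int, i = ka - 1 \/ i = ka & y = A i.
  move=> sta yJ yp; have /PA[i E] : y \in P by case: iJ => _; apply.
  rewrite {y yJ}E in yp *; have [->|->] := far_corner_cells sta yp.
    by exists (ka - 1); first left.
  by exists ka; first right.
have [i iE Ex] := far _ _ _ _ _ st xJ xp; have [i' iE' Ex'] := far _ _ _ _ _ st' xJ' xp'.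
rewrite {x xJ xp}Ex in xJ *; rewrite {x' xJ' xp'}Ex' in xJ' *.
(* By symmetry the line may be followed forwards from u to v. *)
have key sa ja ka ba sb jb kb bb (u v d : int) : stuck sa ja ka ba -> stuck sb jb kb bb ->
    A ka <> A kb -> u = ka - 1 \/ u = ka -> v = kb - 1 \/ v = kb -> 0 <= d ->
    A v = A (u + d) -> (forall t : int, 0 < t < d -> straight A (u + t)) -> False.
  move=> sta stb nab uE vE d0 E lin.
  have Na := stuck_corner_next cw PA bal irr sta; have Nb := stuck_corner_next cw PA bal irr stb.
  have [Na0 Sa] : ~~ straight A ka /\ straight A (ka - 1).
    case: sta => jka inn [_ t] _ _; rewrite (turn_corner cw t); split=> //.
    by have [|//] := inn (ka - 1); clear -jka; lia.
  have [Nb0 Sb] : ~~ straight A kb /\ straight A (kb - 1).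
    case: stb => jkb inn [_ t] _ _; rewrite (turn_corner cw t); split=> //.
    by have [|//] := inn (kb - 1); clear -jkb; lia.
  have corner_eq (x y : int) : A x = A y -> straight A x = straight A y.
    by move/(A_eq_straight 0); rewrite !addr0.
  have bad (x : int) : A x = A kb -> straight A x -> False.
    by move=> /corner_eq ->; rewrite (negbTE Nb0).
  have bad1 (x : int) : A x = A (kb - 1) -> ~~ straight A x -> False.
    by move=> /corner_eq ->; rewrite Sb.
  have nxt (x : int) : A x = A kb -> straight A (x - 1).
    by move=> /(A_eq_straight (-1)) ->.
  case: uE => Eu; rewrite Eu in E lin.
    have [d00|[d1|d2]] : d = 0 \/ d = 1 \/ 1 < d by clear -d0; lia.
    - rewrite d00 addr0 in E; case: vE => Ev; rewrite Ev in E.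
        have [q Eq] := A_eq_shift cw E; apply: nab.
        have -> : kb = ka + q * n%:Z by clear -Eq; lia.
        by rewrite (A_shift cw).
      by apply: (bad (ka - 1)).
    - rewrite d1 subrK in E; case: vE => Ev; rewrite Ev in E; last exact: nab.
      by apply: (bad1 ka).
    - by have := lin 1; rewrite subrK (negbTE Na0) d2 => /(_ isT).
  have [d00|[d1|d2]] : d = 0 \/ d = 1 \/ 1 < d by clear -d0; lia.
  - rewrite d00 addr0 in E; case: vE => Ev; rewrite Ev in E; last exact: nab.
    by apply: (bad1 ka).
  - rewrite d1 in E; case: vE => Ev; rewrite Ev in E.
      by apply: (bad1 (ka + 1)).
    by have := nxt _ (esym E); rewrite addrK (negbTE Na0).
  - by have := lin 1; rewrite (negbTE Na) d2 => /(_ isT).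
have [d [d0 [[E lin]|[E lin]]]] := inner_line cw PA iJ xJ xJ'.
  exact: (key _ _ _ _ _ _ _ _ i i' d st st' ne iE iE' d0 E lin).
have [q Eq] := A_eq_shift cw E.
apply: (key _ _ _ _ _ _ _ _ i' i d st' st (nesym ne) iE' iE d0).
  by rewrite Eq shiftC (A_shift cw) subrK.
move=> t tP; rewrite Eq shiftC (straight_shift cw).
have -> : i - d + t = i - (d - t) by clear; lia.
by apply: lin; clear -tP; lia.
Qed.

Lemma stuck_uniq (s s' : bool) (j j' k : int) (b b' : bool) :
  stuck s j k b -> stuck s' j' k b' -> [/\ s = s', j = j' & b = b'].
Proof.
case=> jk inn [tj tk] _ _ [jk' inn' [tj' tk'] _ _].
have [_ h1] := inn (k - 1) ltac:(clear -jk; lia).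
have [_ h2] := inn' (k - 1) ltac:(clear -jk'; lia).
split.
- by move: h1 h2; clear; case: s; case: s'; rewrite /sg; lia.
- case: (ltrgtP j j') => // lt.
    by have [|] := inn j'; [clear -lt jk'; lia|rewrite (turn_corner cw tj')].
  by have [|] := inn' j; [clear -lt jk; lia|rewrite (turn_corner cw tj)].
- case: (eqVneq b b') => // ne; have := turnN cw tk.
  have -> : ~~ b = b' by move: ne; clear; case: b; case: b'.
  by rewrite tk'.
Qed.

Lemma follows_ex (s : bool) (j k : int) (b : bool) : stuck s j k b ->
  exists s' j' k' b', follows s j k b s' j' k' b'.
Proof.
move=> st; have [j' [k' [b' [st' cor _ Ea [Eb Es]]]]] := stuck_next cw PA bal irr st.
by exists (~~ s), j', k', b'; split.
Qed.

End Arcs.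

Lemma finite_cycle (T : finType) (f : T -> T) (S : T -> Prop) (x0 : T) :
  S x0 -> (forall x, S x -> S (f x)) ->
  exists (y : T) (l : nat), [/\ (0 < l)%N, forall i, S (iter i f y), iter l f y = y &
    forall i j, (i < l)%N -> (j < l)%N -> iter i f y = iter j f y -> i = j].
Proof.
move=> S0 Sf; have Si i : S (iter i f x0) by elim: i => //= i; apply: Sf.
have /trajectP[i iN E] := looping_order f x0.
pose y := iter i f x0; pose d := (order f x0 - i)%N.
have d0 : (0 < d)%N by rewrite subn_gt0.
have Ey : iter d f y = y by rewrite /y -iterD subnK // ltnW.
have cyc : fcycle f (traject f y d).
  move: d0 Ey; case: d => // d _ Ey; rewrite trajectS /=.
  have -> : rcons (traject f (f y) d) y = traject f (f y) d.+1.
    by rewrite trajectSr -iterSr Ey.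
  exact: fpath_traject.
have yin : y \in traject f y d by apply/trajectP; exists 0%N.
have El := iter_order_cycle cyc yin.
exists y, (order f y); split; [exact: order_gt0| |exact: El|].
  by move=> k; rewrite /y -iterD; apply: Si.
move=> a b al bl; rewrite -(nth_traject f al) -(nth_traject f bl) => /eqP.
have := orbit_uniq f y; rewrite /orbit => un.
by rewrite nth_uniq ?size_traject // => /eqP.
Qed.

Lemma quad_fset t I p q r s : quad t I p q r s ->
  if t then [fset p; q]%fset = [fset I.1; I.2]%fset /\ [fset r; s]%fset = [fset ulc I; lrc I]%fset
  else [fset r; s]%fset = [fset I.1; I.2]%fset /\ [fset p; q]%fset = [fset ulc I; lrc I]%fset.
Proof.
rewrite /quad; case: t => /= /andP[];
  by case/orP => /andP[/eqP-> /eqP->]; case/orP => /andP[/eqP-> /eqP->];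
  split=> //; rewrite fsetUC.
Qed.

Lemma D_sum (I : finType) (F : I -> point -> int) p :
  D (fun x => \sum_i F i x) p = \sum_i D (F i) p.
Proof. by rewrite /D -!sumrN -!big_split. Qed.

Definition zmove (P : {fset point}) (m m' : point -> nat) : Prop :=
  exists (W : zigzag_walk P) (m0 : point -> nat),
    m =1 (fun x => m0 x + \sum_(i < zz_len W) (x == val (zz_z i)))%N /\
    m' =1 (fun x => m0 x + \sum_(i < zz_len W) (x == val (zz_u i)))%N.

Section Walking.
Variables (P : {fset point}) (A : int -> point) (n : nat).
Hypothesis cw : closed_walk A n.
Hypothesis PA : forall x, x \in P <-> exists i : int, x = A i.
Variables (tok : bool -> point -> nat) (c : point -> int).
Hypothesis bal : balanced P tok c.
Hypothesis irr : ~ reducible P tok c.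

Notation stuck := (stuck A tok c).
Notation start := (start A c).
Notation stop := (stop A c).
Notation ival u := (nat_of_ord u)%:Z.

Lemma residue (k : int) : exists (u : 'I_n) (q : int), k = ival u + q * n%:Z.
Proof.
have n5 := cw_n cw.
have lt : (`|(k %% n%:Z)%Z| < n)%N by have := @ltz_pmod k n%:Z; have := @modz_ge0 k n%:Z; lia.
exists (Ordinal lt), (k %/ n%:Z)%Z => /=.
by rewrite gez0_abs ?modz_ge0 //; [rewrite addrC -divz_eq|lia].
Qed.

Lemma residue_inj (u v : 'I_n) : A (ival u) = A (ival v) -> u = v.
Proof.
move=> /(A_eq_shift cw)[q E]; apply: val_inj => /=; have := ltn_ord u; have := ltn_ord v.
move: E; have [->|[q1|q1]] : q = 0 \/ 1 <= q \/ q <= -1 by clear; lia.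
- by clear; lia.
- have : n%:Z <= q * n%:Z by clear -q1; nia.
  by clear; lia.
- have : q * n%:Z <= - n%:Z by clear -q1; nia.
  by clear; lia.
Qed.

Lemma stuck_hor (s : bool) (j k : int) (b : bool) : stuck s j k b ->
  hor A (start j) = hor A (k - 1).
Proof.
move=> st; have r := stuck_run cw PA bal irr st; have [js _] := stuck_start st.
have [ks _ _ _] := stuck_stop cw PA bal irr st; case: st => jk inn _ _ _.
have [stk _] := inn (k - 1) ltac:(clear -jk; lia).
rewrite /hor; congr (_.2 == 0); case: (eqVneq (k - 1) (stop k)) => [E|ne].
  by move: stk; rewrite /straight => /eqP ->; rewrite E (run_prev r).
by rewrite (run_step r) //; clear -ne js ks jk; lia.
Qed.

Lemma zigzag_reduction (s0 : bool) (j0 k0 : int) (b0 : bool) : stuck s0 j0 k0 b0 ->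
  exists (t : bool) tok' c', [/\ zmove P (tok t) (tok' t), tok' (~~ t) =1 tok (~~ t),
    balanced P tok' c' & (weight P c' < weight P c)%N].
Proof.
move=> st0.
(* By [stuck_uniq] a block is determined by its last corner, so blocks are indexed by residues;
   residues without a block get a dummy value. *)
have [dat datP] : exists dat : 'I_n -> bool * int * bool, forall u s j b,
    stuck s j (ival u) b -> dat u = (s, j, b).
  apply: (@fin_all_exists _ (fun _ => bool * int * bool)%type
    (fun u d => forall s j b, stuck s j (ival u) b -> d = (s, j, b))) => u.
  have [[s [j [b st]]]|no] := classic (exists s j b, stuck s j (ival u) b).
    by exists (s, j, b) => s' j' b' st'; have [-> -> ->] := stuck_uniq cw st st'.
  by exists (true, 0, true) => s j b st; case: no; exists s, j, b.
pose s_ u := (dat u).1.1; pose j_ u := (dat u).1.2; pose b_ u := (dat u).2.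
pose S u := stuck (s_ u) (j_ u) (ival u) (b_ u).
have datS (k q : int) u s j b : k = ival u + q * n%:Z -> stuck s j k b ->
    S u /\ dat u = (s, j + - q * n%:Z, b).
  move=> E /(stuck_shift cw (- q)).
  have -> : k + - q * n%:Z = ival u by rewrite E mulNr addrK.
  by move=> st; have Ed := datP _ _ _ _ st; rewrite /S /s_ /j_ /b_ Ed.
pose St u := strip A (start (j_ u)) (stop (ival u)).
pose vv u := back A (b_ u) (start (j_ u)).
pose uu u := back A (~~ b_ u) (start (j_ u)).
pose zz u := front A (~~ b_ u) (stop (ival u)).
pose sgn u := s_ u == (hor A (ival u - 1) == b_ u).
pose fol u v := [/\ S v, vv v = front A (b_ u) (stop (ival u)),
  forall p, (p \in pts (St u)) && (p \in pts (St v)) = (p == vv v) & sgn v = sgn u].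
have [f fP] : exists f : 'I_n -> 'I_n, forall u, S u -> fol u (f u).
  apply: (@fin_all_exists _ (fun _ => 'I_n) (fun u v => S u -> fol u v)) => u.
  have [Su|] := classic (S u); last by exists u.
  have [s' [j' [k' [b' fw]]]] := follows_ex cw PA bal irr Su.
  have [v [q E]] := residue k'; exists v => _.
  have fw' := fw; case: fw' => _ st' Es _ [Ea Eb Esg].
  have [Sv Ed] := datS _ _ _ _ _ _ E st'.
  have Ej : start (j_ v) = start j' + - q * n%:Z.
    by rewrite /j_ Ed /= (start_shift cw).
  have Ek : ival v = k' + - q * n%:Z by rewrite E mulNr addrK.
  have ESt : St v = strip A (start j') (stop k').
    by rewrite /St Ej Ek (stop_shift cw) (strip_shift cw).
  have Evv : vv v = front A (b_ u) (stop (ival u)).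
    by rewrite /vv Ej (back_shift cw) /b_ Ed /= Eb.
  split=> //; first by move=> p; rewrite ESt Evv; apply: (arc_meet cw PA bal irr p fw).
  by rewrite /sgn -Esg /s_ /b_ Ed /= Ek shiftC (hor_shift cw).
have [u0 [q0 E0]] := residue k0.
have [Su0 _] := datS _ _ _ _ _ _ E0 st0.
(* A cycle of the successor map [f] is the zig-zag walk; [winj] makes its blocks distinct. *)
have [y [l [l0 Sw wl winj]]] := finite_cycle Su0 (fun u Su => let: And4 Sv _ _ _ := fP u Su in Sv).
pose w (i : 'I_l) := iter i f y.
have wS (i : 'I_l) : w (ordS i) = f (w i).
  rewrite /w /=; have := ltn_ord i; rewrite leq_eqVlt => /orP[/eqP E|lt].
    by rewrite E modnn /= -iterS E wl.
  by rewrite modn_small.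
have wI (i j : 'I_l) : w i = w j -> i = j.
  by move=> E; apply: val_inj; apply: winj E.
have SwI i : S (w i) by apply: Sw.
have inn i : inner_interval P (St (w i)) := stuck_inner cw PA bal irr (SwI i).
have folw i : fol (w i) (w (ordS i)) by rewrite wS; apply: fP.
have qd i : quad (hor A (start (j_ (w i))) == b_ (w i)) (St (w i))
    (vv (w (ordS i))) (uu (w i)) (zz (w i)) (vv (w i)).
  have [_ -> _ _] := folw i.
  exact: (strip_quad cw _ (stuck_run cw PA bal irr (SwI i))).
have vV i : vv (w i) \in V P by have [_ _ _] := quad_V (inn i) (qd i).
have uV i : uu (w i) \in V P by have [] := quad_V (inn i) (qd i).
have zV i : zz (w i) \in V P by have [] := quad_V (inn i) (qd i).
have sep (i j : 'I_l) (J : interval) : i != j -> inner_interval P J ->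
    zz (w i) \in pts J -> zz (w j) \in pts J -> False.
  move=> ij; apply: (arc_sep cw PA bal irr (SwI i) (SwI j)).
  by move=> /residue_inj /wI E; rewrite E eqxx in ij.
have zpts i : zz (w i) \in pts (St (w i)).
  by have [_ _ ] := quad_pts (proj1 (inn i)) (qd i).
pose W := @ZigzagWalk P l (fun i => St (w i)) (fun i => [` vV i]%fset)
  (fun i => [` zV i]%fset) (fun i => [` uV i]%fset) l0.
have W1 : injective (fun i : 'I_l => St (w i)).
  move=> i j E; case: (eqVneq i j) => // ij.
  by case: (sep i j _ ij (inn i)); rewrite ?zpts // E zpts.
have W2 (i : 'I_l) :
    let diag := [fset (St (w i)).1; (St (w i)).2]%fset in
    let anti := [fset ulc (St (w i)); lrc (St (w i))]%fset in
    let vz := [fset vv (w i); zz (w i)]%fset in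
    let uv := [fset uu (w i); vv (w (ordS i))]%fset in
    (vz = diag /\ uv = anti) \/ (vz = anti /\ uv = diag).
  rewrite [[fset vv _; _]%fset]fsetUC [[fset uu _; _]%fset]fsetUC /=.
  have := quad_fset (qd i); case: (_ == _) => -[e1 e2]; [right|left];
    by split; rewrite ?e1 ?e2.
have W3 (i : 'I_l) p : (p \in pts (St (w i))) && (p \in pts (St (w (ordS i)))) =
    (p == vv (w (ordS i))).
  by have [_ _ -> _] := folw i.
have W4 (i : 'I_l) : exists E, [/\ edge_interval P E, vv (w i) \in pts E &
    vv (w (ordS i)) \in pts E].
  have := qd i; rewrite quadC quadsw quadC negbK => q'.
  by have [E [eE pE rE]] := quad_side (inn i) q'; exists E.
have {W} [W [Wl Wz Wu]] : exists W : zigzag_walk P, [/\ l = zz_len W,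
    forall x : point, (\sum_(i < zz_len W) (x == val (zz_z i)) = \sum_(i < l) (x == zz (w i)))%N &
    forall x : point, (\sum_(i < zz_len W) (x == val (zz_u i)) = \sum_(i < l) (x == uu (w i)))%N].
  have W5 (i j : 'I_l) : i != j -> ~ exists J, [/\ inner_interval P J,
     zz (w i) \in pts J & zz (w j) \in pts J].
    by move=> ij [J [iJ zi zj]]; apply: sep ij iJ zi zj.
  by exists (W W1 inn W2 W3 W4 W5); split.
(* The successor map preserves [sgn], so all far tokens belong to this one distribution. *)
pose t := sgn (w (Ordinal l0)).
have sgnw i : sgn (w i) = t.
  rewrite /w /t; elim: {i}(nat_of_ord i) => [//|i IH] /=.
  by have [_ _ _ ->] := fP _ (Sw i).
have tokz i : (0 < tok t (zz (w i)))%N.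
  have [_ _ ft _] := stuck_stop cw PA bal irr (SwI i).
  by move: ft; rewrite /front_tok negbK -/(sgn (w i)) sgnw.
have zzI i j : zz (w i) = zz (w j) -> i = j.
  move=> E; case: (eqVneq i j) => // ij.
  by case: (sep i j _ ij (inn i)); rewrite -?E zpts.
(* The far corners are distinct, so one token at each suffices to move them all at once. *)
have zsum x : (\sum_(i < l) (x == zz (w i)) <= tok t x)%N.
  have [[i ->]|no] := classic (exists i, x = zz (w i)).
    rewrite (bigD1 i) //= eqxx big1 ?addn0 // => j ji.
    by case: eqP => // /zzI E; rewrite E eqxx in ji.
  by rewrite big1 // => i _; case: eqP => // E; case: no; exists i.
pose m0 x := (tok t x - \sum_(i < l) (x == zz (w i)))%N.
pose m1 x := (m0 x + \sum_(i < l) (x == uu (w i)))%N.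
pose c' x := c x + -1 * \sum_(i < l) (sg (s_ (w i)) * ind (St (w i)) x).
exists t, (fun u => if u == t then m1 else tok u), c'; split.
- exists W, m0; rewrite eqxx; split=> x; last by rewrite Wu.
  by rewrite Wz /m0 subnK.
- by move=> x; case: (t).
- split=> [x|x xP]; last first.
    rewrite /c' bal.2 // big1 ?mulr0 // => i _; rewrite /ind.
    case: (boolP (subitv _ _)) => [sub|_]; last by rewrite mulr0.
    by have [_ /(_ _ sub)] := inn i; rewrite (negbTE xP).
  rewrite D_lin D_sum -bal.1.
  have -> : \sum_(i < l) D (fun x => sg (s_ (w i)) * ind (St (w i)) x) x =
      sg t * ((\sum_(i < l) (x == uu (w i)))%N%:Z - (\sum_(i < l) (x == zz (w i)))%N%:Z).
    (* The junction vertices cancel around the cycle, leaving only the [uu] and [zz] terms. *)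
    transitivity (sg t * \sum_(i < l) ((x == vv (w (ordS i)))%:Z - (x == vv (w i))%:Z
        + ((x == uu (w i))%:Z - (x == zz (w i))%:Z))).
      rewrite mulr_sumr; apply: eq_bigr => i _.
      have -> : D (fun x => sg (s_ (w i)) * ind (St (w i)) x) x =
          sg (s_ (w i)) * D (ind (St (w i))) x.
        by rewrite /D !mulrDr !mulrN.
      rewrite (D_quad x (proj1 (inn i)) (qd i)) mulrA -sgM (stuck_hor (SwI i)).
      rewrite -/(sgn (w i)) sgnw; congr (_ * _); ring.
    have E1 : \sum_(i < l) (x == vv (w (ordS i)))%:Z = \sum_(i < l) (x == vv (w i))%:Z.
      by rewrite [RHS](reindex_inj (@ordS_inj l)).
    rewrite big_split /= !sumrB E1 subrr add0r.
    by rewrite !(big_morph Posz PoszD (erefl _)).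
  have := zsum x; rewrite /m1 /m0; case: (t) => /=; rewrite /sg; lia.
- have pos (i : 'I_l) (x : point) : subitv (cell x) (St (w i)) -> 0 < sg (s_ (w i)) * c x.
    move=> /(strip_cell cw _ (stuck_run cw PA bal irr (SwI i)))[k kP ->].
    have [_ ps1] := stuck_start (SwI i); have [_ ps2 _ _] := stuck_stop cw PA bal irr (SwI i).
    have jk : j_ (w i) + 1 < ival (w i) by case: (SwI i).
    case: (ltrP k (ival (w i))) => kw; first by apply: ps1; clear -kP kw; lia.
    by apply: ps2; clear -kP kw jk; lia.
  (* The strips have no cell in common, so each height changes by one unit at most. *)
  have c'E (i : 'I_l) (x : point) : subitv (cell x) (St (w i)) ->
      c' x = c x - sg (s_ (w i)).
    move=> xi; rewrite /c' (bigD1 i) //= /ind xi mulr1 big1 ?addr0 ?mulN1r // => j ji.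
    case: (boolP (subitv _ _)) => [xj|_]; last by rewrite mulr0.
    move: xi xj => /(strip_cell cw _ (stuck_run cw PA bal irr (SwI i)))[k kP Ek].
    move=> /(strip_cell cw _ (stuck_run cw PA bal irr (SwI j)))[k' kP' Ek'].
    have := strips_disjoint cw PA bal irr (SwI i) (SwI j) kP kP'; rewrite -Ek -Ek'.
    by move=> /(_ erefl)/residue_inj/wI E; rewrite E eqxx in ji.
  pose i0 := Ordinal l0; have r0 := stuck_run cw PA bal irr (SwI i0).
  have in0 : subitv (cell (A (start (j_ (w i0))))) (St (w i0)).
    by apply/(strip_cell cw _ r0); eexists; last exact: erefl; case: r0 => -> _ _; rewrite lexx.
  apply: (@weight_lt _ _ _ (A (start (j_ (w i0))))); first exact: (A_in PA).
    by rewrite (c'E _ _ in0) sg_sub // (pos _ _ in0).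
  move=> x; have [[i xi]|no] := classic (exists i, subitv (cell x) (St (w i))).
    by rewrite (c'E _ _ xi) ltW // sg_sub // pos.
  rewrite /c' big1 ?mulr0 ?addr0 // => i _; rewrite /ind.
  by case: (boolP (subitv _ _)) => [xi|_]; [case: no; exists i|rewrite mulr0].
Qed.

End Walking.

(** * Ideals and monomials *)

Section IdealClosure.
Variable R : comNzRingType.

Lemma ideal_gen0 (G : R -> Prop) : ideal_gen G 0.
Proof. by exists [::]; rewrite big_nil. Qed.

Lemma ideal_genD (G : R -> Prop) p q : ideal_gen G p -> ideal_gen G q -> ideal_gen G (p + q).
Proof.
move=> [s [sG ->]] [t [tG ->]]; exists (s ++ t); rewrite big_cat; split=> // u.
by rewrite mem_cat => /orP[/sG|/tG].
Qed.

Lemma ideal_genM (G : R -> Prop) a p : ideal_gen G p -> ideal_gen G (a * p).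
Proof.
move=> [s [sG ->]]; exists [seq (a * u.1, u.2) | u <- s]; split.
  by move=> _ /mapP[u us ->] /=; apply: sG.
by rewrite big_map mulr_sumr; apply: eq_bigr => u _; rewrite mulrA.
Qed.

Lemma ideal_gen_mem (G : R -> Prop) p : G p -> ideal_gen G p.
Proof.
move=> Gp; exists [:: (1, p)]; rewrite big_seq1 mul1r; split=> // u.
by rewrite inE => /eqP ->.
Qed.

Variables G H : R -> Prop.
Notation In := (ideal_add (ideal_gen G) (ideal_gen H)).

Lemma ideal_add0 : In 0.
Proof. by exists 0, 0; rewrite addr0; split=> //; apply: ideal_gen0. Qed.

Lemma ideal_addD p q : In p -> In q -> In (p + q).
Proof.
move=> [a [b [Ia Jb ->]]] [a' [b' [Ia' Jb' ->]]]; exists (a + a'), (b + b').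
by split; [exact: ideal_genD|exact: ideal_genD|rewrite addrACA].
Qed.

Lemma ideal_addM a p : In p -> In (a * p).
Proof.
move=> [x [y [Ix Jy ->]]]; exists (a * x), (a * y).
by split; [exact: ideal_genM|exact: ideal_genM|rewrite mulrDr].
Qed.

Lemma ideal_addN p : In p -> In (- p).
Proof. by rewrite -mulN1r; apply: ideal_addM. Qed.

Lemma ideal_add_l p : G p -> In p.
Proof.
by move=> Gp; exists p, 0; rewrite addr0; split=> //; [exact: ideal_gen_mem|exact: ideal_gen0].
Qed.

Lemma ideal_add_r p : H p -> In p.
Proof.
by move=> Hp; exists 0, p; rewrite add0r; split=> //; [exact: ideal_gen0|exact: ideal_gen_mem].
Qed.

End IdealClosure.

(** Replace each monomial of f by a representative of its fibre under [phi]. The coefficients on a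
    fibre sum to zero, so the replaced polynomial vanishes and f is a combination of binomials
    within fibres. *)
Lemma monomial_kernel (K : fieldType) (N M : nat) (phi : 'X_{1..N} -> 'X_{1..M})
    (In : {mpoly K[N]} -> Prop) (f : {mpoly K[N]}) :
  In 0 -> (forall p q, In p -> In q -> In (p + q)) -> (forall a p, In p -> In (a * p)) ->
  (forall m m', phi m = phi m' -> In ('X_[m] - 'X_[m'])) ->
  \sum_(m <- msupp f) f@_m *: ('X_[phi m] : {mpoly K[M]}) = 0 -> In f.
Proof.
move=> I0 ID IM Ib E.
(* The default of [nth] is never reached on images of the support. *)
pose rep t := nth 0%MM (msupp f) (find (fun m => phi m == t) (msupp f)).
have repP m : m \in msupp f -> phi (rep (phi m)) = phi m.
  move=> mf; apply/eqP; apply: (@nth_find _ 0%MM (fun m' => phi m' == phi m)).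
  by apply/hasP; exists m.
pose ts := undup [seq phi m | m <- msupp f].
have second : \sum_(m <- msupp f) f@_m *: ('X_[rep (phi m)] : {mpoly K[N]}) = 0.
  transitivity (\sum_(t <- ts) (\sum_(m <- msupp f) f@_m *: ('X_[phi m] : {mpoly K[M]}))@_t
      *: ('X_[rep t] : {mpoly K[N]})); last first.
    by rewrite E big1 // => t _; rewrite mcoeff0 scale0r.
  transitivity (\sum_(t <- ts) \sum_(m <- msupp f)
      (f@_m * (phi m == t)%:R) *: ('X_[rep t] : {mpoly K[N]})); last first.
    apply: eq_bigr => t _; rewrite raddf_sum /= scaler_suml.
    by apply: eq_bigr => m _; rewrite mcoeffZ mcoeffX.
  rewrite exchange_big /= big_seq [RHS]big_seq; apply: eq_bigr => m mf.
  have mt : phi m \in ts by rewrite mem_undup; apply: map_f.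
  rewrite (bigD1_seq (phi m)) ?undup_uniq //= eqxx mulr1 big1 ?addr0 // => t.
  by rewrite eq_sym => /negbTE ->; rewrite mulr0 scale0r.
have -> : f = \sum_(m <- msupp f) f@_m *: ('X_[m] - 'X_[rep (phi m)]).
  rewrite (eq_bigr _ (fun m _ => scalerBr _ _ _)) sumrB second subr0.
  exact: mpolyE.
rewrite big_seq; elim/big_ind: _ => // m mf.
by rewrite -mul_mpolyC; apply/IM/Ib; rewrite repP.
Qed.

Section Monomials.
Variables (K : fieldType) (P : {fset point}).

Notation S := (ring_S K P).
Notation x_ := (@x_ K P).
Notation In := (ideal_add (ideal_I K P) (ideal_Z K P)).

Definition mon (m : point -> nat) : S := \prod_(r : V P) x_ r ^+ m (val r).

Lemma eq_mon m m' : m =1 m' -> mon m = mon m'.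
Proof. by move=> e; apply: eq_bigr => r _; rewrite e. Qed.

Lemma monD m m' : mon (fun x => m x + m' x)%N = mon m * mon m'.
Proof. by rewrite /mon -big_split; apply: eq_bigr => r _; rewrite exprD. Qed.

Lemma mon1 (r : V P) : mon (fun x => (x == val r)) = x_ r.
Proof.
rewrite /mon (bigD1 r) //= eqxx expr1 big1 ?mulr1 // => r' /negbTE.
by rewrite -val_eqE => ->.
Qed.

Lemma mon_sum (l : nat) (z : 'I_l -> V P) :
  mon (fun x => \sum_(i < l) (x == val (z i)))%N = \prod_(i < l) x_ (z i).
Proof.
rewrite /mon; under eq_bigr do rewrite -prodrXr.
rewrite exchange_big /=; apply: eq_bigr => i _; exact: mon1.
Qed.

Definition similar (m m' : point -> nat) : Prop := In (mon m - mon m').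

Lemma similar_refl m m' : m =1 m' -> similar m m'.
Proof. by move=> e; rewrite /similar (eq_mon e) subrr; apply: ideal_add0. Qed.

Lemma similar_sym m m' : similar m m' -> similar m' m.
Proof. by rewrite /similar => /ideal_addN; rewrite opprB. Qed.

Lemma similar_trans m1 m2 m3 : similar m1 m2 -> similar m2 m3 -> similar m1 m3.
Proof. by rewrite /similar => /ideal_addD H /H; rewrite addrA subrK. Qed.

Lemma imove_similar m m' : imove P m m' -> similar m m'.
Proof.
case=> I [t] [p] [q] [r] [s] [m0] [iI qd e e'].
have [v1 v2 v3 v4] := inner_V iI.
have dg : inner_binomial (x_ [` v1]%fset * x_ [` v2]%fset - x_ [` v3]%fset * x_ [` v4]%fset).
  exists [` v1]%fset, [` v2]%fset, [` v3]%fset, [` v4]%fset; split=> //=.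
have key (p' q' r' s' : V P) : (p = val p') -> (q = val q') -> (r = val r') -> (s = val s') ->
    In (x_ p' * x_ q' - x_ r' * x_ s') -> similar m m'.
  move=> Ep Eq Er Es H; subst p q r s; rewrite /similar (eq_mon e) (eq_mon e') !monD !mon1 -!mulrA -mulrBr.
  exact: ideal_addM.
have In1 : In _ := ideal_add_l _ dg; have In2 := ideal_addN In1; rewrite opprB in In2.
move: qd; rewrite /quad; case: t => /= /andP[];
  case/orP => /andP[/eqP E1 /eqP E2]; case/orP => /andP[/eqP E3 /eqP E4].
- exact: (key [` v1]%fset [` v2]%fset [` v3]%fset [` v4]%fset).
- by apply: (key [` v1]%fset [` v2]%fset [` v4]%fset [` v3]%fset) => //; rewrite [X in _ - X]mulrC.
- by apply: (key [` v2]%fset [` v1]%fset [` v3]%fset [` v4]%fset) => //; rewrite mulrC.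
- by apply: (key [` v2]%fset [` v1]%fset [` v4]%fset [` v3]%fset) => //;
    rewrite mulrC [X in _ - X]mulrC.
- exact: (key [` v3]%fset [` v4]%fset [` v1]%fset [` v2]%fset).
- by apply: (key [` v4]%fset [` v3]%fset [` v1]%fset [` v2]%fset) => //; rewrite mulrC.
- by apply: (key [` v3]%fset [` v4]%fset [` v2]%fset [` v1]%fset) => //; rewrite [X in _ - X]mulrC.
- by apply: (key [` v4]%fset [` v3]%fset [` v2]%fset [` v1]%fset) => //;
    rewrite mulrC [X in _ - X]mulrC.
Qed.

Lemma zmove_similar m m' : zmove P m m' -> similar m m'.
Proof.
case=> W [m0 [e e']]; rewrite /similar (eq_mon e) (eq_mon e') !monD !mon_sum -mulrBr.
by apply: ideal_addM; apply: ideal_add_r; exists W.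
Qed.

Lemma conn_similar m m' : conn P m m' -> similar m m'.
Proof.
elim=> {m m'} [m m' e|m m' m1 mv _ IH]; first exact: similar_refl.
exact: similar_trans (imove_similar mv) IH.
Qed.

End Monomials.

Lemma fset2_eq (a b c d : point) : c != d -> [fset a; b]%fset = [fset c; d]%fset ->
  ((a == c) && (b == d)) || ((a == d) && (b == c)).
Proof.
move=> cd E.
have Ha : a \in [fset c; d]%fset by rewrite -E in_fset2 eqxx.
have Hb : b \in [fset c; d]%fset by rewrite -E in_fset2 eqxx orbT.
have Hc : c \in [fset a; b]%fset by rewrite E in_fset2 eqxx.
have Hd : d \in [fset a; b]%fset by rewrite E in_fset2 eqxx orbT.
move: Ha Hb Hc Hd; rewrite !in_fset2.
case/orP => /eqP ->; case/orP => /eqP ->; rewrite !eqxx ?orbT //=.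
  by rewrite eq_sym (negbTE cd).
by rewrite (negbTE cd).
Qed.

Lemma fset_quad t I p q r s : proper I ->
  (if t then [fset p; q]%fset = [fset I.1; I.2]%fset else [fset p; q]%fset = [fset ulc I; lrc I]%fset) ->
  (if t then [fset r; s]%fset = [fset ulc I; lrc I]%fset else [fset r; s]%fset = [fset I.1; I.2]%fset) ->
  quad t I p q r s.
Proof.
case: I => [[a b] [a' b']] /andP[/= la lb].
have d1 : (a, b) != (a', b') by rewrite ptE /=; lia.
have d2 : (a, b') != (a', b) by rewrite ptE /=; lia.
by rewrite /quad /ulc /lrc; case: t => /= /fset2_eq -> // /fset2_eq ->.
Qed.

Lemma quad_neq t I p q r s : proper I -> quad t I p q r s -> (p != q) && (q != r).
Proof.
case: I => [[a b] [a' b']] /andP[/= la lb]; rewrite /quad /ulc /lrc; case: t => /= /andP[].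
  by case/orP => /andP[/eqP-> /eqP->]; case/orP => /andP[/eqP-> _]; rewrite !ptE /=; lia.
by case/orP => /andP[/eqP-> _]; case/orP => /andP[/eqP-> /eqP->]; rewrite !ptE /=; lia.
Qed.

(** * Descent on the weight *)

Section Reduction.
Variables (P : {fset point}) (A : int -> point) (n : nat).
Hypothesis cw : closed_walk A n.
Hypothesis PA : forall x, x \in P <-> exists i : int, x = A i.

Lemma balanced0 tok c : balanced P tok c -> (forall x, c x = 0) -> tok true =1 tok false.
Proof. by case=> bal _ c0 p; have := bal p; rewrite /D !c0; lia. Qed.

Lemma similar_reduction (K : fieldType) tok c :
  balanced P tok c -> similar K P (tok true) (tok false).
Proof.
have [w] := ubnP (weight P c); elim: w tok c => // w IH tok c wc bal.
have [c0|] := classic (forall x, c x = 0); first exact: similar_refl (balanced0 bal c0).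
case/not_all_ex_not => x /eqP cx.
have [[tok' [c' [C bal' lt]]]|irr] := classic (reducible P tok c).
  have sim := IH _ _ (leq_trans lt wc) bal'.
  apply: similar_trans (conn_similar K (C true)) _; apply: similar_trans sim _.
  exact: similar_sym (conn_similar K (C false)).
have [s [j [k [b st]]]] := exists_stuck cw PA bal irr cx.
have [t [tok' [c' [zm same bal' lt]]]] := zigzag_reduction cw PA bal irr st.
have sim := IH _ _ (leq_trans lt wc) bal'.
case: t zm same => zm same.
  apply: similar_trans (zmove_similar K zm) _; apply: similar_trans sim _.
  exact: similar_refl same.
apply: similar_trans (similar_refl K P (fsym same)) _; apply: similar_trans sim _.
exact: similar_sym (zmove_similar K zm).
Qed.

Lemma conn_reduction (k0 : int) : (forall i : int, k0 <= i <= k0 + 3 -> ~~ straight A i) ->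
  forall tok c, balanced P tok c -> conn P (tok true) (tok false).
Proof.
move=> corners tok c; have [w] := ubnP (weight P c); elim: w tok c => // w IH tok c wc bal.
have [c0|] := classic (forall x, c x = 0); first exact: conn_refl (balanced0 bal c0).
case/not_all_ex_not => x /eqP cx.
have [[tok' [c' [C bal' lt]]]|irr] := classic (reducible P tok c).
  apply: conn_trans (C true) _; apply: conn_trans (IH _ _ (leq_trans lt wc) bal') _.
  exact: conn_sym (C false).
have [s [j [k [b st]]]] := exists_stuck cw PA bal irr cx.
by case: (no_four_corners cw PA bal irr corners st).
Qed.

(* The monomial of the z_i admits no I-move, so it would have to be the monomial
   of the u_i. *)
Lemma zigzag_no_four_corners (W : zigzag_walk P) (k0 : int) :
  ~ (forall i : int, k0 <= i <= k0 + 3 -> ~~ straight A i).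
Proof.
move=> corners; pose l := zz_len W.
pose z (i : 'I_l) := val (zz_z i); pose u (i : 'I_l) := val (zz_u i).
pose v (i : 'I_l) := val (zz_v i).
pose m x := (\sum_(i < l) (x == z i))%N; pose m' x := (\sum_(i < l) (x == u i))%N.
have inn (i : 'I_l) : inner_interval P (zz_I i) := zz_inner i.
have qd (i : 'I_l) : exists t, quad t (zz_I i) (v i) (z i) (u i) (v (ordS i)).
  have [pI _] := inn i.
  by case: (zz_corners i) => -[e1 e2]; [exists true|exists false]; apply: fset_quad.
have [t tP] := fin_all_exists qd.
pose c x := \sum_(i < l) (- sg (t i) * ind (zz_I i) x).
have bal : balanced P (fun b => if b then m else m') c.
  split=> [p|x xP]; last first.
    rewrite /c big1 // => i _; rewrite /ind; case: (boolP (subitv _ _)) => [sub|]; last by rewrite mulr0.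
    by have [_ /(_ _ sub)] := inn i; rewrite (negbTE xP).
  rewrite D_sum /m /m' !(big_morph Posz PoszD (erefl _)).
  transitivity (\sum_(i < l) (((p == v (ordS i))%:Z - (p == v i)%:Z) + ((p == u i)%:Z - (p == z i)%:Z))).
    have E1 : \sum_(i < l) (p == v (ordS i))%:Z = \sum_(i < l) (p == v i)%:Z.
      by rewrite [RHS](reindex_inj (@ordS_inj l)).
    by rewrite big_split /= !sumrB E1 subrr add0r.
  apply: eq_bigr => i _.
  have -> : D (fun x => - sg (t i) * ind (zz_I i) x) p = - sg (t i) * D (ind (zz_I i)) p.
    by rewrite /D !mulrDr !mulrN.
  rewrite (D_quad p (proj1 (inn i)) (tP i)); case: (t i); rewrite /sg; ring.
have zin (i : 'I_l) : z i \in pts (zz_I i) by have [_ ] := quad_pts (proj1 (inn i)) (tP i).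
have uin (i : 'I_l) : u i \in pts (zz_I i) by have [_ ] := quad_pts (proj1 (inn i)) (tP i).
have sep (i j : 'I_l) J : inner_interval P J -> z i \in pts J -> z j \in pts J -> i = j.
  by move=> iJ zi zj; case: (eqVneq i j) => // /zz_sep; case; exists J.
have some_z x : (0 < m x)%N -> exists i, x = z i.
  move=> mx; have [//|no] := classic (exists i, x = z i).
  by move: mx; rewrite /m big1 // => i _; case: eqP => // E; case: no; exists i.
(* A move takes tokens at two distinct corners of one inner interval, which condition (3) forbids
   for the z_i. *)
have isolated m1 : ~ imove P m m1.
  case=> J [t'] [p] [q] [r] [s] [m0] [iJ qJ e _].
  have [pJ qJ' _ _] := quad_pts (proj1 iJ) qJ.
  have [|i Ei] := some_z p; first by rewrite e eqxx addn1 addSn.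
  have [|j Ej] := some_z q; first by rewrite e eqxx addn1.
  have E := sep i j J iJ; rewrite -Ei -Ej in E.
  have := quad_neq (proj1 iJ) qJ; rewrite Ei Ej (E pJ qJ') eqxx.
  by move=> /andP[].
have mm' : m =1 m'.
  have C := conn_reduction corners bal; move: C isolated; rewrite /=; case=> // m1 mv _ no.
  by case: (no _ mv).
pose i0 : 'I_l := Ordinal (zz_len_gt0 W).
have : (0 < m' (z i0))%N by rewrite -mm' /m (bigD1 i0) //= eqxx.
have [[j Ej]|no] := classic (exists j, z i0 = u j); last first.
  by rewrite /m' big1 // => i _; case: eqP => // E; case: no; exists i.
(* A common point of the z_i and u_j lies in the j-th interval together with z_j; condition (3)
   makes it z_j, but z_j and u_j are different corners. *)
move=> _; have E : i0 = j by apply: (sep _ _ _ (inn j)); rewrite ?zin // Ej uin.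
by have := quad_neq (proj1 (inn j)) (tP j); rewrite -E Ej E eqxx andbF.
Qed.

End Reduction.

(** * From a closed path to a periodic walk *)

Lemma corners_cellE (p x : point) : (p \in corners (cell x)) =
  ((p.1 == x.1) || (p.1 == x.1 + 1)) && ((p.2 == x.2) || (p.2 == x.2 + 1)).
Proof. by rewrite !inE /ulc /lrc /cell !ptE /=; lia. Qed.

Lemma sides_cellE (e : interval) (x : point) : e \in sides (cell x) ->
  [\/ e = (x, (x.1 + 1, x.2)), e = ((x.1, x.2 + 1), (x.1 + 1, x.2 + 1)),
      e = (x, (x.1, x.2 + 1)) | e = ((x.1 + 1, x.2), (x.1 + 1, x.2 + 1))].
Proof. by move=> /fset4P. Qed.

Lemma common_edge_near (p q : point) : common_edge p q -> near p q.
Proof.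
case/existsP => -[e ep] /= /andP[eq /eqP E].
have npq : p != q.
  apply/negP => /eqP pq; move: E; rewrite -pq fsetIid => /fsetP E.
  have := E p; have := E (ulc (cell p)); have := E (lrc (cell p)).
  rewrite !in_fset2 !corners_cellE /ulc /lrc /= !eqxx !orbT /=.
  case: e {ep eq E} => -[a b] [c d]; rewrite !ptE /=; lia.
case: p q ep eq npq {E} => [a b] [c d] /sides_cellE ep /sides_cellE eq.
rewrite ptE /near /=.
by case: ep eq => -> [] /= []; lia.
Qed.

Section Wrap.
Variables (n : nat) (n0 : (0 < n)%N).

Lemma wrap_subproof (i : int) : (`|(i %% n%:Z)%Z| < n)%N.
Proof. by have := @ltz_pmod i n%:Z; have := @modz_ge0 i n%:Z; lia. Qed.

Definition wrap (i : int) : 'I_n := Ordinal (wrap_subproof i).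

Lemma wrapE (i : int) : exists q : int, i = (wrap i : nat)%:Z + q * n%:Z.
Proof.
exists (i %/ n%:Z)%Z => /=; rewrite gez0_abs ?modz_ge0 //; last by lia.
by rewrite addrC -divz_eq.
Qed.

Lemma wrap_eq (i q : int) (u : 'I_n) : i = (u : nat)%:Z + q * n%:Z -> wrap i = u.
Proof.
move=> E; have [q' E'] := wrapE i; apply: ord_inj.
have := ltn_ord u; have := ltn_ord (wrap i); move: (etrans (esym E) E').
move: (nat_of_ord (wrap i)) (nat_of_ord u) => w v.
have [->|[lt|lt]] : q = q' \/ q + 1 <= q' \/ q' + 1 <= q by lia.
- by lia.
- have : (q + 1) * n%:Z <= q' * n%:Z by nia.
  by rewrite mulrDl mul1r; lia.
- have : (q' + 1) * n%:Z <= q * n%:Z by nia.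
  by rewrite mulrDl mul1r; lia.
Qed.

Lemma wrap_ord (u : 'I_n) : wrap (u : nat)%:Z = u.
Proof. by apply: (@wrap_eq _ 0); rewrite mul0r addr0. Qed.

Lemma wrap_shift (i : int) : wrap (i + n%:Z) = wrap i.
Proof.
have [q E] := wrapE i; apply: (@wrap_eq _ (q + 1)).
by rewrite {1}E mulrDl mul1r addrA.
Qed.

Lemma wrap_next (i : int) : wrap (i + 1) = ordS (wrap i).
Proof.
have [q] := wrapE i; move: (wrap i) => u E.
have := ltn_ord u; rewrite leq_eqVlt => /orP[/eqP En|lt].
  by apply: (@wrap_eq _ (q + 1)); rewrite /= En modnn; clear -E En; lia.
by apply: (@wrap_eq _ q); rewrite /= modn_small //; clear -E; lia.
Qed.

Lemma wrap_prev (i : int) : wrap (i - 1) = ord_pred (wrap i).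
Proof. by rewrite -[in RHS](subrK 1 i) wrap_next ordSK. Qed.

End Wrap.

Lemma closed_path_walk (P : {fset point}) : closed_path P ->
  exists (A : int -> point) (n : nat),
    closed_walk A n /\ forall x, x \in P <-> exists i : int, x = A i.
Proof.
case=> _ [n [A [n5 Ainj -> edge disj]]]; have n0 : (0 < n)%N by case: (n) n5.
pose w := wrap n0; exists (fun i => A (w i)), n.
have near_w (i : int) : near (A (w i)) (A (w (i + 1))).
  by rewrite /w wrap_next; apply: common_edge_near.
have five (i j : int) : near (A (w i)) (A (w j)) \/ diagonal (A (w i)) (A (w j)) ->
    [\/ w j = w i, w j = w (i + 1), w j = w (i - 1) |
        w j = w (i + 1 + 1) \/ w j = w (i - 1 - 1)].
  move=> nd; case: (boolP (w j \in
      [:: ord_pred (ord_pred (w i)); ord_pred (w i); w i; ordS (w i); ordS (ordS (w i))])).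
    rewrite !inE /w !wrap_next !wrap_prev.
    case/or4P => [/eqP|/eqP|/eqP|/orP[/eqP|/eqP]].
    - by constructor 4; right.
    - by constructor 3.
    - by constructor 1.
    - by constructor 2.
    - by constructor 4; left.
  move=> /disj /fsetP E; exfalso.
  (* Touching cells share the vertex at the componentwise maximum of their lower left corners. *)
  have := E (Num.max (A (w i)).1 (A (w j)).1, Num.max (A (w i)).2 (A (w j)).2).
  rewrite in_fsetI !corners_cellE in_fset0 /=.
  by move: nd; clear; case: (A (w i)) (A (w j)) => [a b] [c d]; rewrite /near /diagonal /=; lia.
(* Chessboard colouring: three cells cannot be pairwise adjacent, so edge neighbours are never two
   positions apart. *)
have odd3 (x y z : point) : near x y -> near y z -> near x z -> False.
  by case: x y z => [a b] [c d] [e f]; rewrite /near /=; lia.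
have near_w' (i : int) : near (A (w i)) (A (w (i - 1))).
  by rewrite near_sym; have := near_w (i - 1); rewrite subrK.
split; first split=> //.
- by move=> i; rewrite /w wrap_shift.
- move=> i j /Ainj E; have [q Eq] := wrapE n0 i; have [q' Eq'] := wrapE n0 j.
  apply/dvdzP; exists (q - q'); rewrite -/w in Eq Eq'; rewrite Eq Eq' E; ring.
- move=> i j nr; case: (five i j (or_introl nr)) => [E|->|->|[]E]; [|by left|by right|..].
  + by move: nr; rewrite E /near !subrr.
  + by case: (odd3 _ _ _ (near_w i) (near_w (i + 1))); rewrite -E.
  + by case: (odd3 _ _ _ (near_w' i) (near_w' (i - 1))); rewrite -E.
- have nd (x y : point) : near x y -> diagonal x y -> False.
    by case: x y => [a b] [c d]; rewrite /near /diagonal /=; lia.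
  move=> i j dg; case: (five i j (or_intror dg)) => [E|E|E|[->|->]]; [..|by left|by right].
  + by move: dg; rewrite E /diagonal !subrr.
  + by case: (nd _ _ (near_w i)); rewrite -E.
  + by case: (nd _ _ (near_w' i)); rewrite -E.
- move=> x; split=> [/imfsetP[u _ ->]|[i ->]]; last exact: in_imfset.
  by exists (u : nat)%:Z; rewrite /w wrap_ord.
Qed.

(** * The two sides of the path *)

Section Sidedness.
Variables (P : {fset point}) (A : int -> point) (n : nat).
Hypothesis cw : closed_walk A n.
Hypothesis PA : forall x, x \in P <-> exists i : int, x = A i.
Variable C : point -> int.
Hypothesis C_near : forall p q, p \notin P -> q \notin P -> near p q -> C p = C q.

(** At a turn to side [b] the cell beside cell i is cell i-1 of the path; the cell beside i+1 is
    then off the path by [turn_alternate]. *)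
Definition side_value (b : bool) (i : int) : int :=
  if turn A b i then C (beside A b i (i + 1)) else C (beside A b i i).

Lemma beside_off (b : bool) (i : int) : ~~ turn A b i -> beside A b i i \notin P.
Proof.
move=> t; apply/negP => /PA[j /esym E].
by have [t' _] := beside_self cw E; rewrite t' in t.
Qed.

Lemma beside_next_off (b : bool) (i : int) :
  ~~ turn A b (i + 1) -> beside A b i (i + 1) \notin P.
Proof.
move=> t; apply/negP => /PA[j /esym E].
by have [t' _] := beside_next cw E; rewrite t' in t.
Qed.

Lemma side_next (b : bool) (i : int) : ~~ turn A b (i + 1) ->
  C (beside A b i (i + 1)) = side_value b i.
Proof.
move=> t1; rewrite /side_value; case: ifPn => // t.
apply: C_near; [exact: beside_next_off|exact: beside_off|].
rewrite /near /beside A_step /=.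
by clear -cw; case: (step_cases cw i) => ->; case: b => /=; lia.
Qed.

Lemma side_prev (b : bool) (i : int) : side_value b (i - 1) = side_value b i.
Proof.
have nxt := @side_next b (i - 1); rewrite subrK in nxt.
have [st|[t|t]] : straight A i \/ turn A b i \/ turn A (~~ b) i.
  case: (turn_cases cw i) => t; first by left.
    by right; case: (b); [left|right].
  by right; case: (b); [right|left].
- have tF b' : turn A b' i = false by apply/negP => /(turn_corner cw); rewrite st.
  rewrite -nxt ?tF // /side_value tF; congr (C _).
  by rewrite /beside; move/eqP: st => ->.
- rewrite /side_value t; have := turn_alternate cw (b := b) (i := i - 1); rewrite subrK t.
  case: (boolP (turn A b (i - 1))) => [t' /(_ isT)//|t' _].
  congr (C _); rewrite /beside (A_step A i) (A_step_prev A i); move/eqP: t => ->.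
  by clear -cw; case: b; case: (step_cases cw (i - 1)) => ->; apply: pt_eq => /=; lia.
have tF : turn A b i = false by rewrite -[b]negbK (turnN cw t).
rewrite -nxt ?tF // /side_value tF.
(* The cell diagonally beyond the outer corner of the turn connects the two outer neighbours of cell
   i. *)
pose q : point := ((A i).1 + (step A (i - 1)).1 - (step A i).1,
                   (A i).2 + (step A (i - 1)).2 - (step A i).2).
have qP : q \notin P.
  apply/negP => /PA[j E]; have := outer_cells cw (j := j) t; rewrite -E => H.
  have /H/eqP : oppc A i (sd A (~~ b) i) \in pts (cell q).
    rewrite pts_cell /q /oppc /sd; move/eqP: t => ->.
    by clear -cw; case: b; case: (step_cases cw (i - 1)) => -> /=; lia.
  rewrite ptE /q; move/eqP: t => ->.
  by clear -cw; case: b; case: (step_cases cw (i - 1)) => -> /=; lia.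
transitivity (C q); [|symmetry]; apply: C_near => //.
- by have := @beside_next_off b (i - 1); rewrite subrK; apply; rewrite tF.
- rewrite /near /beside /q; move/eqP: t => ->.
  by clear -cw; case: b; case: (step_cases cw (i - 1)) => -> /=; lia.
- by apply: beside_off; rewrite tF.
- rewrite /near /beside /q; move/eqP: t => ->.
  by clear -cw; case: b; case: (step_cases cw (i - 1)) => -> /=; lia.
Qed.

Lemma side_const (b : bool) (i j : int) : side_value b i = side_value b j.
Proof.
have up (m : nat) (k : int) : side_value b (k + m%:Z) = side_value b k.
  elim: m => [|m IH]; first by rewrite addr0.
  by rewrite -side_prev -IH; congr (side_value _ _); lia.
case: (lerP i j) => ij.
  have -> : j = i + `|j - i|%N%:Z by lia.
  by rewrite up.
have -> : i = j + `|i - j|%N%:Z by lia.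
by rewrite up.
Qed.

Lemma side_near (i : int) (q : point) : q \notin P -> near (A i) q ->
  exists b, C q = side_value b 0.
Proof.
move=> qP nr.
have off : q <> A (i + 1) /\ q <> A (i - 1).
  by split=> E; move: qP; rewrite E; move/negP; apply; apply/PA; eexists.
have [Eb|[Eb|[E|E]]] : q = beside A true i i \/ q = beside A false i i \/ q = A (i + 1) \/
    q = ((A i).1 - (step A i).1, (A i).2 - (step A i).2).
- rewrite /beside (A_step A i); move: nr; rewrite /near.
  clear -cw; case: (A i) q => a b [c d] /= nr.
  (have [E|[E|[E|E]]] : (c = a + 1 /\ d = b) \/ (c = a - 1 /\ d = b) \/ (c = a /\ d = b + 1) \/
     (c = a /\ d = b - 1) by lia); case: E => -> ->; case: (step_cases cw i) => -> /=;
    do [by left; apply: pt_eq => /=; lia | by right; left; apply: pt_eq => /=; lia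
       |by right; right; left; apply: pt_eq => /=; lia|by right; right; right; apply: pt_eq => /=; lia].
- exists true; rewrite (side_const _ 0 i) /side_value; case: ifP => [/(turn_prev cw) E|_]; last by rewrite Eb.
  by rewrite Eb -E in off; case: off.
- exists false; rewrite (side_const _ 0 i) /side_value; case: ifP => [/(turn_prev cw) E|_]; last by rewrite Eb.
  by rewrite Eb -E in off; case: off.
- by case: off.
(* The cell behind the outgoing step is off the path only at a corner, and there it lies on the
   outer side of the incoming step. *)
have Nst : ~~ straight A i.
  by apply/negP => /eqP st; case: off => _; rewrite E A_step_prev st.
have [b t] := corner_turn cw Nst; exists (~~ b).
have := @side_next (~~ b) (i - 1); rewrite subrK (turnN cw t) => /(_ isT).
rewrite (side_const _ 0 (i - 1)) => <-; congr (C _).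
rewrite E /beside; move/eqP: t => ->.
by clear -cw; case: b; case: (step_cases cw (i - 1)) => ->; apply: pt_eq => /=; lia.
Qed.

End Sidedness.

(** * Isometries as oriented frames *)

Definition frame (t u : point) (b : bool) (p : point) : point :=
  (t.1 + p.1 * u.1 + p.2 * (rot b u).1, t.2 + p.1 * u.2 + p.2 * (rot b u).2).

Lemma isometry_frame (s : point -> point) : isometry s ->
  exists (t u : point) (b : bool), near u (0, 0) /\ s =1 frame t u b.
Proof.
elim=> {s} [t||||f g _ [t [u [b [nu fE]]]] _ [t' [u' [b' [nu' gE]]]]].
- by exists t, (1, 0), true; split=> // -[x y]; apply: pt_eq => /=; lia.
- by exists (0, 0), (0, 1), true; split=> // -[x y]; apply: pt_eq => /=; lia.
- by exists (0, 0), (1, 0), false; split=> // -[x y]; apply: pt_eq => /=; lia.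
- by exists (0, 0), (-1, 0), false; split=> // -[x y]; apply: pt_eq => /=; lia.
exists (frame t u b t'), (frame (0, 0) u b u'), (b == b'); split.
  rewrite /frame; case: (near0_cases nu) => ->; case: (near0_cases nu') => ->;
    by case: (b) (b') => -[].
move=> [x y]; rewrite /= fE gE /frame.
case: (near0_cases nu) => ->; case: (near0_cases nu') => ->;
  by case: (b) (b') => -[] /=; apply: pt_eq => /=; lia.
Qed.

(** * The special configuration *)

Section Frame.
Variables (t u : point) (b : bool).
Hypothesis nu : near u (0, 0).

(* The frame maps (0, 0) to a corner of the image of the cell [x] that need not be its
   lower left one; hence the shifts. *)
Definition cell_image (x : point) : point :=
  ((frame t u b x).1 - (if u.1 + (rot b u).1 < 0 then 1 else 0),
   (frame t u b x).2 - (if u.2 + (rot b u).2 < 0 then 1 else 0)).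

Lemma cell_imageP (P : {fset point}) (x : point) :
  image_cell_in P (frame t u b) x -> cell_image x \in P.
Proof.
case=> c' c'P /fsetP E; suff -> : cell_image x = c' by [].
have key (p : point) : p \in corners (cell x) -> frame t u b p \in corners (cell c').
  by move=> px; rewrite -E; apply: in_imfset.
have k1 := key (x.1, x.2); have k2 := key (x.1 + 1, x.2 + 1).
have k3 := key (x.1 + 1, x.2); have k4 := key (x.1, x.2 + 1).
move: k1 k2 k3 k4; rewrite !corners_cellE /= !eqxx !orbT /=.
move=> /(_ isT) k1 /(_ isT) k2 /(_ isT) k3 /(_ isT) k4.
move: k1 k2 k3 k4; rewrite /cell_image /frame; case: x c' {key E c'P} => [x y] [c d] /=.
by case: (near0_cases nu) => ->; case: b => /= k1 k2 k3 k4; apply: pt_eq => /=; lia.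
Qed.

Lemma near_cell_image (x y : point) : near (cell_image x) (cell_image y) = near x y.
Proof.
rewrite /near /cell_image /frame.
by case: (near0_cases nu) => ->; case: b => /=; lia.
Qed.

Lemma diagonal_cell_image (x y : point) :
  diagonal (cell_image x) (cell_image y) = diagonal x y.
Proof.
rewrite /diagonal /cell_image /frame.
by case: (near0_cases nu) => ->; case: b => /=; lia.
Qed.

Lemma cell_image_inj : injective cell_image.
Proof.
move=> [x1 x2] [y1 y2] /eqP; rewrite ptE /cell_image /frame => H.
apply/eqP; rewrite ptE; move: H.
by case: (near0_cases nu) => ->; case: b => /=; lia.
Qed.

Lemma frame_inj : injective (frame t u b).
Proof.
move=> [x1 x2] [y1 y2] /eqP; rewrite ptE /frame => H.
apply/eqP; rewrite ptE; move: H.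
by case: (near0_cases nu) => ->; case: b => /=; lia.
Qed.

Lemma D_frame (c : point -> int) (x y : int) : D c (frame t u b (x, y)) =
  sg (b == (u.2 == 0)) * (c (cell_image (x, y)) + c (cell_image (x - 1, y - 1)) -
    c (cell_image (x - 1, y)) - c (cell_image (x, y - 1))).
Proof.
rewrite /D /cell_image /frame.
have ceq (a a' d d' : int) : a = a' -> d = d' -> c (a, d) = c (a', d') by move=> -> ->.
pose w (i j : int) := c (t.1 + x * u.1 + y * (rot b u).1 + i,  t.2 + x * u.2 + y * (rot b u).2 + j).
have wE (i j a d : int) : a = t.1 + x * u.1 + y * (rot b u).1 + i ->
   d = t.2 + x * u.2 + y * (rot b u).2 + j -> c (a, d) = w i j by exact: ceq.
pose v := rot b u; pose o1 : int := if u.1 + v.1 < 0 then 1 else 0.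
pose o2 : int := if u.2 + v.2 < 0 then 1 else 0.
transitivity (w 0 0 + w (-1) (-1) - w (-1) 0 - w 0 (-1)).
  by congr (_ + _ - _ - _); apply: wE => /=; lia.
transitivity (sg (b == (u.2 == 0)) * (w (- o1) (- o2) +
    w (- u.1 - v.1 - o1) (- u.2 - v.2 - o2) - w (- u.1 - o1) (- u.2 - o2) -
    w (- v.1 - o1) (- v.2 - o2))); last first.
  by congr (_ * (_ + _ - _ - _)); symmetry; apply: wE; rewrite /= -/v -/o1 -/o2; ring.
move: w {wE ceq} => w; rewrite /o1 /o2 /v /sg.
by case: (near0_cases nu) => ->; case: b => /=; ring.
Qed.

Variables (P : {fset point}) (A : int -> point) (n : nat).
Hypothesis cw : closed_walk A n.
Hypothesis PA : forall x, x \in P <-> exists i : int, x = A i.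
Notation ci x y := (cell_image (x, y)).
Hypothesis configP : forall x, x \in [:: (0, 2); (0, 1); (1, 1); (1, 0); (2, 0)] ->
  cell_image x \in P.

(* Up to reversing the walk, it runs through the configuration downwards. *)
Lemma oriented_walk : exists (A' : int -> point) (i : int),
  [/\ closed_walk A' n, forall x, x \in P <-> exists i : int, x = A' i &
  [/\ A' (i - 1) = ci 0 2, A' i = ci 0 1, A' (i + 1) = ci 1 1,
      A' (i + 1 + 1) = ci 1 0 & A' (i + 1 + 1 + 1) = ci 2 0]].
Proof.
have rest (B : int -> point) (i : int) : closed_walk B n ->
    (forall x, x \in P <-> exists i : int, x = B i) ->
    B i = ci 0 1 -> B (i + 1) = ci 1 1 -> exists (A' : int -> point) (i : int),
    [/\ closed_walk A' n, forall x, x \in P <-> exists i : int, x = A' i &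
    [/\ A' (i - 1) = ci 0 2, A' i = ci 0 1, A' (i + 1) = ci 1 1,
      A' (i + 1 + 1) = ci 1 0 & A' (i + 1 + 1 + 1) = ci 2 0]].
  move=> bw PB E01 E11; exists B, i; split=> //.
  have nbr (k : int) (x y x' y' : int) : B k = ci x y -> near (x, y) (x', y') ->
      (x', y') \in [:: (0, 2); (0, 1); (1, 1); (1, 0); (2, 0)] ->
      B (k + 1) = ci x' y' \/ B (k - 1) = ci x' y'.
    move=> Ek nr /configP/PB[l El].
    have /(cw_adj bw)[E|E] : near (B k) (B l) by rewrite Ek -El near_cell_image.
      by left; rewrite El E.
    by right; rewrite El E.
  have ne (x y x' y' : int) : (x, y) <> (x', y') -> ci x y <> ci x' y'.
    by move=> H /cell_image_inj.
  have E02 : B (i - 1) = ci 0 2.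
    by case: (nbr i 0 1 0 2 E01) => // E; rewrite E11 in E; case: (ne _ _ _ _ _ E).
  have E10 : B (i + 1 + 1) = ci 1 0.
    by case: (nbr (i + 1) 1 1 1 0 E11) => //; rewrite addrK E01 => E; case: (ne _ _ _ _ _ E).
  have E20 : B (i + 1 + 1 + 1) = ci 2 0.
    by case: (nbr (i + 1 + 1) 1 0 2 0 E10) => //; rewrite addrK E11 => E; case: (ne _ _ _ _ _ E).
  by split.
have /PA[i Ei] : ci 0 1 \in P by apply: configP.
have /PA[k Ek] : ci 1 1 \in P by apply: configP.
have /(cw_adj cw)[E|E] : near (A i) (A k) by rewrite -Ei -Ek near_cell_image.
  by apply: (rest A i) => //; rewrite -E.
apply: (rest (reversed A) (- i)).
- exact: reversed_walk cw.
- move=> x; split=> [/PA[l ->]|[l ->]]; first by exists (- l); rewrite /reversed opprK.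
  by apply/PA; exists (- l).
- by rewrite /reversed opprK.
- by rewrite Ek E /reversed; congr (A _); lia.
Qed.

End Frame.

Section Config.
Variables (t u : point) (b : bool).
Hypothesis nu : near u (0, 0).
Variables (P : {fset point}) (A : int -> point) (n : nat).
Hypothesis cw : closed_walk A n.
Hypothesis PA : forall x, x \in P <-> exists i : int, x = A i.
Notation ci x y := (cell_image t u b (x, y)).
Variable i : int.
Hypotheses (E02 : A (i - 1) = ci 0 2) (E01 : A i = ci 0 1) (E11 : A (i + 1) = ci 1 1)
  (E10 : A (i + 1 + 1) = ci 1 0) (E20 : A (i + 1 + 1 + 1) = ci 2 0).

Lemma ci_inj (x y x' y' : int) : ci x y = ci x' y' -> x = x' /\ y = y'.
Proof. by move=> /(cell_image_inj nu) [-> ->]. Qed.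

Lemma near_off (k : int) (x y x1 y1 x2 y2 x3 y3 : int) : A k = ci x y ->
  A (k + 1) = ci x1 y1 -> A (k - 1) = ci x2 y2 -> near (x, y) (x3, y3) ->
  (x3, y3) != (x1, y1) -> (x3, y3) != (x2, y2) -> ci x3 y3 \notin P.
Proof.
move=> Ek E1 E2 nr n1 n2; apply/negP => /PA[l El].
have /(cw_adj cw)[E|E] : near (A k) (A l) by rewrite Ek -El near_cell_image.
  by move: El n1; rewrite E E1 => /(cell_image_inj nu) -> /eqP.
by move: El n2; rewrite E E2 => /(cell_image_inj nu) -> /eqP.
Qed.

(** These are the cells left over in [special_sum], except (-1,2). The first three touch a cell
    whose two path neighbours are already known; the last two would be two positions away
    diagonally, too far from the cell in between. *)
Lemma config_off : [/\ ci 0 0 \notin P, ci 1 2 \notin P, ci 1 (-1) \notin P,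
  ci (-1) 0 \notin P & ci 0 (-1) \notin P].
Proof.
split.
- exact: (near_off E01 E11 E02).
- by apply: (near_off E11 E10 (x2 := 0) (y2 := 1)); rewrite ?addrK.
- by apply: (near_off E10 E20 (x2 := 1) (y2 := 1)); rewrite ?addrK.
- apply/negP => /PA[l El].
  have /(cw_diag cw)[E|E] : diagonal (A i) (A l) by rewrite E01 -El diagonal_cell_image.
    by move: El; rewrite E E10 => /ci_inj[].
  have := cw_near cw (i - 1 - 1); rewrite subrK near_sym E02 -E -El near_cell_image //.
- apply/negP => /PA[l El].
  have /(cw_diag cw)[E|E] : diagonal (A (i + 1 + 1)) (A l) by rewrite E10 -El diagonal_cell_image.
    have := cw_near cw (i + 1 + 1 + 1); rewrite E20 -E -El near_cell_image //.
  by move: El; rewrite E !addrK E01 => /ci_inj[].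
Qed.

Lemma config_corners : ci (-1) 2 \in P ->
  forall k : int, i - 1 <= k <= i - 1 + 3 -> ~~ straight A k.
Proof.
move=> /PA[l El]; have En : A (i - 1 - 1) = ci (-1) 2.
  have /(cw_adj cw)[E|E] : near (A (i - 1)) (A l) by rewrite E02 -El near_cell_image.
    by move: El; rewrite E subrK E01 => /ci_inj[].
  by rewrite El E.
have cor (k x y x1 y1 x2 y2 : int) : A (k - 1) = ci x1 y1 -> A k = ci x y -> A (k + 1) = ci x2 y2 ->
    (x2 - x, y2 - y) != (x - x1, y - y1) -> ~~ straight A k.
  move=> e1 e e2; rewrite /straight !stepE subrK e1 e e2 !ptE /cell_image /frame /=.
  by case: (near0_cases nu) => ->; case: b; clear => /=; lia.
move=> k kP; have [->|[->|[->|->]]] : k = i - 1 \/ k = i \/ k = i + 1 \/ k = i + 1 + 1.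
- by clear -kP; lia.
- by apply: (cor _ _ _ _ _ _ _ En E02); rewrite ?subrK; first exact: E01.
- by apply: (cor _ _ _ _ _ _ _ E02 E01 E11).
- by apply: (cor _ _ _ _ _ _ _ _ E11 E10); rewrite ?addrK; first exact: E01.
- by apply: (cor _ _ _ _ _ _ _ _ E10 E20); rewrite ?addrK; first exact: E11.
Qed.

Lemma config_sides : exists a : bool,
  ci 1 2 = beside A a (i - 1) (i - 1) /\ ci (-1) 2 = beside A (~~ a) (i - 1) (i - 1).
Proof.
exists b; rewrite /beside stepE subrK E02 E01 /cell_image /frame.
by case: (near0_cases nu) => ->; case: b; split; apply: pt_eq => /=; lia.
Qed.

End Config.

Lemma le_jump (a b : int) :
  ((a <= b)%R : nat)%:Z - ((a <= b - 1)%R : nat)%:Z = (a == b)%:Z.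
Proof. by lia. Qed.

(** * Existence of the height function *)

Section PartialSums.
Variables (P : {fset point}) (d : point -> int).
Hypothesis d_off : forall p, p \notin V P -> d p = 0.
Hypothesis d_vertical : forall I : maxV P, \sum_(r : V P | vmax r == I) d (val r) = 0.
Hypothesis d_horizontal : forall I : maxH P, \sum_(r : V P | hmax r == I) d (val r) = 0.

Definition quadrant_sum (q : point) : int :=
  \sum_(r : V P) d (val r) * ((((val r).1 <= q.1)%R : nat)%:Z * (((val r).2 <= q.2)%R : nat)%:Z).

Lemma D_quadrant_sum (p : point) : D quadrant_sum p = d p.
Proof.
rewrite /D /quadrant_sum -!sumrN -!big_split /=.
transitivity (\sum_(r : V P) d (val r) * (val r == p)%:Z).
  apply: eq_bigr => r _; rewrite ptE.
  have Hn (Q Q' : bool) : (Q && Q')%:Z = Q%:Z * Q'%:Z by case: Q; case: Q'.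
  rewrite Hn -!le_jump; ring.
case: (boolP (p \in V P)) => pV; last first.
  rewrite (d_off pV) big1 // => r _; case: eqP => [E|]; last by rewrite mulr0.
  by move: pV; rewrite -E (valP r).
rewrite (bigD1 [` pV]%fset) //= eqxx mulr1 big1 ?addr0 // => r.
by rewrite -val_eqE /= => /negbTE ->; rewrite mulr0.
Qed.

Lemma vmax_in (r : V P) : val r \in pts (val (vmax r)).
Proof. exact: xchooseP (ex_maxV r). Qed.

Lemma hmax_in (r : V P) : val r \in pts (val (hmax r)).
Proof. exact: xchooseP (ex_maxH r). Qed.

(** The difference is the sum of d over the column x up to height y. No edge interval crosses the
    missing edge, so this is a union of whole maximal intervals, each of sum zero. *)
Lemma quadrant_vertical (x y : int) : ((x, y), (x, y + 1)) \notin edges P ->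
  quadrant_sum (x, y) = quadrant_sum (x - 1, y).
Proof.
move=> Ne; apply/eqP; rewrite -subr_eq0 /quadrant_sum -sumrB; apply/eqP.
pose Q (I : maxV P) := ((val I).1.1 == x) && ((val I).2.2 <= y).
transitivity (\sum_(r : V P | Q (vmax r)) d (val r)).
  rewrite [RHS]big_mkcond; apply: eq_bigr => r _ /=.
  have rI := vmax_in r; have := valP (vmax r); rewrite in_maxV => /andP[/maximalP[eI _] vI].
  have -> : Q (vmax r) = ((val r).1 == x) && ((val r).2 <= y).
    move: rI eI vI; rewrite /Q; case: (val (vmax r)) => [[a b] [a' b']]; case: (val r) => u v.
    rewrite inE /= => rI eI vI; move: (vI) eI => /andP[/= /eqP Ea lb].
    rewrite vert_edge_interval // => /(all_vsegments P vI) /= seg.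
    apply/idP/idP => H; first by move: H rI; rewrite -Ea; clear; lia.
    have [-> le] : a = x /\ v <= y by move: H rI; rewrite -Ea; clear; lia.
    rewrite eqxx leNgt; apply/negP => lt; move/negP: Ne; apply.
    have Eax : a = x by move: H rI; rewrite -Ea; clear; lia.
    by rewrite -Eax; apply: seg; move: rI le lt; clear; lia.
  rewrite -mulrBr -mulrBl le_jump.
  by case: (_ == x); case: (_ <= y); rewrite /= ?mulr1 ?mul0r ?mulr0.
rewrite (partition_big (@vmax P) Q) //= big1 // => I QI.
rewrite -[RHS](d_vertical I); apply: eq_bigl => r.
by case: eqP => [->|]; rewrite ?andbF // QI.
Qed.

Lemma quadrant_horizontal (x y : int) : ((x, y), (x + 1, y)) \notin edges P ->
  quadrant_sum (x, y) = quadrant_sum (x, y - 1).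
Proof.
move=> Ne; apply/eqP; rewrite -subr_eq0 /quadrant_sum -sumrB; apply/eqP.
pose Q (I : maxH P) := ((val I).1.2 == y) && ((val I).2.1 <= x).
transitivity (\sum_(r : V P | Q (hmax r)) d (val r)).
  rewrite [RHS]big_mkcond; apply: eq_bigr => r _ /=.
  have rI := hmax_in r; have := valP (hmax r); rewrite in_maxH => /andP[/maximalP[eI _] vI].
  have -> : Q (hmax r) = ((val r).2 == y) && ((val r).1 <= x).
    move: rI eI vI; rewrite /Q; case: (val (hmax r)) => [[a b] [a' b']]; case: (val r) => u v.
    rewrite inE /= => rI eI vI; move: (vI) eI => /andP[/= /eqP Ea lb].
    rewrite hor_edge_interval // => /(all_hsegments P vI) /= seg.
    apply/idP/idP => H; first by move: H rI; rewrite -Ea; clear; lia.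
    have [-> le] : b = y /\ u <= x by move: H rI; rewrite -Ea; clear; lia.
    rewrite eqxx leNgt; apply/negP => lt; move/negP: Ne; apply.
    have Eax : b = y by move: H rI; rewrite -Ea; clear; lia.
    by rewrite -Eax; apply: seg; move: rI le lt; clear; lia.
  rewrite -!mulrBr le_jump.
  by case: (_ == y); case: (_ <= x); rewrite /= ?mulr1 ?mul0r ?mulr0.
rewrite (partition_big (@hmax P) Q) //= big1 // => I QI.
rewrite -[RHS](d_horizontal I); apply: eq_bigl => r.
by case: eqP => [->|]; rewrite ?andbF // QI.
Qed.

Lemma vertical_edge_cell (x y : int) : ((x, y), (x, y + 1)) \in edges P ->
  (x, y) \in P \/ (x - 1, y) \in P.
Proof.
case/edges_P => -[a b] cP /sides_cellE /= [] [] E1 E2.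
- by move=> E3 E4; exfalso; lia.
- by move=> E3 E4; exfalso; lia.
- by move=> E3 E4; left; rewrite E1 E2.
- by move=> E3 E4; right; rewrite E1 E2 addrK.
Qed.

Lemma horizontal_edge_cell (x y : int) : ((x, y), (x + 1, y)) \in edges P ->
  (x, y) \in P \/ (x, y - 1) \in P.
Proof.
case/edges_P => -[a b] cP /sides_cellE /= [] [] E1 E2.
- by move=> E3 E4; left; rewrite E1 E2.
- by move=> E3 E4; right; rewrite E1 E2 addrK.
- by move=> E3 E4; exfalso; lia.
- by move=> E3 E4; exfalso; lia.
Qed.

Lemma quadrant_near (p q : point) : p \notin P -> q \notin P -> near p q ->
  quadrant_sum p = quadrant_sum q.
Proof.
have V1 (x y : int) : (x, y) \notin P -> (x - 1, y) \notin P ->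
    quadrant_sum (x, y) = quadrant_sum (x - 1, y).
  move=> n1 n2; apply: quadrant_vertical; apply/negP => /vertical_edge_cell[].
    by rewrite (negbTE n1).
  by rewrite (negbTE n2).
have H1 (x y : int) : (x, y) \notin P -> (x, y - 1) \notin P ->
    quadrant_sum (x, y) = quadrant_sum (x, y - 1).
  move=> n1 n2; apply: quadrant_horizontal; apply/negP => /horizontal_edge_cell[].
    by rewrite (negbTE n1).
  by rewrite (negbTE n2).
case: p q => [x y] [x' y'] n1 n2; rewrite /near /= => nr.
have [[Ex Ey]|[[Ex Ey]|[[Ex Ey]|[Ex Ey]]]] : (x' = x - 1 /\ y' = y) \/ (x = x' - 1 /\ y = y') \/
    (x' = x /\ y' = y - 1) \/ (x = x' /\ y = y' - 1) by clear -nr; lia.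
- by subst; apply: V1.
- by subst; symmetry; apply: V1.
- by subst; apply: H1.
- by subst; symmetry; apply: H1.
Qed.

Lemma quadrant_left (q : point) : (forall c : point, c \in P -> q.1 < c.1) -> quadrant_sum q = 0.
Proof.
move=> left; rewrite /quadrant_sum big1 // => r _.
have aux (x c : point) : x \in corners (cell c) -> q.1 < c.1 -> (x.1 <= q.1) = false.
  by rewrite corners_cellE; lia.
have /V_P[c cP rc] := valP r.
rewrite (aux _ _ rc (left c cP)).
by rewrite mul0r mulr0.
Qed.

End PartialSums.

Section Setting.
Variables (P : {fset point}) (t u : point) (b : bool).
Hypothesis nu : near u (0, 0).
Variables (A : int -> point) (n : nat).
Hypothesis cw : closed_walk A n.
Hypothesis PA : forall x, x \in P <-> exists i : int, x = A i.
Notation ci x y := (cell_image t u b (x, y)).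
Notation fr x y := (frame t u b (x, y)).
Variable i : int.
Hypotheses (E02 : A (i - 1) = ci 0 2) (E01 : A i = ci 0 1) (E11 : A (i + 1) = ci 1 1)
  (E10 : A (i + 1 + 1) = ci 1 0) (E20 : A (i + 1 + 1 + 1) = ci 2 0).
Hypothesis ladder : ci (-1) 2 \notin P.

Notation special := [:: fr 0 2; fr 1 2; fr 0 1; fr 1 1; fr 1 0].

Lemma special_sum (c : point -> int) : \sum_(p <- special) D c p =
  sg (b == (u.2 == 0)) * (c (ci 1 2) - c (ci (-1) 2) + (c (ci (-1) 0) - c (ci 0 0))
    + (c (ci 0 (-1)) - c (ci 1 (-1)))).
Proof. by rewrite !big_cons big_nil !D_frame //= !mulrDr; ring. Qed.

Lemma special_sum0 (c : point -> int) : (forall x, x \notin P -> c x = 0) ->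
  \sum_(p <- special) D c p = 0.
Proof.
move=> off; have [o1 o2 o3 o4 o5] := config_off nu cw PA E02 E01 E11 E10 E20.
by rewrite special_sum !off // mulr0.
Qed.

Lemma special_uniq : uniq special.
Proof.
rewrite -[special]/(map (frame t u b) [:: (0, 2); (1, 2); (0, 1); (1, 1); (1, 0)]).
by rewrite map_inj_uniq //; apply: frame_inj.
Qed.

Lemma count_special (q : point) : \sum_(p <- special) (p == q)%:Z = (q \in special)%:Z.
Proof.
case: (boolP (q \in special)) => qs.
  rewrite (bigD1_seq q) ?special_uniq //= eqxx big1_seq ?addr0 // => p /andP[/negbTE -> _] //.
rewrite big1_seq // => p /andP[_ ps].
by case: eqP => // E; rewrite -E ps in qs.
Qed.

(** Apply [special_sum0] to the indicator of I, whose mixed difference counts the four corners with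
    signs. *)
Lemma special_balanced (I : interval) : inner_interval P I ->
  ((I.1 \in special) + (I.2 \in special) = (ulc I \in special) + (lrc I \in special))%N.
Proof.
move=> [pI inP]; have off x : x \notin P -> ind I x = 0.
  by move=> xP; rewrite /ind; case: (boolP (subitv _ _)) => // /inP; rewrite (negbTE xP).
have := special_sum0 off; under eq_bigr do rewrite D_ind //.
rewrite !sumrB big_split /= !count_special.
by move: (_ \in _) (_ \in _) (_ \in _) (_ \in _) => [] [] [] [].
Qed.

(** The quadrant sums are constant on each side of the path. The special points compare one cell
    from each side and make the two constants equal; a cell left of the path shows that they are
    zero. *)
Lemma height_exists (d : point -> int) : (forall p, p \notin V P -> d p = 0) ->
  (forall I : maxV P, \sum_(r : V P | vmax r == I) d (val r) = 0) ->
  (forall I : maxH P, \sum_(r : V P | hmax r == I) d (val r) = 0) ->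
  \sum_(p <- special) d p = 0 ->
  exists c, (forall x, x \notin P -> c x = 0) /\ forall p, D c p = d p.
Proof.
move=> off dV dH dS; pose C := quadrant_sum P d.
have Cnear p q : p \notin P -> q \notin P -> near p q -> C p = C q.
  exact: quadrant_near dV dH p q.
have DC p : D C p = d p by apply: D_quadrant_sum.
exists C; split=> //.
have [o1 o2 o3 o4 o5] := config_off nu cw PA E02 E01 E11 E10 E20.
(* The other four cells in [special_sum] form two adjacent pairs off the path and cancel. *)
have E12 : C (ci 1 2) = C (ci (-1) 2).
  have : \sum_(p <- special) D C p = 0 by rewrite -[RHS]dS; apply: eq_bigr.
  rewrite special_sum.
  rewrite (Cnear (ci (-1) 0) (ci 0 0)) ?near_cell_image // subrr addr0.
  rewrite (Cnear (ci 0 (-1)) (ci 1 (-1))) ?near_cell_image // subrr addr0.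
  by move=> /eqP; rewrite mulf_eq0 subr_eq0; case: (_ == (u.2 == 0)) => /= /eqP.
have sideE : side_value A C true 0 = side_value A C false 0.
  have [a [e1 e2]] := config_sides nu E02 E01.
  have st a' : beside A a' (i - 1) (i - 1) \notin P ->
      C (beside A a' (i - 1) (i - 1)) = side_value A C a' 0.
    rewrite (side_const cw PA Cnear a' 0 (i - 1)) /side_value; case: ifP => // /(turn_prev cw) <-.
    by move/negP; case; apply/PA; eexists.
  move: E12; rewrite e1 e2 !st -?e1 -?e2 //.
  by case: (a).
have nearE p q : p \in P -> q \notin P -> near p q -> C q = side_value A C true 0.
  move=> /PA[k ->] qP nr; have [a ->] := side_near cw PA Cnear qP nr.
  by case: a; rewrite ?sideE.
(* The left neighbour of a leftmost cell touches the path and has quadrant sum zero. *)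
have [c0 c0P min] : exists2 c0 : point, c0 \in P & forall c : point, c \in P -> c0.1 <= c.1.
  have iP : A i \in P by apply/PA; exists i.
  have [[p pP] _ minp] := @arg_minP _ _ _ [` iP]%fset predT (fun p : P => (val p).1) isT.
  by exists p => // c cP; apply: (minp [` cP]%fset).
have left0 (q : point) : q.1 < c0.1 -> C q = 0.
  by move=> lt; apply: quadrant_left => c /min; apply: lt_le_trans.
have lq : (c0.1 - 1, c0.2) \notin P.
  by apply/negP => /min /=; clear; lia.
have side0 : side_value A C true 0 = 0.
  rewrite -(nearE c0 (c0.1 - 1, c0.2)) // ?left0 //=; first by clear; lia.
  by rewrite /near /=; clear; lia.
(* Go left from q until reaching the path, where the side value is zero, or the region left of
   it. *)
have all0 (m : nat) (q : point) : q \notin P -> q.1 < c0.1 + m%:Z -> C q = 0.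
  elim: m q => [|m IH] q qP lt; first by apply: left0; rewrite addr0 in lt.
  have nr : near (q.1 - 1, q.2) q by rewrite /near /=; clear; lia.
  case: (boolP ((q.1 - 1, q.2) \in P)) => q'P; first by rewrite (nearE _ q q'P qP nr).
  by rewrite -(Cnear _ _ q'P qP nr); apply: IH => //; move: lt => /=; clear; lia.
suff H (q : point) : q \notin P -> C q = 0 by exact: H.
by move=> qP; apply: (all0 (`|(q.1 - c0.1)%R|.+1)%N) => //; clear; lia.
Qed.

End Setting.

Section EdgeMax.
Variable P : {fset point}.

(** The union of the two intervals is an edge interval, so maximality forces inclusion. *)
Lemma subitv_vmax (E : interval) (r : V P) : edge_interval P E -> vertical E ->
  val r \in pts E -> subitv E (val (vmax r)).
Proof.
move=> eE vE rE; have rI := vmax_in r.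
have := valP (vmax r); rewrite in_maxV => /andP[/maximalP[eI mI] vI].
move: rE rI eI vI mI; move: (val (vmax r)) (val r) => I x rE rI eI vI mI.
case: E I x eE vE rE rI eI vI mI => [[a lo] [a1 hi]] [[a2 lo'] [a3 hi']] [x y] eE vE rE rI eI vI mI.
move: rE rI (vE) (vI); rewrite !inE /vertical /= => rE rI vE' vI'.
pose U : interval := ((a, Num.min lo lo'), (a, Num.max hi hi')).
have vU : vertical U by rewrite /vertical /=; clear -vE' vI' rE rI; lia.
have eU : edge_interval P U.
  move: eE eI; rewrite !vert_edge_interval // => /(all_vsegments P vE) sE /(all_vsegments P vI) sI.
  apply/(all_vsegments P vU) => z /= zP; have Ea : a2 = a by clear -rE rI vE' vI'; lia.
  have [?|?] := boolP (lo <= z < hi); first exact: sE.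
  by rewrite -Ea; apply: sI => /=; move: zP rE rI vE' vI'; lia.
have sub : subitv ((a2, lo'), (a3, hi')) U.
  by rewrite /subitv !inE /=; clear -rE rI vE' vI'; lia.
by rewrite (mI U eU sub) /subitv !inE /=; clear -rE rI vE' vI'; lia.
Qed.

Lemma subitv_hmax (E : interval) (r : V P) : edge_interval P E -> horizontal E ->
  val r \in pts E -> subitv E (val (hmax r)).
Proof.
move=> eE vE rE; have rI := hmax_in r.
have := valP (hmax r); rewrite in_maxH => /andP[/maximalP[eI mI] vI].
move: rE rI eI vI mI; move: (val (hmax r)) (val r) => I x rE rI eI vI mI.
case: E I x eE vE rE rI eI vI mI => [[lo a] [hi a1]] [[lo' a2] [hi' a3]] [x y] eE vE rE rI eI vI mI.
move: rE rI (vE) (vI); rewrite !inE /horizontal /= => rE rI vE' vI'.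
pose U : interval := ((Num.min lo lo', a), (Num.max hi hi', a)).
have vU : horizontal U by rewrite /horizontal /=; clear -vE' vI' rE rI; lia.
have eU : edge_interval P U.
  move: eE eI; rewrite !hor_edge_interval // => /(all_hsegments P vE) sE /(all_hsegments P vI) sI.
  apply/(all_hsegments P vU) => z /= zP; have Ea : a2 = a by clear -rE rI vE' vI'; lia.
  have [?|?] := boolP (lo <= z < hi); first exact: sE.
  by rewrite -Ea; apply: sI => /=; move: zP rE rI vE' vI'; lia.
have sub : subitv ((lo', a2), (hi', a3)) U.
  by rewrite /subitv !inE /=; clear -rE rI vE' vI'; lia.
by rewrite (mI U eU sub) /subitv !inE /=; clear -rE rI vE' vI'; lia.
Qed.

Lemma vmax_eq (I : interval) (r r' : V P) : inner_interval P I -> (val r).1 = (val r').1 ->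
  (val r).1 = I.1.1 \/ (val r).1 = I.2.1 -> val r \in pts I -> val r' \in pts I ->
  vmax r = vmax r'.
Proof.
move=> iI E xE rI r'I; have eE := vertical_side iI xE.
have vE : vertical (((val r).1, I.1.2), ((val r).1, I.2.2)).
  by case: iI => /andP[_ lb] _; rewrite /vertical /= eqxx.
have inE' (x y : point) : y.1 = x.1 -> x \in pts I -> x \in pts ((y.1, I.1.2), (y.1, I.2.2)).
  by rewrite !inE /=; clear; lia.
have s1 := subitv_vmax eE vE (inE' _ _ erefl rI).
apply: maxV_inj (vmax_in r') => //; last exact: (subitv_pts s1 (inE' _ _ E r'I)).
Qed.

Lemma hmax_eq (I : interval) (r r' : V P) : inner_interval P I -> (val r).2 = (val r').2 ->
  (val r).2 = I.1.2 \/ (val r).2 = I.2.2 -> val r \in pts I -> val r' \in pts I ->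
  hmax r = hmax r'.
Proof.
move=> iI E xE rI r'I; have eE := horizontal_side iI xE.
have vE : horizontal ((I.1.1, (val r).2), (I.2.1, (val r).2)).
  by case: iI => /andP[lb _] _; rewrite /horizontal /= eqxx.
have inE' (x y : point) : y.2 = x.2 -> x \in pts I -> x \in pts ((I.1.1, y.2), (I.2.1, y.2)).
  by rewrite !inE /=; clear; lia.
have s1 := subitv_hmax eE vE (inE' _ _ erefl rI).
apply: maxH_inj (hmax_in r') => //; last exact: (subitv_pts s1 (inE' _ _ E r'I)).
Qed.

End EdgeMax.

(** * The toric ideal *)

Section Toric.
Variables (K : fieldType) (P : {fset point}) (s : point -> point).

Notation S := (ring_S K P).
Notation T := (ring_T K P).
Notation x_ := (@x_ K P).
Notation TV := (toric_vars P).

Definition special (r : V P) : nat := val r \in special_points s.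

Definition multidegree (r : V P) : 'X_{1..#|TV|} :=
  (U_(enum_rank (inl (inl (vmax r)) : TV)) + U_(enum_rank (inl (inr (hmax r)) : TV)) +
   U_(enum_rank (inr tt : TV)) *+ special r)%MM.

Lemma alpha_monomial (r : V P) : alpha K s r = 'X_[multidegree r].
Proof. by rewrite /alpha /v_ /h_ /w_ /var /multidegree !mpolyXD mpolyXn. Qed.

Lemma psi_x (r : V P) : psi s (x_ r) = alpha K s r.
Proof. by rewrite /psi /Defs.x_ /var mmapX mmap1U enum_rankK. Qed.

Definition degree_map (m : 'X_{1..#|{: V P}|}) : 'X_{1..#|TV|} :=
  (\sum_(i < #|{: V P}|) multidegree (enum_val i) *+ m i)%MM.

Lemma psi_monomials (f : S) :
  psi s f = \sum_(m <- msupp f) f@_m *: 'X_[degree_map m].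
Proof.
rewrite /psi /mmap; apply: eq_bigr => m _; rewrite mul_mpolyC; congr (_ *: _).
rewrite /mmap1 /degree_map (big_morph (fun m => 'X_[m] : T) (@mpolyXD _ _) (mpolyX0 _ _)).
apply: eq_bigr => i _.
by rewrite alpha_monomial mpolyXn.
Qed.

Definition tokens (m : 'X_{1..#|{: V P}|}) (p : point) : nat :=
  if insub p is Some r then m (enum_rank (r : V P)) else 0%N.

Lemma tokens_val (m : 'X_{1..#|{: V P}|}) (r : V P) : tokens m (val r) = m (enum_rank r).
Proof. by rewrite /tokens valK. Qed.

Lemma tokens_off (m : 'X_{1..#|{: V P}|}) p : p \notin V P -> tokens m p = 0%N.
Proof. by move=> pV; rewrite /tokens insubN. Qed.

Lemma mon_tokens (m : 'X_{1..#|{: V P}|}) : mon K P (tokens m) = 'X_[m].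
Proof.
rewrite mpolyXE_id /mon [RHS](reindex (@enum_rank _)); last exact/onW_bij/enum_rank_bij.
by apply: eq_bigr => r _; rewrite tokens_val.
Qed.

Lemma degree_mapE (m : 'X_{1..#|{: V P}|}) (y : TV) : degree_map m (enum_rank y) =
  (\sum_(r : V P) ((inl (inl (vmax r)) == y) + (inl (inr (hmax r)) == y) +
     (inr tt == y) * special r) * tokens m (val r))%N.
Proof.
rewrite /degree_map mnm_sumE (reindex (@enum_rank _)); last exact/onW_bij/enum_rank_bij.
apply: eq_bigr => r _; rewrite mulmnE tokens_val enum_rankK; congr (_ * _)%N.
by rewrite !mnmDE mulmnE !mnm1E !(inj_eq enum_rank_inj).
Qed.

Lemma degree_vertical (m : 'X_{1..#|{: V P}|}) (I : maxV P) :
  degree_map m (enum_rank (inl (inl I) : TV)) = (\sum_(r : V P | vmax r == I) tokens m (val r))%N.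
Proof.
rewrite degree_mapE [RHS]big_mkcond; apply: eq_bigr => r _.
have -> : (inl (inl (vmax r)) == inl (inl I) :> TV) = (vmax r == I) by [].
by case: (vmax r == I); rewrite ?mul1n.
Qed.

Lemma degree_horizontal (m : 'X_{1..#|{: V P}|}) (I : maxH P) :
  degree_map m (enum_rank (inl (inr I) : TV)) = (\sum_(r : V P | hmax r == I) tokens m (val r))%N.
Proof.
rewrite degree_mapE [RHS]big_mkcond; apply: eq_bigr => r _.
have -> : (inl (inr (hmax r)) == inl (inr I) :> TV) = (hmax r == I) by [].
by case: (hmax r == I); rewrite ?mul1n.
Qed.

Lemma degree_special (m : 'X_{1..#|{: V P}|}) :
  degree_map m (enum_rank (inr tt : TV)) = (\sum_(r : V P) special r * tokens m (val r))%N.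
Proof. by rewrite degree_mapE; apply: eq_bigr => r _; rewrite eqxx mul1n. Qed.

Hypothesis special_inner : forall I : interval, inner_interval P I ->
  ((I.1 \in special_points s) + (I.2 \in special_points s) =
   (ulc I \in special_points s) + (lrc I \in special_points s))%N.

Lemma alpha_inner (I : interval) (a c d e : V P) : inner_interval P I ->
  val a = I.1 -> val c = I.2 -> val d = ulc I -> val e = lrc I ->
  alpha K s a * alpha K s c = alpha K s d * alpha K s e.
Proof.
move=> iI Ea Ec Ed Ee; have sp := special_inner iI; have [pI _] := iI.
have q : quad true I (val a) (val c) (val d) (val e).
  by rewrite /quad Ea Ec Ed Ee !eqxx.
have [ia ic id ie] := quad_pts pI q.
have v1 : vmax a = vmax d.
  by apply: (vmax_eq iI) => //; rewrite Ea ?Ed; [|left].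
have v2 : vmax c = vmax e.
  by apply: (vmax_eq iI) => //; rewrite Ec ?Ee; [|right].
have h1 : hmax a = hmax e.
  by apply: (hmax_eq iI) => //; rewrite Ea ?Ee; [|left].
have h2 : hmax c = hmax d.
  by apply: (hmax_eq iI) => //; rewrite Ec ?Ed; [|right].
rewrite /alpha v1 v2 h1 h2 Ea Ec Ed Ee.
transitivity (v_ K (vmax d) * h_ K (hmax e) * (v_ K (vmax e) * h_ K (hmax d)) *
  w_ K P ^+ ((I.1 \in special_points s) + (I.2 \in special_points s))).
  by rewrite exprD; ring.
by rewrite sp exprD; ring.
Qed.

Lemma alpha_quad t I (p q r r' : V P) : inner_interval P I ->
  quad t I (val p) (val q) (val r) (val r') ->
  alpha K s p * alpha K s q = alpha K s r * alpha K s r'.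
Proof.
move=> iI; have A0 := alpha_inner iI; rewrite /quad; case: t => /= /andP[];
  case/orP => /andP[/eqP E1 /eqP E2]; case/orP => /andP[/eqP E3 /eqP E4].
- exact: A0.
- by rewrite [RHS]mulrC; apply: A0.
- by rewrite mulrC; apply: A0.
- by rewrite mulrC [RHS]mulrC; apply: A0.
- by symmetry; apply: A0.
- by rewrite mulrC; symmetry; apply: A0.
- by rewrite [RHS]mulrC; symmetry; apply: A0.
- by rewrite mulrC [RHS]mulrC; symmetry; apply: A0.
Qed.

Lemma psi_f_walk (W : zigzag_walk P) : psi s (f_walk K W) = 0.
Proof.
pose l := zz_len W.
have E (i : 'I_l) : alpha K s (zz_v i) * alpha K s (zz_z i) =
    alpha K s (zz_u i) * alpha K s (zz_v (ordS i)).
  have [pI _] := zz_inner i.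
  have [c q] : exists c, quad c (zz_I i) (val (zz_v i)) (val (zz_z i)) (val (zz_u i))
      (val (zz_v (ordS i))).
    by case: (zz_corners i) => -[e1 e2]; [exists true|exists false]; apply: fset_quad.
  exact: alpha_quad (zz_inner i) q.
have nz (r : V P) : alpha K s r != 0.
  rewrite alpha_monomial; apply/eqP => /(congr1 (mcoeff (multidegree r))).
  by rewrite mcoeffX eqxx mcoeff0 => /eqP; rewrite oner_eq0.
rewrite /f_walk /psi rmorphB !rmorph_prod /=.
under eq_bigr do rewrite -/(psi s _) psi_x; under [X in _ - X]eq_bigr do rewrite -/(psi s _) psi_x.
apply/eqP; rewrite subr_eq0; apply/eqP.
have nzv : \prod_(i < l) alpha K s (zz_v i) != 0 by apply/prodf_neq0 => i _.
apply: (mulfI nzv); rewrite -big_split /= (eq_bigr _ (fun i _ => E i)) big_split /= mulrC.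
by congr (_ * _); rewrite [RHS](reindex_inj (@ordS_inj l)).
Qed.

Lemma ideal_sub_toric (f : S) :
  ideal_add (ideal_I K P) (ideal_Z K P) f -> ideal_J K P s f.
Proof.
have gen (G : S -> Prop) (g : S) : (forall h, G h -> psi s h = 0) -> ideal_gen G g -> psi s g = 0.
  move=> G0 [L [LG ->]]; rewrite /psi rmorph_sum /= big1_seq // => x /andP[_ xL].
  by rewrite rmorphM /= -/(psi s x.2) G0 ?mulr0 //; apply: LG.
case=> g [h [Ig Zh ->]]; rewrite /ideal_J /psi rmorphD /= -!/(psi s _).
rewrite (gen _ _ _ Ig) ?(gen _ _ _ Zh) ?addr0 //.
  by move=> _ [W ->]; apply: psi_f_walk.
move=> _ [a [c [d [e [iI Ed Ee ->]]]]]; rewrite /psi rmorphB !rmorphM /= -!/(psi s _) !psi_x.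
by rewrite (alpha_inner iI (a := a) (c := c) (d := d) (e := e)) ?subrr.
Qed.

End Toric.

Lemma sum_special (P : {fset point}) (t u : point) (b : bool) (g : point -> int) :
  near u (0, 0) -> (forall p, p \notin V P -> g p = 0) ->
  let sp := map (frame t u b) [:: (0, 2); (1, 2); (0, 1); (1, 1); (1, 0)] in
  \sum_(p <- sp) g p = \sum_(r : V P) (val r \in sp)%:Z * g (val r).
Proof.
move=> nu off sp.
transitivity (\sum_(p <- sp) \sum_(r : V P) (p == val r)%:Z * g (val r)); last first.
  rewrite exchange_big /=; apply: eq_bigr => r _.
  by rewrite -mulr_suml (count_special _ _ nu).
apply: eq_bigr => p _; case: (boolP (p \in V P)) => pV; last first.
  rewrite off // big1 // => r _; case: eqP => [E|]; last by rewrite mul0r.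
  by move: pV; rewrite E (valP r).
rewrite (bigD1 [` pV]%fset) //= eqxx mul1r big1 ?addr0 // => r.
by rewrite -val_eqE /= eq_sym => /negbTE ->; rewrite mul0r.
Qed.

Theorem theorem4p16 (K : fieldType) (P : {fset point})
    (hP : closed_path P) (hW : inhabited (zigzag_walk P))
    (s : point -> point) (hs : special_configuration P s) :
  forall f : ring_S K P,
    ideal_add (ideal_I K P) (ideal_Z K P) f <-> ideal_J K P s f.
Proof.
have [A0 [n [cw0 PA0]]] := closed_path_walk hP.
case: hs => /isometry_frame[t [u [b [nu sE]]]] conf.
have confP x : x \in [:: (0, 2); (0, 1); (1, 1); (1, 0); (2, 0)] -> cell_image t u b x \in P.
  move=> /conf[c' c'P E]; apply: (cell_imageP nu); exists c' => //.
  by rewrite -E; apply: eq_imfset => // p; rewrite sE.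
have [A [i [cw PA [E02 E01 E11 E10 E20]]]] := oriented_walk nu cw0 PA0 confP.
have ladder : cell_image t u b (-1, 2) \notin P.
  apply/negP => inP; case: hW => W.
  have corners := config_corners nu cw PA E02 E01 E11 E10 E20 inP.
  exact: (@zigzag_no_four_corners P A n cw PA W (i - 1) corners).
have spE : special_points s = map (frame t u b) [:: (0, 2); (1, 2); (0, 1); (1, 1); (1, 0)].
  exact: eq_map.
have inner I : inner_interval P I ->
    ((I.1 \in special_points s) + (I.2 \in special_points s) =
     (ulc I \in special_points s) + (lrc I \in special_points s))%N.
  by move=> iI; rewrite spE; apply: (special_balanced nu cw PA E02 E01 E11 E10 E20 ladder iI).
move=> f; split; first exact: ideal_sub_toric.
rewrite /ideal_J psi_monomials => f0.
apply: (monomial_kernel (phi := degree_map s)) f0 => [||a p|m m' Em].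
- exact: ideal_add0.
- exact: ideal_addD.
- exact: ideal_addM.
pose tok b := if b then tokens m else tokens m'.
pose d p := (tokens m' p)%:Z - (tokens m p)%:Z.
have dsum (Q : pred (V P)) : \sum_(r | Q r) d (val r) =
    (\sum_(r | Q r) tokens m' (val r))%N%:Z - (\sum_(r | Q r) tokens m (val r))%N%:Z.
  by rewrite sumrB !(big_morph Posz PoszD (erefl _)).
have [| | | |c [coff Dc]] := height_exists nu cw PA E02 E01 E11 E10 E20 ladder (d := d).
- by move=> p pV; rewrite /d !tokens_off.
- by move=> I; rewrite dsum -!(degree_vertical s) Em subrr.
- by move=> I; rewrite dsum -!(degree_horizontal s) Em subrr.
- transitivity (\sum_(p <- special_points s) d p); first by rewrite spE.
  have := sum_special (P := P) t b (g := d) nu; rewrite -spE /= => ->; last first.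
    by move=> p pV; rewrite /d !tokens_off.
  have := degree_special s m'; have := degree_special s m; rewrite Em => -> E.
  rewrite (eq_bigr (fun r : V P => (special s r * tokens m' (val r))%N%:Z -
     (special s r * tokens m (val r))%N%:Z)) => [|r _]; last by rewrite mulrBr !PoszM.
  by rewrite sumrB -!(big_morph Posz PoszD (erefl _)) E subrr.
have bal : balanced P tok c by split=> // p; rewrite Dc.
by have := similar_reduction cw PA K bal; rewrite /similar !mon_tokens.
Qed.
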